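(* For every integer $\nu$ with $0\le\nu\le p-3$ one has $$a(z)^2\,\partial^\nu a(z)=0$$ on $V$ (where $\partial=d/dz$). Equivalently, for any $d$ and any $\nu$ with $0\le\nu\le p-3$, the sum $$\sum_{\substack{i,j,k>0\\ i+j+k=d}}(k-1)(k-2)\cdots(k-\nu)\,\xi_{-i}\xi_{-j}\xi_{-k}$$ belongs to $\mathfrak{a}_3=\mathfrak{a}\cap A_3$.
   Context: Setting. Let $p\ge 4$ be an integer not divisible by $3$, $c'=1-\frac{2(p-3)^2}{p}$. Let $M_{1,1}$, $M_{2,1}$ be the irreducible highest weight modules over the Virasoro algebra (modes $L'_n$, current $T'(z)=\sum_n L'_n z^{-n-2}$) with central charge $c'$, highest weights $0$ and $\frac{p-2}{4}$, and highest weight vectors $|1,1\rangle$, $|2,1\rangle$. Let $\psi(z)$ be the $(2,1)$ primary field of the $(3,p)$ Virasoro minimal model, acting $M_{1,1}\to M_{2,1}$ with expansion $\psi(z)=\sum_{n\in\mathbb{Z}}\psi_n z^{-n}$ and $M_{2,1}\to M_{1,1}$ with expansion $\psi(z)=\sum_{n\in\mathbb{Z}}\psi_n z^{-n-\frac{p-2}{2}}$; it is characterized by $[L'_m,\psi(z)]=z^m\bigl(z\frac{d}{dz}+(m+1)\frac{p-2}{4}\bigr)\psi(z)$ and $\psi_0|1,1\rangle=|2,1\rangle$, $\psi_0|2,1\rangle=|1,1\rangle$. Matrix elements of $(z-w)^{(p-2)/2}\psi(z)\psi(w)$ continue analytically to $\mathbb{C}^\times\times\mathbb{C}^\times$, coincide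 with those of $(w-z)^{(p-2)/2}\psi(w)\psi(z)$, and expand as $I+\frac{p-2}{2c'}(z-w)^2T'(w)+O((z-w)^3)$ as $z\to w$. Let $h_n$ ($n\in\mathbb{Z}$) generate the Heisenberg algebra $[h_m,h_n]=m\delta_{m+n,0}$, and let $\mathcal{F}_\gamma=\mathbb{C}[h_{-1},h_{-2},\dots]|\gamma\rangle$ be the Fock space with $h_n|\gamma\rangle=0$ ($n>0$), $h_0|\gamma\rangle=\gamma|\gamma\rangle$. Let $\phi_\alpha(z)=\exp\bigl(-\alpha\sum_{n<0}\frac{h_n}{n}z^{-n}\bigr)e^{\alpha Q}z^{\alpha h_0}\exp\bigl(-\alpha\sum_{n>0}\frac{h_n}{n}z^{-n}\bigr):\mathcal{F}_\gamma\to\mathcal{F}_{\gamma+\alpha}$, where $e^{\alpha Q}$ is the isomorphism $\mathcal{F}_\gamma\to\mathcal{F}_{\gamma+\alpha}$ commuting with $h_n$, $n\ne0$, and sending $|\gamma\rangle$ to $|\gamma+\alpha\rangle$. Put $\beta=\sqrt{(p-2)/2}$, $V=\bigoplus_{n\in\mathbb{Z}}V_n$ with $V_n=M_{1,1}\otimes\mathcal{F}_{n\beta}$ for $n$ even and $V_n=M_{2,1}\otimes\mathcal{F}_{n\beta}$ for $n$ odd, and $a(z)=\psi(z)\phi_\beta(z)=\sum_{n\in\mathbb{Z}}a_nz^{-n-1}$, $a_n\in\mathrm{End}(V)$ ($\psi$ acts on the first tensor factor, $\phi_\beta$ on the second). The $a_n$ commute with each other, and products of $a(z)$ and its derivatives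 at the same point $z$ have coefficients that are well-defined operators on $V$. Let $v_0=|1,1\rangle\otimes|0\rangle$. $A=\mathbb{C}[\xi_{-1},\xi_{-2},\dots]$; $A_3$ is the span of products of three generators; $\mathfrak{a}\subset A$ is the ideal of polynomials $P$ with $P(a_{-1},a_{-2},\dots)v_0=0$ (with $\xi_{-n}$ replaced by $a_{-n}$). *)

(* Defs.v *)
From HB Require Import structures.
From mathcomp Require Import all_boot all_order all_algebra finmap.
From mathcomp Require Import generic_quotient.
From mathcomp Require Import boolp classical_sets functions cardinality fsbigop.
From mathcomp Require Import reals complex monalg.

Set Implicit Arguments.
Unset Strict Implicit.
Unset Printing Implicit Defensive.
Import Order.TTheory GRing.Theory Num.Theory.

Local Open Scope classical_set_scope.
Local Open Scope quotient_scope.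
Local Open Scope ring_scope.

(* Tensor product of two modules: formal sums of pairs (u, v), two of them    *)
(* being identified when every bilinear map takes the same value on them.     *)
(* No formal scalars are needed because they can be absorbed in u.            *)
Section Tensor.
Variable K : fieldType.

Definition bilinear_map (U V W : lmodType K) (B : U -> V -> W) : Prop :=
  (forall a u u' v, B (a *: u + u') v = a *: B u v + B u' v) /\
  (forall a u v v', B u (a *: v + v') = a *: B u v + B u v').

Variables U V : lmodType K.

Definition tsum_eval (W : lmodType K) (B : U -> V -> W) (s : seq (U * V)) : W :=
  \sum_(x <- s) B x.1 x.2.

Definition tensor_eqv (s t : seq (U * V)) : bool :=
  `[< forall (W : lmodType K) (B : U -> V -> W),
        bilinear_map B -> tsum_eval B s = tsum_eval B t >].

Fact tensor_eqv_refl : reflexive tensor_eqv.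
Proof. by move=> s; apply/asboolP. Qed.

Fact tensor_eqv_sym : symmetric tensor_eqv.
Proof.
by move=> s t; apply/idP/idP => /asboolP e; apply/asboolP => W B bB; rewrite e.
Qed.

Fact tensor_eqv_trans : transitive tensor_eqv.
Proof.
move=> t s r /asboolP e1 /asboolP e2; apply/asboolP => W B bB.
by rewrite e1 // e2.
Qed.

Canonical tensor_eqv_equiv := EquivRel tensor_eqv
  tensor_eqv_refl tensor_eqv_sym tensor_eqv_trans.

Definition tensor : Type := {eq_quot tensor_eqv}.
HB.instance Definition _ : EqQuotient _ tensor_eqv tensor :=
  EqQuotient.on tensor.
HB.instance Definition _ := Choice.on tensor.

Definition tpi (s : seq (U * V)) : tensor := \pi_tensor s.

(* The map U (x) V -> W given on pure tensors by B. *)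
Definition tlift (W : lmodType K) (B : U -> V -> W) (t : tensor) : W :=
  tsum_eval B (repr t).

Lemma tlift_pi (W : lmodType K) (B : U -> V -> W) (s : seq (U * V)) :
  bilinear_map B -> tlift B (tpi s) = tsum_eval B s.
Proof.
move=> bB; have /eqmodP/asboolP e : repr (tpi s) = s %[mod tensor] by rewrite reprK.
exact: e.
Qed.

Lemma tpi_repr (t : tensor) : tpi (repr t) = t.
Proof. exact: reprK. Qed.

Lemma tpiP (s t : seq (U * V)) :
  (forall (W : lmodType K) (B : U -> V -> W),
     bilinear_map B -> tsum_eval B s = tsum_eval B t) -> tpi s = tpi t.
Proof. by move=> e; apply/eqmodP/asboolP. Qed.

Lemma tensorP (s t : tensor) :
  (forall (W : lmodType K) (B : U -> V -> W),
     bilinear_map B -> tlift B s = tlift B t) -> s = t.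
Proof. by move=> e; rewrite -[s]tpi_repr -[t]tpi_repr; apply: tpiP. Qed.

Definition tzero : tensor := tpi [::].
Definition tadd (s t : tensor) : tensor := tpi (repr s ++ repr t).
Definition tscale (a : K) (s : tensor) : tensor :=
  tpi [seq (a *: x.1, x.2) | x <- repr s].
Definition topp (s : tensor) : tensor := tscale (-1) s.

Section Eval.
Variables (W : lmodType K) (B : U -> V -> W).
Hypothesis bB : bilinear_map B.

Lemma bilinear_mapZl a u v : B (a *: u) v = a *: B u v.
Proof.
have B0 : B 0 v = 0.
  by have := bB.1 (-1) 0 0 v; rewrite scaler0 addr0 scaleN1r addNr.
by rewrite -[a *: u]addr0 bB.1 B0 addr0.
Qed.

Lemma tlift0 : tlift B tzero = 0.
Proof. by rewrite tlift_pi // /tsum_eval big_nil. Qed.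

Lemma tliftD s t : tlift B (tadd s t) = tlift B s + tlift B t.
Proof. by rewrite tlift_pi // /tsum_eval big_cat. Qed.

Lemma tliftZ a s : tlift B (tscale a s) = a *: tlift B s.
Proof.
rewrite tlift_pi // /tsum_eval big_map scaler_sumr.
by apply: eq_bigr => x _; rewrite bilinear_mapZl.
Qed.
End Eval.

Fact taddA : associative tadd.
Proof. by move=> x y z; apply: tensorP => W B bB; rewrite !tliftD ?addrA. Qed.

Fact taddC : commutative tadd.
Proof. by move=> x y; apply: tensorP => W B bB; rewrite !tliftD // addrC. Qed.

Fact tadd0 : left_id tzero tadd.
Proof. by move=> x; apply: tensorP => W B bB; rewrite tliftD // tlift0 // add0r. Qed.

Fact taddN : left_inverse tzero topp tadd.
Proof.
move=> x; apply: tensorP => W B bB.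
by rewrite tliftD // tlift0 // tliftZ // scaleN1r addNr.
Qed.

HB.instance Definition _ := GRing.isZmodule.Build tensor taddA taddC tadd0 taddN.

Fact tscaleA a b v : tscale a (tscale b v) = tscale (a * b) v.
Proof. by apply: tensorP => W B bB; rewrite !tliftZ // scalerA. Qed.

Fact tscale1 : left_id 1 tscale.
Proof. by move=> v; apply: tensorP => W B bB; rewrite tliftZ // scale1r. Qed.

Fact tscaleDr : right_distributive tscale +%R.
Proof.
move=> a x y; apply: tensorP => W B bB.
by rewrite !(tliftZ, tliftD) // scalerDr.
Qed.

Fact tscaleDl v : {morph tscale^~ v : a b / a + b}.
Proof.
move=> a b; apply: tensorP => W B bB.
by rewrite !(tliftZ, tliftD) // scalerDl.
Qed.

HB.instance Definition _ := GRing.Zmodule_isLmodule.Build K tensor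
  tscaleA tscale1 tscaleDr tscaleDl.

Definition tpure (u : U) (v : V) : tensor := tpi [:: (u, v)].

Lemma tlift_pure (W : lmodType K) (B : U -> V -> W) u v :
  bilinear_map B -> tlift B (tpure u v) = B u v.
Proof. by move=> bB; rewrite tlift_pi // /tsum_eval big_seq1. Qed.

Lemma tlift_linear (W : lmodType K) (B : U -> V -> W) :
  bilinear_map B -> linear (tlift B).
Proof. by move=> bB a s t; rewrite tliftD // tliftZ. Qed.

Lemma tpure_bilinear : bilinear_map tpure.
Proof.
by split=> a u v w; apply: tensorP => W B bB;
  rewrite tlift_linear // !tlift_pure //; case: bB.
Qed.

Lemma tensor_sum (t : tensor) : exists s, t = \sum_(x <- s) tpure x.1 x.2.
Proof.
exists (repr t); apply: tensorP => W B bB; rewrite -{1}[t]tpi_repr tlift_pi //.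
rewrite /tsum_eval; elim: (repr t) => [|x s IH].
  by rewrite !big_nil -(tlift0 bB).
rewrite !big_cons IH [in RHS]/GRing.add/= tliftD // tlift_pure //.
Qed.

End Tensor.

Definition tmap (K : fieldType) (U V U' V' : lmodType K)
    (f : U -> U') (g : V -> V') : tensor U V -> tensor U' V' :=
  tlift (fun u v => tpure (f u) (g v)).

Section DirectSum.
Variables (K : fieldType) (I : choiceType) (W : I -> lmodType K).

Definition dsupport (f : forall i, W i) : set I := [set i | f i != 0].

Record dsum := DSum {
  dsum_val :> forall i, W i;
  dsum_fin : finite_set (dsupport dsum_val) }.

Lemma dsumP (f g : dsum) : (forall i, f i = g i) -> f = g.
Proof.
case: f g => [f Hf] [g Hg] /= e.
have efg : f = g by apply: functional_extensionality_dep.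
by subst g; congr DSum; exact: Prop_irrelevance.
Qed.

HB.instance Definition _ := gen_eqMixin dsum.
HB.instance Definition _ := gen_choiceMixin dsum.

Fact dsum0_fin : finite_set (dsupport (fun i => 0)).
Proof.
by rewrite (_ : dsupport _ = set0) // -subset0 => i; rewrite /dsupport/= eqxx.
Qed.

Fact dsumD_fin (f g : dsum) : finite_set (dsupport (fun i => f i + g i)).
Proof.
apply: (@sub_finite_set _ _ (dsupport f `|` dsupport g)); last first.
  by rewrite finite_setU; split; exact: dsum_fin.
move=> i; rewrite /dsupport/=; case: (eqVneq (f i) 0) => [->|]; last by left.
by rewrite add0r; right.
Qed.

Fact dsumN_fin (f : dsum) : finite_set (dsupport (fun i => - f i)).
Proof.
apply: (sub_finite_set _ (dsum_fin f)) => i.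
by rewrite /dsupport/= oppr_eq0.
Qed.

Fact dsumZ_fin (a : K) (f : dsum) : finite_set (dsupport (fun i => a *: f i)).
Proof.
apply: (sub_finite_set _ (dsum_fin f)) => i.
by rewrite /dsupport/=; apply: contra_neq => ->; rewrite scaler0.
Qed.

Definition dsum0 := DSum dsum0_fin.
Definition dsumD f g := DSum (dsumD_fin f g).
Definition dsumN f := DSum (dsumN_fin f).
Definition dsumZ a f := DSum (dsumZ_fin a f).

Fact dsumDA : associative dsumD.
Proof. by move=> f g h; apply: dsumP => i /=; rewrite addrA. Qed.
Fact dsumDC : commutative dsumD.
Proof. by move=> f g; apply: dsumP => i /=; rewrite addrC. Qed.
Fact dsumD0 : left_id dsum0 dsumD.
Proof. by move=> f; apply: dsumP => i /=; rewrite add0r. Qed.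
Fact dsumDN : left_inverse dsum0 dsumN dsumD.
Proof. by move=> f; apply: dsumP => i /=; rewrite addNr. Qed.

HB.instance Definition _ :=
  GRing.isZmodule.Build dsum dsumDA dsumDC dsumD0 dsumDN.

Fact dsumZA a b v : dsumZ a (dsumZ b v) = dsumZ (a * b) v.
Proof. by apply: dsumP => i /=; rewrite scalerA. Qed.
Fact dsumZ1 : left_id 1 dsumZ.
Proof. by move=> f; apply: dsumP => i /=; rewrite scale1r. Qed.
Fact dsumZDr : right_distributive dsumZ +%R.
Proof. by move=> a f g; apply: dsumP => i /=; rewrite scalerDr. Qed.
Fact dsumZDl v : {morph dsumZ^~ v : a b / a + b}.
Proof. by move=> a b; apply: dsumP => i /=; rewrite scalerDl. Qed.

HB.instance Definition _ := GRing.Zmodule_isLmodule.Build K dsum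
  dsumZA dsumZ1 dsumZDr dsumZDl.

Fact dsum_inj_fin i (x : W i) :
  finite_set (dsupport (dfwith (fun j => 0 : W j) x)).
Proof.
apply: (@sub_finite_set _ _ [set i]) => // j; rewrite /dsupport/=.
by apply: contra_neqP => /eqP ji; rewrite dfwith_out // eq_sym.
Qed.

Definition dsum_inj i (x : W i) : dsum := DSum (dsum_inj_fin x).

End DirectSum.

Section Virasoro.
Variables (K : fieldType) (c : K).

Definition virasoro_action (M : lmodType K) (L : int -> {linear M -> M}) : Prop :=
  forall m n x, L m (L n x) - L n (L m x) =
    (m - n)%:~R *: L (m + n) x
    + (if m + n == 0 then c / 12%:R * (m ^+ 3 - m)%:~R else 0) *: x.

Definition virasoro_submodule (M : lmodType K) (L : int -> {linear M -> M})
    (S : set M) : Prop :=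
  [/\ S 0, forall a x y, S x -> S y -> S (a *: x + y)
    & forall n x, S x -> S (L n x)].

Definition irreducible_hw_module (h : K) (M : lmodType K)
    (L : int -> {linear M -> M}) (v : M) : Prop :=
  [/\ virasoro_action L, v <> 0,
      forall n : int, 0 < n -> L n v = 0,
      L 0 v = h *: v
    & forall S, virasoro_submodule L S -> S = [set 0] \/ S = setT].

(* [L_m, psi(z)] = z^m (z d/dz + (m + 1) h) psi(z) for                        *)
(* psi(z) = \sum_n psi_n z^(- n - delta), read off at z^(- n - delta):        *)
(* z^m shifts the index by m, and z d/dz multiplies the coefficient of        *)
(* z^(- k - delta) by - (k + delta).                                          *)
Definition primary_field (h delta : K) (M M' : lmodType K)
    (L : int -> {linear M -> M}) (L' : int -> {linear M' -> M'})
    (psi : int -> {linear M -> M'}) : Prop :=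
  forall m n x, L' m (psi n x) - psi n (L m x) =
    (- ((n + m)%:~R + delta) + (m + 1)%:~R * h) *: psi (n + m) x.

End Virasoro.

(* Polynomials in countably many variables indexed by n >= 1. The variable n  *)
(* is stored with index n - 1, so pgen 0 is a second name of pgen 1.         *)
Notation ipoly K := {malg K[{cmonom nat}]}.

Section Polynomials.
Variable K : fieldType.

Definition pgen (n : nat) : ipoly K := << ucm n.-1 >>.

(* partial derivative with respect to pgen n *)
Definition pderiv (n : nat) (P : ipoly K) : ipoly K :=
  \sum_(m <- msupp P)
    << mcoeff m P * (m n.-1)%:R *g divcm m (ucm n.-1) >>.

(* P(X_1, X_2, ...) v for a family X of operators. The order of the factors   *)
(* in a monomial is the enumeration order of its support; it is irrelevant    *)
(* when the operators commute.                                                *)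
Definition poly_act (V : lmodType K) (X : nat -> V -> V) (P : ipoly K) (v : V) : V :=
  \sum_(m <- msupp P) mcoeff m P *:
    foldr (fun i w => iter (m i) (X i.+1) w) v (finsupp m).

Definition cubic : set (ipoly K) :=
  [set P | exists s : seq (K * (nat * nat * nat)),
     P = \sum_(t <- s) t.1 *: (pgen t.2.1.1 * pgen t.2.1.2 * pgen t.2.2)].

End Polynomials.

(* Every F_gamma is C[h_{-1}, h_{-2}, ...]|gamma>; P|gamma> is represented by *)
(* P, with pgen n for h_{-n}. Only h_0 depends on gamma, and                  *)
(* e^(alpha Q) : F_gamma -> F_(gamma + alpha) is the identity on P.           *)
Notation fock K := (ipoly K).

Section Fock.
Variable K : fieldType.
Local Notation fock := (fock K).

Definition heis (gamma : K) (n : int) (P : fock) : fock :=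
  match n with
  | Posz 0 => gamma *: P
  | Posz k.+1 => k.+1%:R *: pderiv k.+1 P
  | Negz k => pgen K k.+1 * P
  end.

(* Coefficient of z^k in X(z)^j and in exp X(z) = \sum_j X(z)^j / j!, where   *)
(* X(z) = \sum_(n >= 1) X_n z^n.                                              *)
Fixpoint pow_coef (X : nat -> fock -> fock) (j k : nat) (P : fock) : fock :=
  if j is j'.+1 then \sum_(1 <= n < k.+1) X n (pow_coef X j' (k - n) P)
  else if k == 0%N then P else 0.

Definition exp_coef (X : nat -> fock -> fock) (k : nat) (P : fock) : fock :=
  \sum_(0 <= j < k.+1) (j`!%:R)^-1 *: pow_coef X j k P.

(* exp(- alpha \sum_(n < 0) h_n / n z^(-n)), coefficient of z^k *)
Definition creation_coef (gamma alpha : K) : nat -> fock -> fock :=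
  exp_coef (fun n P => - (alpha / (- n%:Z)%:~R) *: heis gamma (- n%:Z) P).

(* exp(- alpha \sum_(n > 0) h_n / n z^(-n)), coefficient of z^(-k) *)
Definition annihilation_coef (gamma alpha : K) : nat -> fock -> fock :=
  exp_coef (fun n P => - (alpha / n%:R) *: heis gamma n%:Z P).

(* phi_alpha(z) = \sum_d phi_mode d z^(d + alpha gamma) on F_gamma; the sum   *)
(* below is finite for every P.                                               *)
Definition phi_mode (gamma alpha : K) (d : int) (P : fock) : fock :=
  \sum_(t \in [set t : nat * nat | t.1%:Z - t.2%:Z = d])
    creation_coef (gamma + alpha) alpha t.1
      (annihilation_coef gamma alpha t.2 P).

End Fock.

Definition oddz (n : int) : bool := odd `|n|%N.

Section MinimalModel.
Variables (R : realType) (p : nat).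
Local Notation C := (R[i])%C.

Definition central_charge : C := 1 - 2%:R * (p%:R - 3%:R) ^+ 2 / p%:R.
Definition weight21 : C := (p%:R - 2%:R) / 4%:R.
Definition shift21 : C := (p%:R - 2%:R) / 2%:R.
Definition beta : C := (Num.sqrt ((p%:R - 2%:R) / 2%:R : R))%:C%C.

Variables (M11 M21 : lmodType C).

(* the first tensor factor of V_n, as a function of the parity of n *)
Definition Mpar (b : bool) : lmodType C := if b then M21 else M11.

Definition Vn (n : int) : lmodType C := tensor (Mpar (oddz n)) (fock C).
Definition Vspace : lmodType C := dsum Vn.

Variables (psi12 : int -> {linear M11 -> M21}) (psi21 : int -> {linear M21 -> M11}).

Definition psi_mode (b b' : bool) (n : int) : Mpar b -> Mpar b' :=
  match b, b' return Mpar b -> Mpar b' with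
  | false, true => psi12 n
  | true, false => psi21 n
  | _, _ => fun=> 0
  end.

(* psi(z) = \sum_n psi_n z^(- n - psi_shift b) on the module of parity b *)
Definition psi_shift (b : bool) : C := if b then shift21 else 0.

(* a_k : V_(n - 1) -> V_n is the coefficient of z^(- k - 1) in                *)
(* psi(z) phi_beta(z), where psi_i (x) phi_j comes with the power             *)
(* z^(- i - psi_shift) z^(j + beta gamma), gamma = (n - 1) beta. The sum is   *)
(* finite for every x.                                                        *)
Definition a_comp (k n : int) (x : Vn (n - 1)) : Vn n :=
  \sum_(t \in [set t : int * int |
          - t.1%:~R - psi_shift (oddz (n - 1))
          + (t.2%:~R + beta * ((n - 1)%:~R * beta)) = - k%:~R - 1 :> C])
    tmap (@psi_mode (oddz (n - 1)) (oddz n) t.1)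
         (phi_mode ((n - 1)%:~R * beta) beta t.2) x.

Definition a_mode (k : int) (x : Vspace) : Vspace :=
  \sum_(n \in [set: int]) dsum_inj (a_comp k (x (n - 1)) : Vn n).

End MinimalModel.

(* v_0 = |1,1> (x) |0> *)
Definition vac (R : realType) (M11 M21 : lmodType R[i]%C) (v11 : M11) :
    Vspace M11 M21 :=
  dsum_inj (tpure (v11 : Mpar M11 M21 (oddz 0)) (1 : fock R[i]%C) : Vn M11 M21 0).

(* A field A(z) = \sum_k A_k z^(- k - 1) is given by its modes A_k. *)
Section Fields.
Variables (K : fieldType) (V : lmodType K).
Implicit Types A B D : int -> V -> V.

Definition field_deriv A : int -> V -> V :=
  fun k x => - k%:~R *: A (k - 1) x.

(* A(z)B(z)D(z) is a well-defined operator-valued series and it vanishes: for *)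
(* every vector x, the sum giving the coefficient of z^(- n - 3) on x has     *)
(* finitely many nonzero terms and is zero.                                   *)
Definition field_mul3_eq0 A B D : Prop :=
  forall (n : int) (x : V),
    let S := [set t : int * int * int | t.1.1 + t.1.2 + t.2 = n] in
    let F := fun t : int * int * int => A t.1.1 (B t.1.2 (D t.2 x)) in
    finite_set [set t | S t /\ F t != 0] /\ \sum_(t \in S) F t = 0.

(* the ideal of relations between A_{-1}, A_{-2}, ... on the vector v *)
Definition relation_ideal A (v : V) : set (ipoly K) :=
  [set P | poly_act (fun n : nat => A (- n%:Z)) P v = 0].

End Fields.

(* \sum_(i, j, k > 0, i + j + k = d)
     (k - 1)(k - 2)...(k - nu) xi_{-i} xi_{-j} xi_{-k} *)
Definition cubic_relation (K : fieldType) (nu d : nat) : ipoly K :=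
  \sum_(1 <= i < d.+1) \sum_(1 <= j < d.+1)
    \sum_(1 <= k < d.+1 | (i + j + k == d)%N)
      (\prod_(1 <= l < nu.+1) (k%:R - l%:R : K)) *:
        (pgen K i * pgen K j * pgen K k).

(* Main.v *)
Require Import Defs.
From mathcomp Require Import all_boot all_order all_algebra finmap.
From mathcomp Require Import boolp classical_sets functions cardinality fsbigop.
From mathcomp Require Import reals complex monalg.
From mathcomp Require Import zify ring.

Set Implicit Arguments.
Unset Strict Implicit.
Unset Printing Implicit Defensive.
Import Order.TTheory GRing.Theory Num.Theory.
Local Open Scope classical_set_scope.
Local Open Scope ring_scope.

(** Write s = (p - 2) / 2. Then psi has weight s / 2 and beta ^ 2 = s, and the
    two tensor factors of a(z) = psi(z) phi_beta(z) compensate each other.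

    On the lattice side, phi_al(z) phi_be(w) is (1 - w / z)^(al be) times the
    normally ordered product, which is symmetric for al = be and equals
    phi_(al + be)(z) at w = z (vertex_mul, normal_product_sym, vertex_diagonal).

    On the Virasoro side, consider the coefficients of (z - w)^s psi(z) psi(w).
    Their commutators with the L_m are linear combinations of themselves
    (product_ward). A family of operators with this property that kills the
    highest weight vector in degree 0 is zero (covariant_eq0): by descending
    induction it sends the highest weight vector to singular vectors, which
    vanish in an irreducible module, and the vectors that it kills form a
    submodule. Therefore the symmetry of (z - w)^s psi(z) psi(w) in z and w
    (product_sym) need only be checked on its matrix elements between highest
    weight vectors; the same principle shows that its restriction to z = w is
    a scalar (diagonal_coef_scalar). These matrix elements are series in
    x = w / z of the form (1 - x)^s y(x), where y satisfies a differential
    equation given by a null vector: L_(-1) v = 0 in M_(1,1), which makes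
    (1 - x)^s y constant, and (L_(-1)^2 - (p / 3) L_(-2)) v = 0 in M_(2,1),
    which makes (1 - x)^s y a solution of a hypergeometric equation that is
    invariant under n |-> p - 2 - n on coefficients, hence a palindromic
    polynomial of degree at most p - 2 (conv_palindromic). The assumption that
    3 does not divide p says that the coefficients of the recursion do not
    vanish where it is used.

    Multiplying the two sides, the factors (z - w)^s and (1 - w / z)^s match, so
    a(z) a(w) is a symmetric function of z and w times a normally ordered
    product. Hence the a_k commute (two_modes_comm) and, at w = z, a(z)^2 is a
    scalar times id (x) phi_(2 beta)(z), up to a power of z
    (two_modes_diagonal). Finally 2 beta * beta = p - 2, so that
    phi_(2 beta)(z) phi_beta(w) is divisible by (z - w)^(p - 2), and all its
    derivatives in w of order at most p - 3 vanish at w = z. On coefficients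
    this is the fact that the N-th finite difference of a polynomial of degree
    less than N is zero (finite_difference, vertex_vanishing).

    The cubic relations are the coefficients of a(z)^2 d^nu a(z) v_0: the modes
    commute and a_n v_0 = 0 for n >= 0, so only products of three modes with
    negative indices remain (cubic_relation_mem). *)

(** * Finite sums over the integers *)

Section IntegerSums.
Variable V : zmodType.
Implicit Types F G : int -> V.

(** All series of modes below are indexed by the integers and have finitely many
    nonzero terms on each vector; zsum is 0 on a family of infinite support, so
    most lemmas ask for an explicit bound on the support. *)
Definition zsum F : V := \sum_(i \in [set: int]) F i.

Definition bounded F := exists B : int, forall i, B < `|i| -> F i = 0.
Definition bounded2 (F : int -> int -> V) :=
  exists B : int, forall i j, B < `|i| \/ B < `|j| -> F i j = 0.

Lemma bounded_between lo hi F :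
  (forall i, i < lo -> F i = 0) -> (forall i, hi < i -> F i = 0) -> bounded F.
Proof.
move=> hlo hhi; exists (`|lo| + `|hi|) => i hi'.
by case: (ltP i lo) => ilo; [exact: hlo|apply: hhi; lia].
Qed.

Lemma bounded_shift c F : bounded F -> bounded (fun i => F (i + c)).
Proof. by case=> B hB; exists (`|B| + `|c|) => i hi; apply: hB; lia. Qed.

Definition int_range (B : nat) : seq int :=
  [seq k%:Z - B%:Z | k <- iota 0 (B + B).+1].

Lemma mem_int_range B i : (i \in int_range B) = (`|i| <= B%:Z).
Proof.
apply/mapP/idP => [[k]|hi]; first by rewrite mem_iota; lia.
by exists (absz (i + B%:Z)); [rewrite mem_iota; lia|lia].
Qed.

Lemma int_range_uniq B : uniq (int_range B).
Proof. by rewrite map_inj_uniq ?iota_uniq // => i j; lia. Qed.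

Lemma zsum_seq (r : seq int) F : uniq r -> (forall i, i \notin r -> F i = 0) ->
  zsum F = \sum_(i <- r) F i.
Proof.
move=> ur hF; rewrite /zsum -(@fsbig_widen _ _ _ _ [set` r]) //.
  by rewrite -fsbig_seq.
by move=> i [_ /negP]; exact: hF.
Qed.

Lemma zsumE (B : nat) F : (forall i, B%:Z < `|i| -> F i = 0) ->
  zsum F = \sum_(i <- int_range B) F i.
Proof.
move=> hF; apply: zsum_seq; first exact: int_range_uniq.
by move=> i; rewrite mem_int_range -ltNge; exact: hF.
Qed.

Lemma zsum_nat (k : nat) F : (forall i : int, i < 1 \/ k%:Z < i -> F i = 0) ->
  zsum F = \sum_(1 <= n < k.+1) F n%:Z.
Proof.
move=> hF; rewrite (@zsum_seq [seq n%:Z | n <- index_iota 1 k.+1]) ?big_map //.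
  by rewrite map_inj_uniq ?iota_uniq // => i j; lia.
move=> i hi; apply: hF; apply: contrapT => hn; move/negP: hi; apply.
by apply/mapP; exists (absz i); [rewrite mem_index_iota; lia|lia].
Qed.

Lemma eq_zsum F G : F =1 G -> zsum F = zsum G.
Proof. by move=> e; congr zsum; apply: funext. Qed.

Lemma zsum0 F : (forall i, F i = 0) -> zsum F = 0.
Proof. by move=> e; apply: fsbig1 => i _; exact: e. Qed.

Lemma zsum_shift c F : zsum (fun i => F (i + c)) = zsum F.
Proof.
apply/esym; apply: (reindex_fsbigT (fun i : int => i + c)).
by exists (fun i => i - c) => i; ring.
Qed.

Lemma zsum_reflect c F : zsum (fun i => F (c - i)) = zsum F.
Proof.
apply/esym; apply: (reindex_fsbigT (fun i : int => c - i)).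
by exists (fun i => c - i) => i; ring.
Qed.

Lemma zsum_single c F : (forall i, i != c -> F i = 0) -> zsum F = F c.
Proof.
move=> hF; rewrite /zsum -(@fsbig_widen _ _ _ _ [set c]) ?fsbig_set1 //.
by move=> i [_ /= /eqP]; exact: hF.
Qed.

Lemma zsum_exchange (F : int -> int -> V) : bounded2 F ->
  zsum (fun i => zsum (F i)) = zsum (fun j => zsum (F^~ j)).
Proof.
case=> B hF.
rewrite (@zsumE (absz B)); last first.
  by move=> i hi; apply: zsum0 => j; apply: hF; left; lia.
rewrite [RHS](@zsumE (absz B)); last first.
  by move=> i hi; apply: zsum0 => j; apply: hF; right; lia.
under eq_bigr => i _.
  rewrite (@zsumE (absz B)); last by move=> j hj; apply: hF; right; lia.
  over.
rewrite exchange_big /=; apply: eq_bigr => j _.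
by rewrite (@zsumE (absz B)) // => i hi; apply: hF; left; lia.
Qed.

Lemma zsum_rotate (F : int -> int -> int -> V) (B : int) :
  (forall i j k, [\/ B < `|i|, B < `|j| | B < `|k|] -> F i j k = 0) ->
  zsum (fun i => zsum (fun j => zsum (fun k => F i j k))) =
  zsum (fun k => zsum (fun i => zsum (fun j => F i j k))).
Proof.
move=> hF.
transitivity (zsum (fun i => zsum (fun k => zsum (fun j => F i j k)))).
  apply: eq_zsum => i; apply: zsum_exchange; exists B => j k [] h; apply: hF.
    by apply: Or32.
  by apply: Or33.
apply: zsum_exchange; exists B => i k [] h; apply: zsum0 => j; apply: hF.
  by apply: Or31.
by apply: Or33.
Qed.

Lemma zsumD F G : bounded F -> bounded G ->
  zsum (fun i => F i + G i) = zsum F + zsum G.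
Proof.
case=> B hF [B' hG].
rewrite (@zsumE (absz B + absz B')); last by move=> i hi; rewrite hF ?hG ?addr0 //; lia.
rewrite big_split /=; congr (_ + _); apply/esym/zsumE => i hi.
  by apply: hF; lia.
by apply: hG; lia.
Qed.

Lemma boundedD F G : bounded F -> bounded G -> bounded (fun i => F i + G i).
Proof.
case=> B hF [B' hG]; exists (`|B| + `|B'|) => i hi.
by rewrite hF ?hG ?addr0 //; lia.
Qed.

Lemma bounded_sum (I : Type) (r : seq I) (F : I -> int -> V) :
  (forall x, bounded (F x)) -> bounded (fun i => \sum_(x <- r) F x i).
Proof.
move=> hF; elim: r => [|x r IH]; first by exists 0 => i _; rewrite big_nil.
rewrite (_ : (fun i => _) = (fun i => F x i + \sum_(x <- r) F x i)).
  exact: boundedD.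
by apply: funext => i; rewrite big_cons.
Qed.

Lemma zsum_sum (I : Type) (r : seq I) (F : I -> int -> V) :
  (forall x, bounded (F x)) ->
  zsum (fun i => \sum_(x <- r) F x i) = \sum_(x <- r) zsum (F x).
Proof.
move=> hF; elim: r => [|x r IH].
  by rewrite big_nil; apply: zsum0 => i; rewrite big_nil.
rewrite big_cons -IH -zsumD //; last exact: bounded_sum.
by apply: eq_zsum => i; rewrite big_cons.
Qed.

End IntegerSums.

Lemma morphD0 (V W : zmodType) (f : V -> W) : {morph f : x y / x + y} -> f 0 = 0.
Proof.
by move=> fD; apply: (addrI (f 0)); rewrite -fD !addr0.
Qed.

Lemma bounded_morph (V W : zmodType) (f : V -> W) (F : int -> V) :
  {morph f : x y / x + y} -> bounded F -> bounded (fun i => f (F i)).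
Proof. by move=> /morphD0 f0 [B hF]; exists B => i hi; rewrite hF. Qed.

Lemma zsum_morph (V W : zmodType) (f : V -> W) (F : int -> V) :
  {morph f : x y / x + y} -> bounded F ->
  f (zsum F) = zsum (fun i => f (F i)).
Proof.
move=> fD [B hF]; have f0 := morphD0 fD.
rewrite (@zsumE _ (absz B)) => [|i hi]; last by apply: hF; lia.
rewrite (@zsumE _ (absz B)) => [|i hi]; last by rewrite hF //; lia.
exact: (big_morph f fD f0).
Qed.

Section ScaledSums.
Variables (K : pzRingType) (V : lmodType K).
Implicit Types F : int -> V.

Lemma bounded_scale (f : int -> K) F : bounded F -> bounded (fun i => f i *: F i).
Proof. by case=> B hF; exists B => i hi; rewrite hF ?scaler0. Qed.

Lemma boundedZ c F : bounded F -> bounded (fun i => c *: F i).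
Proof. exact: bounded_scale. Qed.

(** The typical support: the coefficients of a binomial series vanish to the
    left, the modes of a field applied to a vector vanish to the right. *)
Lemma bounded_halves (f : int -> K) F lo hi :
  (forall i, i < lo -> f i = 0) -> (forall i, hi < i -> F i = 0) ->
  bounded (fun i => f i *: F i).
Proof.
move=> hf hF; apply: (@bounded_between _ lo hi) => i hi'.
  by rewrite hf // scale0r.
by rewrite hF // scaler0.
Qed.

Lemma bounded_linear (W : lmodType K) (f : {linear V -> W}) F :
  bounded F -> bounded (fun i => f (F i)).
Proof. by apply: bounded_morph; exact: linearD. Qed.

Lemma zsum_linear (W : lmodType K) (f : {linear V -> W}) F :
  bounded F -> f (zsum F) = zsum (fun i => f (F i)).
Proof. by apply: zsum_morph; exact: linearD. Qed.

Lemma zsumZ c F : bounded F -> c *: zsum F = zsum (fun i => c *: F i).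
Proof. by apply: zsum_morph => x y; rewrite scalerDr. Qed.

Lemma zsumDl (f g : int -> K) F : bounded (fun i => f i *: F i) ->
  bounded (fun i => g i *: F i) ->
  zsum (fun i => (f i + g i) *: F i) =
  zsum (fun i => f i *: F i) + zsum (fun i => g i *: F i).
Proof.
by move=> hf hg; rewrite -zsumD //; apply: eq_zsum => i; rewrite scalerDl.
Qed.

Lemma zsum_suml (I : Type) (r : seq I) (f : I -> int -> K) F :
  (forall x, bounded (fun i => f x i *: F i)) ->
  zsum (fun i => (\sum_(x <- r) f x i) *: F i) =
  \sum_(x <- r) zsum (fun i => f x i *: F i).
Proof.
by move=> hf; rewrite -zsum_sum //; apply: eq_zsum => i; rewrite scaler_suml.
Qed.

End ScaledSums.

(** * Irreducible highest weight modules *)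

Section VirasoroGrading.
Variables (K : numFieldType) (c h : K) (M : lmodType K).
Variable L : int -> {linear M -> M}.

(** Degrees are measured from the lowest L_0-eigenvalue h. *)
Definition homogeneous (k : int) (x : M) := L 0 x = (h + k%:~R) *: x.

Lemma homogeneousD k x y :
  homogeneous k x -> homogeneous k y -> homogeneous k (x + y).
Proof. by move=> hx hy; rewrite /homogeneous linearD hx hy scalerDr. Qed.

Lemma homogeneousZ k a x : homogeneous k x -> homogeneous k (a *: x).
Proof. by move=> hx; rewrite /homogeneous linearZ /= hx !scalerA mulrC. Qed.

Lemma homogeneous0 k : homogeneous k 0.
Proof. by rewrite /homogeneous linear0 scaler0. Qed.

Lemma homogeneousB k x y :
  homogeneous k x -> homogeneous k y -> homogeneous k (x - y).
Proof.
by move=> hx hy; rewrite -scaleN1r; apply: homogeneousD => //; exact: homogeneousZ.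
Qed.

Hypothesis vir : virasoro_action c L.

Lemma virasoroC m n x : L m (L n x) = L n (L m x) + (m - n)%:~R *: L (m + n) x
    + (if m + n == 0 then c / 12%:R * (m ^+ 3 - m)%:~R else 0) *: x.
Proof. by rewrite -addrA -vir addrC subrK. Qed.

Lemma virasoro_bracket m n x : m + n != 0 ->
  L m (L n x) - L n (L m x) = (m - n)%:~R *: L (m + n) x.
Proof. by move=> mn; rewrite vir (negbTE mn) scale0r addr0. Qed.

Lemma homogeneousL k m x : homogeneous k x -> homogeneous (k - m) (L m x).
Proof.
rewrite /homogeneous => hx; case: (eqVneq m 0) => [->|m0].
  by rewrite hx linearZ /= hx subr0.
have := virasoro_bracket (m := 0) (n := m) x.
rewrite add0r => /(_ m0)/eqP; rewrite subr_eq => /eqP ->.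
by rewrite hx linearZ /= -scalerDl; congr (_ *: _); rewrite sub0r; ring.
Qed.

(** All L_n are iterated brackets of L_1, L_2, L_(-1), L_(-2), so covariance need
    only be checked for these four. *)
Lemma virasoro_generators (S : set M) :
    (forall a x y, S x -> S y -> S (a *: x + y)) ->
    (forall m x, m \in [:: 1; 2; -1; -2] -> S x -> S (L m x)) ->
  forall n x, S x -> S (L n x).
Proof.
move=> Slin Sgen.
have S1 x : S x -> S (L 1 x) by apply: Sgen; rewrite !inE.
have SN1 x : S x -> S (L (-1) x) by apply: Sgen; rewrite !inE.
have S2 x : S x -> S (L 2 x) by apply: Sgen; rewrite !inE.
have SN2 x : S x -> S (L (-2) x) by apply: Sgen; rewrite !inE.
have SZ a x : S x -> S (a *: x).
  move=> Sx; have S0 : S 0.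
    by rewrite (_ : 0 = -1 *: x + x); [exact: Slin|rewrite scaleN1r addNr].
  by rewrite -[a *: x]addr0; exact: Slin.
have SB m n x : m - n != 0 -> m + n != 0 ->
    S (L m (L n x)) -> S (L n (L m x)) -> S (L (m + n) x).
  move=> mn0 mn1 h1 h2.
  have -> : L (m + n) x = ((m - n)%:~R)^-1 *: (L m (L n x) - L n (L m x)).
    by rewrite virasoro_bracket // scalerA mulVf ?intr_eq0 // scale1r.
  by apply: SZ; rewrite addrC -scaleN1r; exact: Slin.
have Sp (n : nat) : forall x, S x -> S (L n.+1%:Z x).
  elim: n => [|[|n] IH] x Sx; [exact: S1|exact: S2|].
  rewrite (_ : n.+3%:Z = n.+2%:Z + 1); last lia.
  by apply: SB; [lia|lia|apply/IH/S1|apply/S1/IH].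
have Sn (n : nat) : forall x, S x -> S (L (- n.+1%:Z) x).
  elim: n => [|[|n] IH] x Sx; [exact: SN1|exact: SN2|].
  rewrite (_ : - n.+3%:Z = - n.+2%:Z + (-1)); last lia.
  by apply: SB; [lia|lia|apply/IH/SN1|apply/SN1/IH].
case=> [[|n]|n] x Sx; [|exact: Sp|by rewrite NegzE; exact: Sn].
have -> : L 0 x = 2^-1 *: (L 1 (L (-1) x) - L (-1) (L 1 x)).
  by rewrite vir !subrr !mulr0 scale0r addr0 scalerA mulVf ?scale1r ?pnatr_eq0.
by apply: SZ; rewrite addrC -scaleN1r; apply: Slin; [apply/SN1/S1|apply/S1/SN1].
Qed.

End VirasoroGrading.

Section HighestWeight.
Variables (K : numFieldType) (c h : K) (M : lmodType K).
Variables (L : int -> {linear M -> M}) (v : M).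
Hypothesis hM : irreducible_hw_module c h L v.
Local Notation homog := (homogeneous h L).

Let vir : virasoro_action c L. Proof. by case: hM. Qed.
Let v_neq0 : v != 0. Proof. by case: hM => _ /eqP. Qed.
Let Lpos n : 0 < n -> L n v = 0. Proof. by case: hM => _ _ + _ _; apply. Qed.
Let L0v : L 0 v = h *: v. Proof. by case: hM. Qed.

(** The span of the vectors L_(- n_1) ... L_(- n_r) v with n_1 + ... + n_r = k and
    all n_i > 0, presented inductively. *)
Inductive descendant : int -> M -> Prop :=
| descendant0 k : descendant k 0
| descendant_lin k a x y :
    descendant k x -> descendant k y -> descendant k (a *: x + y)
| descendant_hw : descendant 0 v
| descendant_step k n x :
    0 < n -> descendant k x -> descendant (k + n) (L (- n) x).

Lemma descendantZ k a x : descendant k x -> descendant k (a *: x).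
Proof.
by move=> hx; rewrite -[_ *: _]addr0; apply: descendant_lin => //; exact: descendant0.
Qed.

Lemma descendantD k x y :
  descendant k x -> descendant k y -> descendant k (x + y).
Proof. by move=> hx hy; rewrite -[x]scale1r; exact: descendant_lin. Qed.

(** The commutation relations move L_m to the right, up to the highest weight
    vector. *)
Lemma descendantL k x m : descendant k x -> descendant (k - m) (L m x).
Proof.
have neg k' m' y : m' < 0 -> descendant k' y -> descendant (k' - m') (L m' y).
  move=> m0 hy; rewrite -[m' in L m']opprK; apply: descendant_step => //; lia.
move=> hx; elim: hx m => {k x} [k|k a x y _ IHx _ IHy||k n x n0 hx IH] m.
- by rewrite linear0; exact: descendant0.
- by rewrite linearP; exact: descendant_lin.
- case: (ltrgtP m 0) => [m0|m0|->].
  + by apply: neg => //; exact: descendant_hw.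
  + by rewrite Lpos //; exact: descendant0.
  + by rewrite L0v subr0; apply: descendantZ; exact: descendant_hw.
- rewrite (virasoroC vir); apply: descendantD; last first.
    case: eqP => [mn|_]; last by rewrite scale0r; exact: descendant0.
    by apply: descendantZ; rewrite (_ : k + n - m = k) //; lia.
  apply: descendantD; last first.
    by apply: descendantZ; rewrite (_ : k + n - m = k - (m - n)); [exact: IH|lia].
  by rewrite (_ : k + n - m = k - m + n); [exact: descendant_step|lia].
Qed.

Lemma descendant_neg k x : descendant k x -> k < 0 -> x = 0.
Proof.
elim=> {k x} [k|k a x y _ IHx _ IHy||k n x n0 hx IH] // k0.
  by rewrite IHx // IHy // scaler0 addr0.
by rewrite IH ?linear0 //; lia.
Qed.

Lemma descendant_top k x : descendant k x -> k = 0 -> exists a, x = a *: v.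
Proof.
elim=> {k x} [k _|k a x y _ IHx _ IHy k0|_|k n x n0 hx IH k0].
- by exists 0; rewrite scale0r.
- have [[b ->] [d ->]] := (IHx k0, IHy k0).
  by exists (a * b + d); rewrite scalerA -scalerDl.
- by exists 1; rewrite scale1r.
- exists 0; rewrite scale0r (@descendant_neg k x) ?linear0 //; lia.
Qed.

Lemma descendant_homogeneous k x : descendant k x -> homog k x.
Proof.
elim=> {k x} [k|k a x y _ IHx _ IHy||k n x n0 hx IH].
- exact: homogeneous0.
- by apply: homogeneousD => //; exact: homogeneousZ.
- by rewrite /homogeneous L0v mulr0z addr0.
- by rewrite -[k + n]/(k + n); have := homogeneousL vir (- n) IH; rewrite opprK.
Qed.

(** The number of summands is recorded for the induction in
    homogeneous_descendant. *)
Inductive descendant_sum : nat -> M -> Prop :=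
| descendant_sum0 : descendant_sum 0 0
| descendant_sumS n k x y :
    descendant k x -> descendant_sum n y -> descendant_sum n.+1 (x + y).

Lemma descendant_sumZ n a x : descendant_sum n x -> descendant_sum n (a *: x).
Proof.
elim=> {n x} [|n k x y hx _ IH]; first by rewrite scaler0; exact: descendant_sum0.
by rewrite scalerDr; exact: descendant_sumS (descendantZ _ hx) IH.
Qed.

Lemma descendant_sumD n n' x y :
  descendant_sum n x -> descendant_sum n' y -> descendant_sum (n + n')%N (x + y).
Proof.
move=> hx hy; elim: hx => {n x} [|n k x z hx _ IH]; first by rewrite add0r.
by rewrite -addrA addSn; exact: descendant_sumS hx IH.
Qed.

Lemma descendant_sumL n x m : descendant_sum n x -> descendant_sum n (L m x).
Proof.
elim=> {n x} [|n k x y hx _ IH]; first by rewrite linear0; exact: descendant_sum0.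
by rewrite linearD; exact: descendant_sumS (descendantL _ hx) IH.
Qed.

Lemma descendant_sum_shift n x mu :
  descendant_sum n x -> descendant_sum n (L 0 x - mu *: x).
Proof.
elim=> {n x} [|n k x y hx _ IH].
  by rewrite linear0 scaler0 subrr; exact: descendant_sum0.
rewrite linearD scalerDr opprD addrACA; apply: (descendant_sumS _ IH).
by rewrite (descendant_homogeneous hx) -scalerBl; exact: descendantZ hx.
Qed.

Lemma descendant_sum_inv n x : descendant_sum n x ->
  if n is n'.+1 then
    exists k y z, [/\ descendant k y, descendant_sum n' z & x = y + z]
  else x = 0.
Proof. by case=> {n x} // n k x y hx hy; exists k, x, y. Qed.

(** Applying L_0 - (h + j) to a sum of descendants removes its summand of degree j,
    so that an induction on the number of summands separates the eigenspaces. *)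
Lemma homogeneous_descendant n x k :
  descendant_sum n x -> homog k x -> descendant k x.
Proof.
elim: n x k => [|n IH] x k /descendant_sum_inv.
  by move=> -> _; exact: descendant0.
move=> [j [y [z [hy hz ->]]]] hx.
case: (eqVneq k j) => [kj|kj].
  apply: descendantD; first by rewrite kj.
  apply: IH => //; rewrite -[z](addKr y) addrC.
  by apply: homogeneousB => //; rewrite kj; exact: descendant_homogeneous.
have e : (k - j)%:~R *: (y + z) = L 0 z - (h + j%:~R) *: z.
  have <- : L 0 (y + z) - (h + j%:~R) *: (y + z) = (k - j)%:~R *: (y + z).
    by rewrite hx -scalerBl; congr (_ *: _); ring.
  by rewrite linearD (descendant_homogeneous hy) scalerDr opprD addrACA subrr add0r.
have hk : descendant k ((k - j)%:~R *: (y + z)).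
  apply: IH; last exact: homogeneousZ.
  by rewrite e; exact: descendant_sum_shift.
rewrite -[y + z]scale1r -(@mulVf _ ((k - j)%:~R : K)); last first.
  by rewrite intr_eq0 subr_eq0.
by rewrite -scalerA; exact: descendantZ.
Qed.

(** Sums of descendants form a nonzero submodule. *)
Lemma all_descendants x : exists n, descendant_sum n x.
Proof.
have [_ _ _ _ irr] := hM.
have sub : virasoro_submodule L [set x | exists n, descendant_sum n x].
  split=> [|a y z [n hy] [n' hz]|m y [n hy]].
  - by exists 0; exact: descendant_sum0.
  - by exists (n + n')%N; apply: descendant_sumD => //; exact: descendant_sumZ.
  - by exists n; exact: descendant_sumL.
have Sv : [set x | exists n, descendant_sum n x] v.
  exists 1; rewrite -[v]addr0; apply: descendant_sumS; first exact: descendant_hw.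
  exact: descendant_sum0.
have := irr _ sub => -[e|e]; last first.
  by have : [set: M] x by []; rewrite -e.
by move: Sv; rewrite e /= => /eqP; rewrite (negbTE v_neq0).
Qed.

Lemma homogeneous_neg k x : homog k x -> k < 0 -> x = 0.
Proof.
have [n hn] := all_descendants x.
by move=> hx; apply: descendant_neg; exact: (homogeneous_descendant hn).
Qed.

Lemma homogeneous_top x : homog 0 x -> exists a, x = a *: v.
Proof.
have [n hn] := all_descendants x => hx.
by apply: (descendant_top (k := 0)) => //; exact: (homogeneous_descendant hn).
Qed.

Lemma homogeneous_hw : homog 0 v.
Proof. by rewrite /homogeneous L0v mulr0z addr0. Qed.

Lemma homogeneous_ind (P : M -> Prop) : P 0 ->
  (forall x y, P x -> P y -> P (x + y)) ->
  (forall k x, homog k x -> P x) -> forall x, P x.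
Proof.
move=> P0 PD Ph x; have [n] := all_descendants x; elim=> {n x} // n k x y hx _.
by apply: PD; exact: Ph (descendant_homogeneous hx).
Qed.

End HighestWeight.

Section Uniqueness.
Variables (K : numFieldType) (c h : K) (M : lmodType K).
Variables (L : int -> {linear M -> M}) (v : M).
Hypothesis hM : irreducible_hw_module c h L v.
Local Notation homog := (homogeneous h L).

Let vir : virasoro_action c L. Proof. by case: hM. Qed.

(** A singular vector of degree k > 0 would be a highest weight vector of the same
    irreducible module, and v would have the negative degree - k with respect to it. *)
Lemma singular_eq0 k x : 0 < k -> homog k x -> L 1 x = 0 -> L 2 x = 0 -> x = 0.
Proof.
move=> k0 hx L1x L2x.
have Lpos (n : nat) : L n.+1%:Z x = 0.
  elim: n => [|[|n] IH] //.
  have := virasoro_bracket vir (m := n.+2%:Z) (n := 1) x isT.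
  rewrite IH L1x !linear0 addr0 => /esym/eqP.
  rewrite scaler_eq0 intr_eq0 => /orP[|/eqP]; first by lia.
  by rewrite (_ : n.+2%:Z + 1 = n.+3%:Z); last lia.
apply: contrapT => x0.
have hx' : irreducible_hw_module c (h + k%:~R) L x.
  split=> //; last by case: hM.
  by case=> [[|n]|n] // _; exact: Lpos.
have [_ + _ Lv _] := hM; apply.
apply: (homogeneous_neg hx' (k := - k)); last lia.
by rewrite /homogeneous Lv; congr (_ *: _); ring.
Qed.

Variables (I : eqType) (D : I -> M -> M) (deg : I -> int).
Hypothesis D_linear : forall i, linear (D i).
Hypothesis D_homog : forall i k x, homog k x -> homog (k - deg i) (D i x).
Hypothesis D_cov : forall m i, m \in [:: 1; 2; -1; -2] ->
  exists2 l : seq (K * I), all (fun t => deg t.2 == deg i + m) l &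
    forall x, L m (D i x) - D i (L m x) = \sum_(t <- l) t.1 *: D t.2 x.
Hypothesis D_top : forall i, deg i = 0 -> D i v = 0.

(** By induction on the degree of D i v: each D i v is singular, because L_1 and L_2
    send it to combinations of vectors D j v of smaller degree. *)
Lemma covariant_eq0_hw i : D i v = 0.
Proof.
have hw i' : homog (- deg i') (D i' v).
  by rewrite -sub0r; apply: D_homog; exact: homogeneous_hw hM.
suff : forall (n : nat) i, - deg i <= n%:Z -> D i v = 0.
  by move/(_ (absz (deg i))); apply; lia.
elim=> {i} [|n IH] i hi.
  case: (eqVneq (deg i) 0) => [/D_top//|di].
  by apply: (homogeneous_neg hM (hw i)); lia.
case: (leP (- deg i) n%:Z) => hi'; first exact: IH.
have Lm m : 0 < m -> m \in [:: 1; 2; -1; -2] -> L m (D i v) = 0.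
  move=> m0 hm; have [l /allP hl] := D_cov i hm => /(_ v).
  have [_ _ /(_ m m0) -> _ _] := hM.
  rewrite (_ : D i 0 = 0) ?subr0 => [->|]; last first.
    by have := D_linear i (-1) v v; rewrite !scaleN1r !addNr.
  rewrite big1_seq // => t /andP[_ /hl /eqP ht].
  by rewrite IH ?scaler0 // ht; lia.
by apply: (singular_eq0 _ (hw i)); [lia|exact: Lm|exact: Lm].
Qed.

(** The principle by which identities between fields reduce to identities on the
    highest weight vector in degree 0. The common kernel of a covariant family is a
    submodule, and it contains v. *)
Lemma covariant_eq0 i x : D i x = 0.
Proof.
have [_ v0 _ _ irr] := hM.
pose S : set M := [set y | forall i, D i y = 0].
have S0 : S 0 by move=> j; have := D_linear j (-1) v v; rewrite !scaleN1r !addNr.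
have Slin a y z : S y -> S z -> S (a *: y + z).
  by move=> hy hz j; rewrite D_linear hy hz scaler0 addr0.
have sub : virasoro_submodule L S.
  split=> //; apply: (virasoro_generators vir Slin) => m y hm hy j.
  have [l _ /(_ y)] := D_cov j hm.
  rewrite hy linear0 sub0r big1 => [/eqP|t _]; last by rewrite hy scaler0.
  by rewrite oppr_eq0 => /eqP.
have Sv : S v by move=> j; exact: covariant_eq0_hw.
case: (irr _ sub) => e; first by move: Sv; rewrite e /= => /v0.
by have : [set: M] x by []; rewrite -e; apply.
Qed.

End Uniqueness.

(** * The product of two primary fields *)

Section Binomial.
Variables (K : numFieldType) (s : K).

(** The coefficient of x^r in (1 - x)^s, which is 0 for r < 0. *)
Definition binom_coef (r : int) : K :=
  if r is Posz n then \prod_(i < n) ((i%:R - s) / i.+1%:R) else 0.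

Lemma binom_coef_neg r : r < 0 -> binom_coef r = 0.
Proof. by case: r. Qed.

Lemma binom_coef0 : binom_coef 0 = 1.
Proof. by rewrite /binom_coef /= big_ord0. Qed.

(** The differential equation (1 - x) f' = - s f of f = (1 - x)^s. *)
Lemma binom_coef_rec r :
  r%:~R * binom_coef r = ((r - 1)%:~R - s) * binom_coef (r - 1).
Proof.
case: r => [[|n]|n].
- by rewrite mul0r binom_coef_neg ?mulr0.
- rewrite (_ : n.+1%:Z - 1 = n%:Z); last lia.
  rewrite /binom_coef big_ord_recr /= mulrC -mulrA divfK ?pnatr_eq0 //.
  by rewrite mulrC.
- by rewrite !binom_coef_neg ?mulr0.
Qed.

End Binomial.

Section FieldProduct.
Variables (K : numFieldType) (c h h' hf delta delta' : K) (N : int).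
Variables (M M' : lmodType K).
Variables (L : int -> {linear M -> M}) (L' : int -> {linear M' -> M'}).
Variables (v : M) (v' : M').
Variables (psi : int -> {linear M -> M'}) (psi' : int -> {linear M' -> M}).
Hypothesis hM : irreducible_hw_module c h L v.
Hypothesis hM' : irreducible_hw_module c h' L' v'.
Hypothesis hpsi : primary_field hf delta L L' psi.
Hypothesis hpsi' : primary_field hf delta' L' L psi'.
Hypothesis h_delta : h + hf = h' + delta.
Hypothesis h_delta' : h' + hf = h + delta'.
Hypothesis N_delta : N%:~R = delta + delta.

Local Notation s := (hf + hf).
Local Notation homog := (homogeneous h L).
Local Notation homog' := (homogeneous h' L').
Local Notation bin := (binom_coef s).

Let delta'E : delta' = s - delta.
Proof.
have -> : delta' = h' + hf - h by rewrite h_delta' [h + _]addrC addrK.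
by have -> : h' = h + hf - delta by [rewrite h_delta addrK]; ring.
Qed.

(** The case m = 0 of the covariance relation. *)
Lemma primary_homogeneous n k x : homog k x -> homog' (k - n) (psi n x).
Proof.
move=> hx; have := hpsi 0 n x; rewrite hx linearZ /= => /eqP.
rewrite /homogeneous !addr0 subr_eq -scalerDl => /eqP ->; congr (_ *: _).
have -> : h' = h + hf - delta by rewrite h_delta addrK.
by ring.
Qed.

Lemma primary_homogeneous' n k x : homog' k x -> homog (k - n) (psi' n x).
Proof.
move=> hx; have := hpsi' 0 n x; rewrite hx linearZ /= => /eqP.
rewrite /homogeneous !addr0 subr_eq -scalerDl => /eqP ->; congr (_ *: _).
have -> : h = h' + hf - delta' by rewrite h_delta' addrK.
by ring.
Qed.

Lemma primary_truncated x : exists B : int, forall j, B < j -> psi j x = 0.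
Proof.
elim/(homogeneous_ind hM): x => [|x y [B hB] [B' hB']|k x hx].
- by exists 0 => j _; rewrite linear0.
- exists (`|B| + `|B'|) => j hj; rewrite linearD hB ?hB' ?addr0 //; lia.
- exists k => j hj; apply: (homogeneous_neg hM' (primary_homogeneous j hx)); lia.
Qed.

(** (z - w)^s psi'(z) psi(w) = \sum_(a, b) H_(a, b) z^(- a - delta) w^(- b - delta).
    The exponents of z and w agree because delta' = s - delta and N = 2 delta. *)
Definition product_coef (a b : int) (x : M) : M :=
  zsum (fun r => bin r *: psi' (a + N - r) (psi (b + r) x)).
Local Notation H := product_coef.

Lemma product_bounded x (f : int -> K) (b lo : int) (u : int -> int):
  (forall r, r < lo -> f r = 0) ->
  bounded (fun r => f r *: psi' (u r) (psi (b + r) x)).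
Proof.
move=> hf0; have [B hB] := primary_truncated x.
apply: (@bounded_halves _ _ _ _ lo (B - b)) => // r hr.
by rewrite hB ?linear0 //; lia.
Qed.

Lemma product_coef_shift i a b x : H (a - i) (b + i) x =
  zsum (fun r => bin (r - i) *: psi' (a + N - r) (psi (b + r) x)).
Proof.
rewrite -[RHS](zsum_shift i); apply: eq_zsum => r; rewrite addrK.
by congr (_ *: psi' _ (psi _ _)); lia.
Qed.

Lemma product_coef_linear a b : linear (H a b).
Proof.
move=> al x y; have hb z := product_bounded z b (fun r => a + N - r) (@binom_coef_neg _ s).
rewrite /product_coef zsumZ // -zsumD //; last exact: boundedZ.
by apply: eq_zsum => r; rewrite !linearP.
Qed.

Lemma product_coef_homogeneous a b k x :
  homog k x -> homog (k - (a + b + N)) (H a b x).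
Proof.
move=> hx; have hb := product_bounded x b (fun r => a + N - r) (@binom_coef_neg _ s).
rewrite /homogeneous /product_coef (zsum_linear _ hb).
rewrite (zsumZ _ hb); apply: eq_zsum => r.
rewrite linearZ /= !scalerA mulrC -scalerA; congr (_ *: _).
have /primary_homogeneous' := primary_homogeneous (b + r) hx.
move/(_ (a + N - r)); rewrite /homogeneous => ->.
by congr ((_ + _%:~R) *: _); lia.
Qed.

Lemma product_coef_truncated x :
  exists B : int, forall a b, B < b -> H a b x = 0.
Proof.
have [B hB] := primary_truncated x; exists B => a b hb.
apply: zsum0 => r; case: (ltP r 0) => r0; first by rewrite binom_coef_neg ?scale0r.
by rewrite hB ?linear0 ?scaler0 //; lia.
Qed.

(** (z^(m + 1) - w^(m + 1)) / (z - w) = \sum_((e, i) in geometric m) e z^(m - i) w^i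
    for m = 1, 2, - 1, - 2. *)
Definition geometric (m : int) : seq (K * int) :=
  if m == 1 then [:: (1, 0); (1, 1)]
  else if m == 2 then [:: (1, 0); (1, 1); (1, 2)]
  else if m == -2 then [:: (-1, -1)] else [::].

Lemma geometric_sum m : m \in [:: 1; 2; -1; -2] ->
  \sum_(t <- geometric m) t.1 = (m + 1)%:~R :> K.
Proof.
rewrite !inE => /or4P[] /eqP -> /=; rewrite /geometric /= ?big_cons big_nil /=.
all: ring.
Qed.

Lemma geometric_sym m (V : lmodType K) (F : int -> V) :
  m \in [:: 1; 2; -1; -2] ->
  \sum_(t <- geometric m) t.1 *: F (m - t.2) = \sum_(t <- geometric m) t.1 *: F t.2.
Proof.
rewrite !inE => /or4P[] /eqP -> /=; rewrite /geometric /= ?big_cons ?big_nil //=.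
  by rewrite subr0 subrr addr0 addrCA [in RHS]addr0.
by rewrite subr0 subrr (_ : 2 - 1 = 1 :> int) // !addr0 addrA addrC (addrC (_ *: F 2)).
Qed.

(** The identity
    ((z^(m + 1) d/dz + w^(m + 1) d/dw) (z - w)^s) (z - w)
      = s (z^(m + 1) - w^(m + 1)) (z - w)^s, read off on coefficients. *)
Lemma geometric_binom m r : m \in [:: 1; 2; -1; -2] ->
  s * (\sum_(t <- geometric m) t.1 * bin (r - t.2)) =
  s * bin r + (r - m)%:~R * bin (r - m) - r%:~R * bin r.
Proof.
have rec1 i j : j = i - 1 -> i%:~R * bin i = j%:~R * bin j - s * bin j.
  by move=> ->; rewrite binom_coef_rec mulrBl.
rewrite !inE => /or4P[] /eqP -> /=; rewrite /geometric /= ?big_cons big_nil /=.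
- by rewrite (rec1 r _ erefl) !subr0; ring.
- rewrite (rec1 r _ erefl) (rec1 (r - 1) (r - 2)) ?subr0; last by ring.
  by ring.
- by rewrite !opprK (rec1 (r + 1) r) ?addrK //; ring.
- rewrite !opprK (rec1 (r + 2) (r + 1)) ?(rec1 (r + 1) r) ?addrK //; last by ring.
  by ring.
Qed.

Definition ward_list m (a b : int) : seq (K * int) :=
  [:: (- ((a + m)%:~R + delta) + (m + 1)%:~R * hf, 0),
      (- ((b + m)%:~R + delta) + (m + 1)%:~R * hf, m)
    & [seq (- s * t.1, t.2) | t <- geometric m]].

(** [L_m, psi'(z) psi(w)] is given by the differential operator
    z^m (z d/dz + (m + 1) hf) + w^m (w d/dw + (m + 1) hf); moving it across (z - w)^s
    produces the additional term - s (z^(m + 1) - w^(m + 1)) / (z - w), a Laurent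
    polynomial whose terms are listed by geometric. *)
Lemma product_ward m a b x : m \in [:: 1; 2; -1; -2] ->
  L m (H a b x) - H a b (L m x) =
  \sum_(t <- ward_list m a b) t.1 *: H (a + m - t.2) (b + t.2) x.
Proof.
move=> hm.
pose C r := psi' (a + m + N - r) (psi (b + r) x).
pose w1 (i : int) : K := - ((i + m)%:~R + delta') + (m + 1)%:~R * hf.
pose w2 (j : int) : K := - ((j + m)%:~R + delta) + (m + 1)%:~R * hf.
have bC (f : int -> K) lo : (forall r, r < lo -> f r = 0) ->
  bounded (fun r => f r *: C r) by exact: product_bounded.
have bin0 r : r < 0 -> bin r = 0 by exact: binom_coef_neg.
(* w1 and w2 are the covariance factors of psi' and psi; the second sum is
   shifted by m so that both are expressed through the same products C r. *)
transitivity (zsum (fun r => (bin r * w1 (a + N - r)) *: C r) +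
              zsum (fun r => (bin (r - m) * w2 (b + r - m)) *: C r)).
  rewrite -[X in _ = _ + X](zsum_shift m) -zsumD; first last.
  - apply: (@bounded_shift _ m (fun r => (bin (r - m) * w2 (b + r - m)) *: C r)).
    apply: (bC _ m) => r hr.
    by rewrite bin0 ?mul0r //; lia.
  - by apply: (bC _ 0) => r hr; rewrite bin0 ?mul0r.
  have hb z := product_bounded z b (fun r => a + N - r) bin0.
  rewrite /product_coef (zsum_linear _ (hb _)) -scaleN1r zsumZ //.
  rewrite -zsumD; first last.
  - exact: boundedZ.
  - exact: bounded_linear.
  apply: eq_zsum => r; rewrite linearZ /= scalerA mulN1r scaleNr -scalerBr.
  rewrite addrK -!scalerA -scalerDr; congr (_ *: _).
  rewrite -(subrK (psi' (a + N - r) (L' m (psi (b + r) x))) (L m _)) -addrA.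
  rewrite -linearB hpsi hpsi' linearZ /=.
  rewrite /C (_ : a + m + N - r = a + N - r + m); last lia.
  rewrite (_ : a + m + N - (r + m) = a + N - r); last lia.
  rewrite (_ : b + (r + m) = b + r + m); last lia.
  by rewrite addrK.
transitivity (\sum_(t <- ward_list m a b)
    zsum (fun r => (t.1 * bin (r - t.2)) *: C r)); last first.
  apply: eq_bigr => t _; rewrite product_coef_shift zsumZ.
    by apply: eq_zsum => r; rewrite scalerA.
  by apply: (bC _ t.2) => r hr; rewrite bin0 //; lia.
rewrite -zsum_suml => [|t]; last first.
  by apply: (bC _ t.2) => r hr; rewrite bin0 ?mulr0 //; lia.
rewrite -zsumDl.
- apply: eq_zsum => r; congr (_ *: _).
  rewrite /ward_list !big_cons big_map /= subr0.
  under eq_bigr do rewrite -mulrA.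
  rewrite -mulr_sumr mulNr geometric_binom // /w1 /w2 (_ : b + r - m + m = b + r); last lia.
  rewrite delta'E.
  by rewrite !(intrD, intrN, N_delta); ring.
- by apply: (bC _ 0) => r hr; rewrite bin0 ?mul0r.
- by apply: (bC _ m) => r hr; rewrite bin0 ?mul0r //; lia.
Qed.

Hypothesis product_top_sym : forall a b, a + b + N = 0 -> H a b v = H b a v.

(** The coefficients H_(a, b) - H_(b, a) form a covariant family, because
    (z^(m + 1) - w^(m + 1)) / (z - w) is symmetric. *)
Lemma product_sym a b x : H a b x = H b a x.
Proof.
pose D (t : int * int) y := H t.1 t.2 y - H t.2 t.1 y.
apply/eqP; rewrite -subr_eq0 -[_ - _]/(D (a, b) x); apply/eqP.
apply: (covariant_eq0 hM (deg := fun t => t.1 + t.2 + N)) => /= [t|t k y hy|m t hm|t ht].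
- move=> al y z; rewrite /D !product_coef_linear scalerBr opprD addrACA //.
- apply: homogeneousB; first exact: product_coef_homogeneous.
  by rewrite (addrC t.1); exact: product_coef_homogeneous.
- exists [seq (u.1, (t.1 + m - u.2, t.2 + u.2)) | u <- ward_list m t.1 t.2].
    by apply/allP => _ /mapP[u _ ->] /=; lia.
  move=> y; rewrite big_map /D /= linearB opprD addrACA -opprD.
  rewrite !product_ward //.
  rewrite [X in - X](_ : _ = \sum_(u <- ward_list m t.1 t.2)
     u.1 *: H (t.2 + u.2) (t.1 + m - u.2) y).
    by rewrite -sumrB; apply: eq_bigr => u _; rewrite -scalerBr.
  rewrite /ward_list !big_cons !big_map /= addrCA.
  have e0 i : i - 0 = i :> int by lia.
  have e1 i : i + 0 = i :> int by lia.
  rewrite (e0 (t.2 + m)) (e0 (t.1 + m)) (e1 t.1) (e1 t.2) !addrK.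
  congr (_ + (_ + _)).
  under eq_bigr do rewrite -scalerA.
  under [RHS]eq_bigr do rewrite -scalerA.
  rewrite -!scaler_sumr; congr (_ *: _).
  rewrite -(geometric_sym (fun i => H (t.2 + m - i) (t.1 + i) y)) //.
  apply: eq_bigr => u _.
  by rewrite (_ : t.2 + m - (m - u.2) = t.2 + u.2) ?addrA //; ring.
- by rewrite /D product_top_sym ?subrr.
Qed.

(** The restriction of (z - w)^s psi'(z) psi(w) to w = z is
    \sum_q E_q z^(- q - 2 delta). The sum over a is finite by locality. *)
Definition diagonal_coef (q : int) (x : M) : M := zsum (fun a => H a (q - a) x).
Local Notation E := diagonal_coef.

Lemma product_diagonal_bounded q x (f : int -> K) j :
  bounded (fun a => f a *: H (a + j) (q - a) x).
Proof.
have [B hB] := product_coef_truncated x; apply: bounded_scale.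
apply: (@bounded_between _ (q - B) (B - j)) => a ha; first by apply: hB; lia.
by rewrite product_sym; apply: hB; lia.
Qed.

Lemma product_diagonal_bounded1 q x : bounded (fun a => H a (q - a) x).
Proof.
have := product_diagonal_bounded q x (fun=> 1) 0.
by congr bounded; apply: funext => a; rewrite scale1r addr0.
Qed.

Lemma diagonal_coef_linear q : linear (E q).
Proof.
move=> al x y; rewrite /diagonal_coef zsumZ; last exact: product_diagonal_bounded1.
rewrite -zsumD; first last.
- exact: product_diagonal_bounded1.
- exact/boundedZ/product_diagonal_bounded1.
by apply: eq_zsum => a; rewrite product_coef_linear.
Qed.

Lemma diagonal_coef_homogeneous q k x : homog k x -> homog (k - (q + N)) (E q x).
Proof.
move=> hx; have hb := product_diagonal_bounded1 q x.
rewrite /homogeneous /diagonal_coef (zsum_linear _ hb) (zsumZ _ hb).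
apply: eq_zsum => a; have := product_coef_homogeneous a (q - a) hx.
by rewrite (_ : a + (q - a) + N = q + N) //; lia.
Qed.

(** The restriction to w = z is primary of weight 0: its weight 2 hf = s is
    compensated by the weight - s of (z - w)^s. *)
Lemma diagonal_ward m q x : m \in [:: 1; 2; -1; -2] ->
  L m (E q x) - E q (L m x) = - (q + m + N)%:~R *: E (q + m) x.
Proof.
move=> hm; have hb := product_diagonal_bounded1 q.
have term (f : int -> K) i :
    zsum (fun a => f a *: H (a + m - i) (q - a + i) x) =
    zsum (fun a => f (a - m + i) *: H a (q + m - a) x).
  rewrite -[RHS](zsum_shift (m - i)); apply: eq_zsum => a.
  have -> : a + (m - i) - m + i = a by ring.
  have -> : q + m - (a + (m - i)) = q - a + i by ring.
  by rewrite addrA.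
have bd (f : int -> K) : bounded (fun a => f a *: H a (q + m - a) x).
  have := product_diagonal_bounded (q + m) x f 0.
  by congr bounded; apply: funext => a; rewrite addr0.
have bd' (f : int -> K) i : bounded (fun a => f a *: H (a + m - i) (q - a + i) x).
  have := product_diagonal_bounded (q + i) x f (m - i).
  congr bounded; apply: funext => a.
  by rewrite addrA (_ : q + i - a = q - a + i) //; ring.
rewrite /diagonal_coef (zsum_linear _ (hb _)) -scaleN1r zsumZ //.
rewrite -zsumD; [|exact: bounded_linear|exact: boundedZ].
rewrite zsumZ; last exact: product_diagonal_bounded1.
pose e1 (a : int) : K := - ((a + m)%:~R + delta) + (m + 1)%:~R * hf.
pose e2 (a : int) : K := - ((q - a + m)%:~R + delta) + (m + 1)%:~R * hf.
pose e3 (u : K * int) (a : int) : K := - s * u.1.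
transitivity (zsum (fun a => e1 a *: H (a + m - 0) (q - a + 0) x +
    (e2 a *: H (a + m - m) (q - a + m) x +
    \sum_(u <- geometric m) e3 u a *: H (a + m - u.2) (q - a + u.2) x))).
  apply: eq_zsum => a; rewrite scaleN1r product_ward //.
  by rewrite /ward_list !big_cons big_map.
rewrite zsumD; [|exact: bd'|apply: boundedD; [exact: bd'|apply: bounded_sum => u; exact: bd']].
rewrite zsumD; [|exact: bd'|apply: bounded_sum => u; exact: bd'].
rewrite zsum_sum; last by move=> u; exact: bd'.
rewrite (term e1) (term e2) (eq_bigr _ (fun u _ => term (e3 u) u.2)).
rewrite -zsum_suml; last by move=> u; exact: bd.
rewrite -zsumDl; [|exact: bd|exact: bd].
rewrite -zsumDl; [|exact: bd|exact: bd].
apply: eq_zsum => a; congr (_ *: _).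
rewrite /e3 -mulr_sumr geometric_sum // /e1 /e2 !(intrD, intrN, N_delta).
by ring.
Qed.

(** Subtracting the constant field kappa keeps the family of the E_q covariant, and
    kappa is chosen so that the difference kills v in degree 0. *)
Lemma diagonal_coef_scalar :
  exists kappa : K, forall q x, E q x = if q == - N then kappa *: x else 0.
Proof.
have hw : homog 0 (E (- N) v).
  by have := diagonal_coef_homogeneous (- N) (homogeneous_hw hM); rewrite addNr subr0.
have [kappa hk] := homogeneous_top hM hw; exists kappa => q x.
pose D (k : int) y := E (k - N) y - (if k == 0 then kappa *: y else 0).
suff hD k y : D k y = 0.
  by have /eqP := hD (q + N) x; rewrite /D addrK subr_eq0 addr_eq0 => /eqP.
apply: (covariant_eq0 hM (deg := id)) => /= {k y} [k|k j y hy|m k hm|k ->].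
- move=> al y z; rewrite /D diagonal_coef_linear; case: ifP => _.
    by rewrite [kappa *: (_ + _)]scalerDr scalerBr opprD addrACA !scalerA mulrC.
  by rewrite !subr0.
- apply: homogeneousB.
    by have := diagonal_coef_homogeneous (k - N) hy; rewrite subrK.
  case: eqP => [->|_]; last exact: homogeneous0.
  by rewrite subr0; exact: homogeneousZ.
- exists [:: (- (k + m)%:~R, k + m)]; first by rewrite /= eqxx.
  move=> y; rewrite big_seq1 /D /= linearB opprD addrACA diagonal_ward //.
  rewrite (_ : k - N + m + N = k + m); last lia.
  rewrite (_ : k - N + m = k + m - N); last lia.
  rewrite scalerBr; congr (_ + _).
  have -> : L m (if k == 0 then kappa *: y else 0) =
            if k == 0 then kappa *: L m y else 0.
    by case: ifP => _; rewrite ?linear0 ?linearZ.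
  rewrite opprK addNr; case: eqP => [->|_]; last by rewrite scaler0 oppr0.
  by rewrite mulr0z oppr0 scale0r oppr0.
- by rewrite /D eqxx sub0r hk subrr.
Qed.

End FieldProduct.

(** * The binomial series times a hypergeometric series *)

Section BinomialConvolution.
Variables (K : numFieldType) (s : K) (V : lmodType K) (y : int -> V).
Hypothesis y_neg : forall n, n < 0 -> y n = 0.
Local Notation bin := (binom_coef s).

(** The coefficients of (1 - x)^s \sum_n y_n x^n. *)
Definition binom_conv (n : int) : V := zsum (fun r => bin r *: y (n - r)).
Local Notation p := binom_conv.

Lemma conv_bounded (f : int -> K) lo n :
  (forall r, r < lo -> f r = 0) -> bounded (fun r => f r *: y (n - r)).
Proof. by move=> hf; apply: (bounded_halves hf (hi := n)) => r hr; apply: y_neg; lia. Qed.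

Lemma binom_conv_neg n : n < 0 -> p n = 0.
Proof.
move=> hn; apply: zsum0 => r; case: (ltP r 0) => hr.
  by rewrite binom_coef_neg ?scale0r.
by rewrite y_neg ?scaler0 //; lia.
Qed.

Lemma binom_conv_shift i n : p (n - i) = zsum (fun r => bin (r - i) *: y (n - r)).
Proof.
rewrite -[RHS](zsum_shift i); apply: eq_zsum => r; rewrite addrK.
by congr (_ *: y _); lia.
Qed.

End BinomialConvolution.

Section InverseConvolution.
Variables (K : numFieldType) (s : K) (V : lmodType K) (y : int -> V).
Hypothesis y_neg : forall n, n < 0 -> y n = 0.
Hypothesis y_rec : forall n, n%:~R *: y n = ((n - 1)%:~R + s) *: y (n - 1).
Local Notation bin := (binom_coef s).
Local Notation p := (binom_conv s y).

(** The recursion says that y is y_0 (1 - x)^(- s). *)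
Lemma binom_conv_inverse n : n != 0 -> p n = 0.
Proof.
have bd := conv_bounded y_neg.
have rec (m : int) : m%:~R *: p m = (m - 1)%:~R *: p (m - 1).
  rewrite /binom_conv !zsumZ; first last.
  - by apply: (bd _ 0) => r hr; rewrite binom_coef_neg.
  - by apply: (bd _ 0) => r hr; rewrite binom_coef_neg.
  transitivity (zsum (fun r => (r%:~R * bin r) *: y (m - r)) +
                zsum (fun r => (bin r * ((m - r)%:~R)) *: y (m - r))).
    rewrite -zsumDl.
    - by apply: eq_zsum => r; rewrite scalerA; congr (_ *: _); rewrite intrB; ring.
    - by apply: (bd _ 0) => r hr; rewrite binom_coef_neg ?mulr0.
    - by apply: (bd _ 0) => r hr; rewrite binom_coef_neg ?mul0r.
  transitivity (zsum (fun r => ((r%:~R - s) * bin r) *: y (m - 1 - r)) +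
                zsum (fun r => (bin r * ((m - 1 - r)%:~R + s)) *: y (m - 1 - r))).
    congr (_ + _).
      rewrite -[LHS](zsum_shift 1); apply: eq_zsum => r.
      by rewrite binom_coef_rec addrK; congr (_ *: y _); lia.
    apply: eq_zsum => r; rewrite -!scalerA y_rec.
    by rewrite (_ : m - r - 1 = m - 1 - r) //; lia.
  rewrite -zsumDl.
  - by apply: eq_zsum => r; rewrite scalerA; congr (_ *: _); rewrite !intrB; ring.
  - by apply: (bd _ 0) => r hr; rewrite binom_coef_neg ?mulr0.
  - by apply: (bd _ 0) => r hr; rewrite binom_coef_neg ?mul0r.
have pos (k : nat) : p k.+1%:Z = 0.
  elim: k => [|k IH].
    have /eqP := rec 1.
    by rewrite subrr scale0r scaler_eq0 intr_eq0 /= => /eqP.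
  have /eqP := rec k.+2%:Z; rewrite (_ : k.+2%:Z - 1 = k.+1%:Z); last lia.
  by rewrite IH scaler0 scaler_eq0 intr_eq0 /= => /eqP.
case: n => [[|n]|n] // _; by apply: binom_conv_neg.
Qed.

End InverseConvolution.

Section HypergeometricConvolution.
Variables (K : numFieldType) (s h t : K) (N : nat) (V : lmodType K) (y : int -> V).
Hypothesis h_s : s = h + h.
Hypothesis t_h : 3%:R * t = 2%:R + 4%:R * h.
Hypothesis N_s : N%:R = s + s.
Hypothesis t_nint : forall n : int, n%:~R != t.
Hypothesis t2_nint : forall n : int, n%:~R != t + t.
Hypothesis y_neg : forall n, n < 0 -> y n = 0.
Hypothesis y_rec : forall n : int,
  (n%:~R * (n%:~R + 1 - t - t)) *: y n
  - (2%:R * (n%:~R - 1 - s) * (n%:~R - 1)) *: y (n - 1)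
  + ((n%:~R - 2%:R) * (n%:~R - 1) - t * (n%:~R - 2%:R + h)) *: y (n - 2) = 0.
Local Notation bin := (binom_coef s).
Local Notation p := (binom_conv s y).

Let residual (n : int) : V := (n%:~R * (n%:~R + 1 - t - t)) *: p n
  - ((n%:~R - 1 - N%:R) * (n%:~R - t)) *: p (n - 1).

(** The recursion for y is a second order equation for \sum_n y_n x^n with
    singularities at 0, 1 and infinity. The function (1 - x)^s \sum_n y_n x^n has
    exponent 0 at x = 1, so that its equation is hypergeometric; the recursion
    obtained directly is the hypergeometric one multiplied by 1 - x. *)
Lemma conv_hypergeometric_step n : residual n = residual (n - 1).
Proof.
have bd := conv_bounded y_neg.
have bin0 r : r < 0 -> bin r = 0 by exact: binom_coef_neg.
pose c0 (x : K) := x * (x + 1 - t - t).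
pose c1 (x : K) := - (2%:R * (x - 1 - s) * (x - 1)).
pose c2 (x : K) := (x - 2%:R) * (x - 1) - t * (x - 2%:R + h).
pose x : K := n%:~R.
(* The recursion for y multiplied by (1 - x)^s, then rearranged by the y_(n - r). *)
have z0 : zsum (fun r : int => bin r *: (c0 (x - r%:~R) *: y (n - r)
   + c1 (x - r%:~R) *: y (n - r - 1) + c2 (x - r%:~R) *: y (n - r - 2))) = 0.
  apply: zsum0 => r; have := y_rec (n - r).
  by rewrite intrB /c0 /c1 /c2 scaleNr => ->; rewrite scaler0.
have z1 : zsum (fun r : int => (bin r * c0 (x - r%:~R)
    + bin (r - 1) * c1 (x - r%:~R + 1) + bin (r - 2) * c2 (x - r%:~R + 2%:R)) *: y (n - r)) = 0.
  rewrite zsumDl; first last.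
  - by apply: (bd _ 0) => r hr; rewrite bin0 ?mul0r //; lia.
  - by apply: (bd _ 0) => r hr; rewrite !bin0 ?mul0r ?addr0 //; lia.
  rewrite zsumDl; first last.
  - by apply: (bd _ 0) => r hr; rewrite bin0 ?mul0r //; lia.
  - by apply: (bd _ 0) => r hr; rewrite bin0 ?mul0r //; lia.
  rewrite -[X in _ + X + _](zsum_shift 1) -[X in _ + _ + X](zsum_shift 2).
  rewrite -zsumD; first last.
  - apply: (@bounded_shift _ 1 (fun r : int => (bin (r - 1) * c1 (x - r%:~R + 1)) *: y (n - r))).
    by apply: (bd _ 0) => r hr; rewrite bin0 ?mul0r //; lia.
  - by apply: (bd _ 0) => r hr; rewrite bin0 ?mul0r //; lia.
  rewrite -zsumD; first last.
  - apply: (@bounded_shift _ 2 (fun r : int => (bin (r - 2) * c2 (x - r%:~R + 2%:R)) *: y (n - r))).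
    by apply: (bd _ 0) => r hr; rewrite bin0 ?mul0r //; lia.
  - apply: boundedD; first by apply: (bd _ 0) => r hr; rewrite bin0 ?mul0r //; lia.
    apply: (@bounded_shift _ 1 (fun r : int => (bin (r - 1) * c1 (x - r%:~R + 1)) *: y (n - r))).
    by apply: (bd _ 0) => r hr; rewrite bin0 ?mul0r //; lia.
  rewrite -[RHS]z0; apply: eq_zsum => r.
  rewrite !addrK !scalerDr !scalerA !opprD !addrA.
  by congr (_ *: _ + (_ * c1 _) *: _ + (_ * c2 _) *: _); rewrite /x !intrD; ring.
have pE i (a : K) : a *: p (n - i) = zsum (fun r => (a * bin (r - i)) *: y (n - r)).
  rewrite binom_conv_shift zsumZ; first by apply: eq_zsum => r; rewrite scalerA.
  by apply: (bd _ i) => r hr; rewrite bin0 //; lia.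
have bdi (a : K) i : bounded (fun r => (a * bin (r - i)) *: y (n - r)).
  by apply: (bd _ i) => r hr; rewrite bin0 ?mulr0 //; lia.
apply/eqP; rewrite -subr_eq0 -[X in _ == X]z1; apply/eqP.
rewrite /residual -[p n](congr1 p (subr0 n)) (_ : n - 1 - 1 = n - 2); last by ring.
rewrite opprB addrA addrAC -[_ - _ - _]addrA -opprD -scalerDl -scaleNr !pE.
rewrite -zsumDl // addrC -zsumDl //; last first.
  by apply: (bd _ 0) => r hr; rewrite !bin0 ?mulr0 ?addr0 //; lia.
apply: eq_zsum => r; congr (_ *: _).
have b1 : r%:~R * bin r = (r%:~R - 1 - s) * bin (r - 1).
  by rewrite binom_coef_rec intrB.
have b2 : (r%:~R - 1) * bin (r - 1) = (r%:~R - 2%:R - s) * bin (r - 2).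
  have := binom_coef_rec s (r - 1); rewrite (_ : r - 1 - 1 = r - 2); last by ring.
  by rewrite !intrB.
have hE : h = (3%:R * t - 2%:R) / 4%:R by rewrite t_h; field.
apply/eqP; rewrite -subr_eq0 subr0; set lhs := (X in X == 0).
(* The coefficient of y_(n - r) is a combination of two instances of the
   recursion for the binomial coefficients. *)
have -> : lhs = (r%:~R * bin r - (r%:~R - 1 - s) * bin (r - 1))
    * (2%:R * x - r%:~R + 1 - t - t)
  + ((r%:~R - 1) * bin (r - 1) - (r%:~R - 2%:R - s) * bin (r - 2))
    * (r%:~R - (2%:R * x - 3%:R + t + t - s - s - s)).
  rewrite /lhs /c0 /c1 /c2 /x N_s h_s hE.
  by field.
by rewrite b1 b2 !subrr !mul0r addr0.
Qed.

(** The residual does not depend on n and vanishes for negative n. *)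
Lemma conv_hypergeometric n : n%:~R * (n%:~R + 1 - t - t) *: p n
  = ((n%:~R - 1 - N%:R) * (n%:~R - t)) *: p (n - 1).
Proof.
suff r0 : residual n = 0 by apply/eqP; rewrite -subr_eq0 -[_ - _]/(residual n) r0.
have step k m : residual m = residual (m - k%:Z).
  elim: k => [|k IH]; first by rewrite subr0.
  by rewrite IH conv_hypergeometric_step; congr residual; lia.
rewrite (step (absz n).+1 n) /residual !binom_conv_neg ?scaler0 ?subr0 //; lia.
Qed.

Let antisym (n : int) : V := p n - p (N%:Z - n).

Lemma conv_antisym n : (n%:~R * (n%:~R + 1 - t - t)) *: antisym n
  = ((n%:~R - 1 - N%:R) * (n%:~R - t)) *: antisym (n - 1).
Proof.
rewrite /antisym !scalerBr conv_hypergeometric; congr (_ - _).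
have hE : h = (3%:R * t - 2%:R) / 4%:R by rewrite t_h; field.
have := conv_hypergeometric (N%:Z - (n - 1)).
rewrite (_ : N%:Z - (n - 1) - 1 = N%:Z - n); last by ring.
have -> : (N%:Z - (n - 1))%:~R * ((N%:Z - (n - 1))%:~R + 1 - t - t) =
    (n%:~R - 1 - N%:R) * (n%:~R - t) :> K.
  by rewrite !intrB -[N%:~R]/(N%:R) N_s h_s hE; field.
move=> ->; congr (_ *: _).
by rewrite !intrB -[N%:~R]/(N%:R) N_s h_s hE; field.
Qed.

(** The recursion is invariant under n |-> N - n, so the antisymmetric part of p
    satisfies it too. That part vanishes near the middle N / 2, and the recursion
    propagates this upwards as its leading coefficient n (n + 1 - 2 t) is nonzero
    for n > 0. *)
Lemma conv_palindromic n : p n = p (N%:Z - n).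
Proof.
have anti m : antisym (N%:Z - m) = - antisym m.
  by rewrite /antisym subKr opprB.
have half m : antisym m = - antisym m -> antisym m = 0.
  by move/eqP; rewrite -addr_eq0 -mulr2n -scaler_nat scaler_eq0 pnatr_eq0 => /eqP.
have nt m : m%:~R - t != 0 by rewrite subr_eq0.
have n2t m : m%:~R + 1 - t - t != 0.
  rewrite -addrA -opprD subr_eq0; have := t2_nint (m + 1).
  by rewrite intrD.
(* For even N the antisymmetric part vanishes at N / 2. For odd N = 2 k + 1 the
   recursion from k to k + 1 has the same coefficient on both sides, while the
   values are opposite. *)
have [m0 [m0_ge0 [m0_le hm0]]] : exists m : int,
    0 <= m /\ m <= N%:Z - m /\ antisym m = 0.
  have := odd_double_half N; set k := N./2; case: (odd N) => /= kN.
    exists k%:Z; split; [lia|split; first lia].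
    have e := conv_antisym k.+1%:Z.
    have e1 : k.+1%:Z - 1 = k%:Z by lia.
    rewrite e1 in e.
    have e2 : antisym k.+1%:Z = - antisym k%:Z by rewrite -anti; congr antisym; lia.
    rewrite e2 in e.
    have c0 : k%:~R - t != 0 := nt _.
    have hE : h = (3%:R * t - 2%:R) / 4%:R by rewrite t_h; field.
    have kE : N%:R = 1 + k%:R + k%:R :> K by rewrite -kN -addnn !natrD addrA.
    have tE : t = (N%:R + 2%:R) / 3%:R by rewrite N_s h_s hE; field.
    have d1 : (k.+1%:~R * (k.+1%:~R + 1 - t - t)) = - ((k%:R + 1) * k%:R / 3%:R) :> K.
      by rewrite tE kE -[k.+1%:~R]/(k.+1%:R) -natr1; field.
    have d2 : (k.+1%:~R - 1 - N%:R) * (k.+1%:~R - t) = - ((k%:R + 1) * k%:R / 3%:R) :> K.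
      by rewrite tE kE -[k.+1%:~R]/(k.+1%:R) -natr1; field.
    have k0 : k%:R != 0 :> K.
      apply: contra (nt 1); rewrite -[1%:~R]/(1 : K) tE kE => /eqP ->.
      by apply/eqP; field.
    rewrite pnatr_eq0 in k0; rewrite d1 d2 in e; apply: half; apply/esym/eqP; rewrite -subr_eq0.
    move/eqP: e; rewrite -subr_eq0 -scalerBr scaler_eq0 => /orP[|//].
    by rewrite oppr_eq0 !mulf_eq0 invr_eq0 natr1 !pnatr_eq0 (negbTE k0).
  exists k%:Z; split; [lia|split; first lia].
  by apply: half; rewrite -anti; congr antisym; lia.
have up (k : nat) : antisym (m0 + k%:Z) = 0.
  elim: k => [|k IH]; first by rewrite addr0.
  have := conv_antisym (m0 + k.+1%:Z); rewrite (_ : m0 + k.+1%:Z - 1 = m0 + k%:Z); last lia.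
  rewrite IH scaler0 => /eqP; rewrite scaler_eq0 mulf_eq0 (negbTE (n2t _)) orbF.
  by rewrite intr_eq0 => /orP[|/eqP //]; lia.
apply/eqP; rewrite -subr_eq0 -[_ - _]/(antisym n); apply/eqP.
case: (leP m0 n) => hn.
  by rewrite (_ : n = m0 + (absz (n - m0)%R)%:Z); [exact: up|lia].
rewrite -[antisym n]opprK -anti (_ : N%:Z - n = m0 + (absz (N%:Z - n - m0)%R)%:Z); last lia.
by rewrite up oppr0.
Qed.

End HypergeometricConvolution.

(** * Null vectors and matrix elements on highest weight vectors *)

Lemma vacuum_null (K : numFieldType) (c : K) (M : lmodType K)
    (L : int -> {linear M -> M}) (v : M) :
  irreducible_hw_module c 0 L v -> L (-1) v = 0.
Proof.
move=> hM; have [vir _ Lpos L0 _] := hM.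
have hv := homogeneous_hw hM.
apply: (singular_eq0 hM (k := 1)) => //.
- by have := homogeneousL vir (-1) hv.
- rewrite (virasoroC vir) (Lpos 1) // linear0 L0 scale0r scaler0 add0r.
  by rewrite !subrr ?mulr0 ?scale0r ?addr0 //= expr1n subrr mulr0 scale0r.
- rewrite (virasoroC vir) (Lpos 2) // linear0 (_ : 2 + -1 = 1) // Lpos //.
  by rewrite scaler0 scale0r !addr0.
Qed.

(** The condition on c is the vanishing of the Kac determinant at level 2; for
    c t = 12 h - 8 h t the vector L_(-1)^2 v - t L_(-2) v is singular. *)
Lemma level2_null (K : numFieldType) (c h t : K) (M : lmodType K)
    (L : int -> {linear M -> M}) (v : M) :
  irreducible_hw_module c h L v -> 3%:R * t = 2%:R + 4%:R * h ->
  c * t = 12%:R * h - 8%:R * h * t ->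
  L (-1) (L (-1) v) = t *: L (-2) v.
Proof.
move=> hM ht hc; have [vir _ Lpos L0 _] := hM.
have hv := homogeneous_hw hM.
have h1 := homogeneousL vir (-1) hv; rewrite sub0r opprK in h1.
have h2 := homogeneousL vir (-2) hv; rewrite sub0r opprK in h2.
have h11 := homogeneousL vir (-1) h1; rewrite opprK in h11.
have br m n x : m + n != 0 -> L m (L n x) = L n (L m x) + (m - n)%:~R *: L (m + n) x.
  by move=> mn; rewrite (virasoroC vir) (negbTE mn) scale0r addr0.
have L1L1 : L 1 (L (-1) v) = (2%:R * h) *: v.
  rewrite (virasoroC vir) (Lpos 1) // linear0 add0r L0 scalerA.
  by rewrite expr1n subrr mulr0 scale0r addr0.
have L2L1 : L 2 (L (-1) v) = 0.
  by rewrite br // (Lpos 2) // linear0 add0r (Lpos (2 - 1)) // scaler0.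
apply/eqP; rewrite -subr_eq0; apply/eqP.
apply: (singular_eq0 hM (k := 2)) => //.
- by apply: homogeneousB => //; exact: homogeneousZ.
- rewrite linearB linearZ /= (virasoroC vir 1 (-1)) L1L1 linearZ /= ?subrr ?eqxx.
  rewrite (br 1 (-2)) // (Lpos 1) // linear0 add0r.
  rewrite mulr0z mulr0 scale0r addr0 (_ : 1 - 2 = -1 :> int) //.
  rewrite /homogeneous in h1; rewrite h1 !scalerA -!scalerDl -scalerBl.
  rewrite (_ : 2 * h + _ - _ = 0) ?scale0r //.
  have -> : h = (3%:R * t - 2%:R) / 4%:R by rewrite ht; field.
  by field.
- rewrite linearB linearZ /= (br 2 (-1)) // L2L1 linear0 add0r (_ : 2 + -1 = 1 :> int) // L1L1.
  rewrite (virasoroC vir 2 (-2)) (Lpos 2) // linear0 add0r (_ : 2 + -2 = 0 :> int) // eqxx L0.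
  rewrite !scalerA -!scalerDl scalerA -scalerBl.
  rewrite (_ : _ - _ = 0) ?scale0r //.
  transitivity ((12%:R * h - 8%:R * h * t - c * t) / 2%:R); first by field.
  by rewrite hc subrr mul0r.
Qed.

Section TopCoefficients.
Variables (K : numFieldType) (c h h' hf delta delta' : K) (N : int).
Variables (M M' : lmodType K).
Variables (L : int -> {linear M -> M}) (L' : int -> {linear M' -> M'}).
Variables (v : M) (v' : M').
Variables (psi : int -> {linear M -> M'}) (psi' : int -> {linear M' -> M}).
Hypothesis hM : irreducible_hw_module c h L v.
Hypothesis hM' : irreducible_hw_module c h' L' v'.
Hypothesis hpsi : primary_field hf delta L L' psi.
Hypothesis hpsi' : primary_field hf delta' L' L psi'.
Hypothesis h_delta : h + hf = h' + delta.
Hypothesis h_delta' : h' + hf = h + delta'.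

Local Notation homog := (homogeneous h L).
Local Notation homog' := (homogeneous h' L').
Let y (n : int) : M := psi' n (psi (- n) v).

Lemma top_coef_neg n : n < 0 -> y n = 0.
Proof.
move=> hn; rewrite /y.
have hu := primary_homogeneous hpsi h_delta (- n) (homogeneous_hw hM).
by rewrite (homogeneous_neg hM' hu) ?linear0 //; lia.
Qed.

(** On the highest weight vector the coefficients of total degree 0 are those of a
    series in x = w / z, namely (1 - x)^s \sum_n y_n x^n. *)
Lemma product_coef_top a b : a + b + N = 0 ->
  product_coef hf N psi psi' a b v = binom_conv (hf + hf) y (- b).
Proof.
move=> hab; apply: eq_zsum => r; congr (_ *: psi' _ (psi _ _)); lia.
Qed.

(** psi' n lowers w to negative degree and kills it, so only one term of the
    commutator [L_(- m), psi'] contributes. *)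
Lemma primary_lowering n m w : homog' (n - m) w -> 0 < m ->
  psi' n (L' (- m) w) =
  ((n - m)%:~R + delta' - (1 - m)%:~R * hf) *: psi' (n - m) w.
Proof.
move=> hw m0.
have h0 : psi' n w = 0.
  have := primary_homogeneous hpsi' h_delta' n hw.
  by move/(homogeneous_neg hM) => -> //; lia.
have := hpsi' (- m) n w; rewrite h0 linear0 sub0r => /(congr1 -%R).
rewrite opprK -scaleNr => ->; congr (_ *: _).
by rewrite opprD opprK; congr (_ - _%:~R * _); ring.
Qed.

(** L_(-1) v = 0 turns the covariance of psi under L_(-1) into a first order
    equation for psi'(z) psi(w) v. *)
Lemma vacuum_recursion : delta = 0 -> L (-1) v = 0 ->
  forall n, n%:~R *: y n = ((n - 1)%:~R + (hf + hf)) *: y (n - 1).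
Proof.
move=> d0 Lv n; have hu := primary_homogeneous hpsi h_delta (- (n - 1)) (homogeneous_hw hM).
have e := hpsi (-1) (- (n - 1)) v.
rewrite Lv linear0 subr0 addNr mul0r addr0 d0 addr0 in e.
have -> : n%:~R *: y n = psi' n (L' (-1) (psi (- (n - 1)) v)).
  rewrite e linearZ /= (_ : - (n - 1) - 1 = - n); last by ring.
  by rewrite intrN opprK.
rewrite sub0r opprK in hu.
rewrite primary_lowering // subrr mul0r subr0; congr ((_ + _) *: _).
have -> : delta' = h' + hf - h by rewrite h_delta' [h + _]addrC addrK.
by have -> : h' = h + hf - delta by [rewrite h_delta addrK]; rewrite d0; ring.
Qed.

(** Both sides of L_(-1)^2 v = t L_(-2) v are moved across psi and psi' by
    covariance; on coefficients this is the second order equation of Belavin,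
    Polyakov and Zamolodchikov. *)
Lemma level2_recursion t : delta' = 0 -> delta = hf + hf ->
    3%:R * t = 2%:R + 4%:R * hf ->
    L (-1) (L (-1) v) = t *: L (-2) v ->
  forall n : int, (n%:~R * (n%:~R + 1 - t - t)) *: y n
  - (2%:R * (n%:~R - 1 - (hf + hf)) * (n%:~R - 1)) *: y (n - 1)
  + ((n%:~R - 2%:R) * (n%:~R - 1) - t * (n%:~R - 2%:R + hf)) *: y (n - 2) = 0.
Proof.
move=> d'0 d ht hnull n.
have hu m : homog' m (psi (- m) v).
  have := primary_homogeneous hpsi h_delta (- m) (homogeneous_hw hM).
  by rewrite sub0r opprK.
have cov1 m w : psi (- (m - 1)) (L (-1) w) = L' (-1) (psi (- (m - 1)) w)
    - (m%:~R - (hf + hf)) *: psi (- m) w.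
  rewrite -[LHS](subKr (L' (-1) (psi (- (m - 1)) w))) hpsi addNr mul0r addr0 d.
  rewrite (_ : - (m - 1) - 1 = - m); last by ring.
  by congr (_ - _ *: _); rewrite intrN; ring.
have cov2 : psi (- (n - 2)) (L (-2) v) = L' (-2) (psi (- (n - 2)) v)
    - (n%:~R - (hf + hf) - hf) *: psi (- n) v.
  rewrite -[LHS](subKr (L' (-2) (psi (- (n - 2)) v))) hpsi d.
  rewrite (_ : - (n - 2) - 2 = - n); last by ring.
  by congr (_ - _ *: _); rewrite intrN; ring.
have low1 k w : homog' (k - 1) w ->
    psi' k (L' (-1) w) = (k%:~R - 1) *: psi' (k - 1) w.
  move=> hw; rewrite primary_lowering // subrr mul0r subr0 d'0 addr0.
  by rewrite intrB.
have hu1 : homog' (n - 1) (L' (-1) (psi (- (n - 2)) v)).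
  have [vir _ _ _ _] := hM'; have := homogeneousL vir (-1) (hu (n - 2)).
  by rewrite (_ : n - 2 - -1 = n - 1) //; ring.
have hu2 : homog' (n - 1 - 1) (psi (- (n - 2)) v).
  by rewrite (_ : n - 1 - 1 = n - 2) //; ring.
have lhs : psi' n (psi (- (n - 2)) (L (-1) (L (-1) v))) =
   ((n%:~R - 1) * (n%:~R - 2%:R)) *: y (n - 2)
   - (2%:R * (n%:~R - 1 - (hf + hf)) * (n%:~R - 1)) *: y (n - 1)
   + ((n%:~R - 1 - (hf + hf)) * (n%:~R - (hf + hf))) *: y n.
  have e1 := cov1 (n - 1); rewrite (_ : n - 1 - 1 = n - 2) in e1; last by ring.
  rewrite e1 e1 cov1 !linearB !linearZ /= (low1 _ _ hu1) (low1 _ _ hu2).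
  rewrite !(low1 _ _ (hu _)) .
  have -> : psi' (n - 1 - 1) (psi (- (n - 2)) v) = y (n - 2).
    by rewrite /y (_ : n - 1 - 1 = n - 2) //; ring.
  rewrite !opprK !scalerN !scalerA -/(y n) -/(y (n - 1)) addrA -[X in X + _]addrA.
  rewrite -opprD -scalerDl.
  by congr (_ *: _ - _ *: _ + _ *: _); rewrite intrB; ring.
move: lhs; rewrite hnull !linearZ /= cov2 linearB linearZ /= -/(y n).
rewrite (primary_lowering (hu _)) // d'0 => e.
move: e; rewrite scalerBr !scalerA => e.
set Y0 := y n; set Y1 := y (n - 1); set Y2 := y (n - 2).
rewrite -/Y0 -/Y1 -[psi' _ (psi _ v)]/Y2 -/Y2 in e.
rewrite scalerN in e *.
have hE : hf = (3%:R * t - 2%:R) / 4%:R by rewrite ht; field.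
have -> : n%:~R * (n%:~R + 1 - t - t) =
    (n%:~R - 1 - (hf + hf)) * (n%:~R - (hf + hf)) + t * (n%:~R - (hf + hf) - hf) :> K.
  by rewrite hE; field.
have -> : (n%:~R - 2%:R) * (n%:~R - 1) - t * (n%:~R - 2%:R + hf) =
    (n%:~R - 1) * (n%:~R - 2%:R) - t * ((n - 2)%:~R + 0 - (1 - 2)%:~R * hf) :> K.
  by rewrite !intrB; ring.
rewrite scalerDl scalerBl.
have rearrange (p q x d1 e1 : M) : p - q = x - d1 + e1 -> e1 + q - d1 + (x - p) = 0.
  move=> pq; rewrite -(subrK q p) pq.
  have -> : x - d1 + e1 + q = x + (e1 + q - d1).
    by rewrite -!addrA; congr (x + _); rewrite addrC -addrA.
  by rewrite opprD [x + _]addrA subrr add0r subrr.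
exact: rearrange e.
Qed.

End TopCoefficients.

(** * Polynomials as a Heisenberg module *)

Lemma linear_morphD (K : pzRingType) (U V : lmodType K) (f : U -> V) :
  linear f -> {morph f : p q / p + q}.
Proof. by move=> lf p q; have := lf 1 p q; rewrite !scale1r. Qed.

Lemma linear_scalable (K : pzRingType) (U V : lmodType K) (f : U -> V) :
  linear f -> forall a p, f (a *: p) = a *: f p.
Proof.
move=> lf a p; have f0 := morphD0 (linear_morphD lf).
by have := lf a p 0; rewrite f0 !addr0.
Qed.

Section GeneratorRule.
Variables (K : fieldType) (F : comAlgType K) (D : F -> F) (g : F) (e : K).
Hypotheses (DD : {morph D : p q / p + q}) (DZ : forall a p, D (a *: p) = a *: D p).
Let Q p := D (g * p) = e *: p + g * D p.

Lemma generator_rule0 : Q 0.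
Proof. by rewrite /Q mulr0 (morphD0 DD) scaler0 mulr0 addr0. Qed.

Lemma generator_ruleD p q : Q p -> Q q -> Q (p + q).
Proof. by rewrite /Q => hp hq; rewrite mulrDr !DD hp hq scalerDr mulrDr addrACA. Qed.

Lemma generator_ruleZ a p : Q p -> Q (a *: p).
Proof.
by rewrite /Q => hp; rewrite -scalerAr !DZ hp -scalerAr scalerDr !scalerA mulrC.
Qed.

End GeneratorRule.

Section Polynomials.
Variable K : fieldType.
Local Notation fock := (ipoly K).
Local Notation x n := (pgen K n).

Lemma monom_ind (P : {cmonom nat} -> Prop) : P mone ->
  (forall i m, P m -> P (mmul (ucm i) m)) -> forall m, P m.
Proof.
move=> P1 PM m; have [n] := ubnP (mdeg m); elim: n m => // n IH m hm.
case: (eqVneq m mone) => [->//|m1].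
have [i hi] : exists i, m i != 0%N.
  apply: contrapT => h; move/eqP: m1; apply; apply/eqP/cmP => i; rewrite cm1.
  by apply/eqP; apply: contrapT => /negP hi; apply: h; exists i.
have -> : m = mmul (ucm i) (divcm m (ucm i)).
  apply/eqP/cmP => j; rewrite cmM divcmE cmU; case: eqP => [<-|_] /=.
    by rewrite add1n subn1 prednK // lt0n.
  by rewrite add0n subn0.
apply: PM; apply: IH; move: hm.
have {1}-> : m = mmul (ucm i) (divcm m (ucm i)).
  apply/eqP/cmP => j; rewrite cmM divcmE cmU; case: eqP => [<-|_] /=.
    by rewrite add1n subn1 prednK // lt0n.
  by rewrite add0n subn0.
by rewrite mdegM mdegU.
Qed.

Lemma monomialM (m m' : {cmonom nat}) :
  << m >> * << m' >> = << mmul m m' >> :> fock.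
Proof. by rewrite malgM_def fgmulUU mulr1. Qed.

Let mcoeff_monomial (m k : {cmonom nat}) : (<< m >> : fock)@_k = (m == k)%:R.
Proof. exact (mcoeffU1 K m k). Qed.

Lemma monomialZ a (m : {cmonom nat}) : << a *g m >> = a *: << m >> :> fock.
Proof.
apply/malgP => k; rewrite [RHS]mcoeffZ [X in _ * X]mcoeff_monomial.
rewrite [LHS]mcoeffU; case: (m == k).
  by rewrite mulr1n mulr1.
by rewrite mulr0n mulr0.
Qed.

(** Linear statements about polynomials need only be checked on 1 and be stable
    under multiplication by a generator. *)
Lemma ipoly_ind (P : fock -> Prop) : P 1 ->
  (forall a p q, P p -> P q -> P (a *: p + q)) ->
  (forall n p, P p -> P (x n.+1 * p)) -> forall p, P p.
Proof.
move=> P1 Plin Pgen p.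
have P0 : P 0 by have := Plin (-1) _ _ P1 P1; rewrite scaleN1r addNr.
have Pm m : P << m >>.
  elim/monom_ind: m => [//|i m hm].
  by rewrite -monomialM; exact: Pgen.
rewrite (monalgE p); apply: (big_ind P); [exact: P0|move=> q r hq hr|move=> m _].
  by rewrite -[q]scale1r; apply: (Plin _ _ _ hq hr).
by rewrite monomialZ -[_ *: _]addr0; apply: (Plin _ _ _ (Pm m) P0).
Qed.

(** The coefficients of the derivative show that it is additive, which its
    definition as a sum over the support hides. *)
Lemma mcoeff_pderiv n (P : fock) (k : {cmonom nat}) :
  mcoeff k (pderiv n P) = mcoeff (mmul k (ucm n.-1)) P * (k n.-1).+1%:R.
Proof.
rewrite /pderiv raddf_sum /=.
have hk : divcm (mmul k (ucm n.-1)) (ucm n.-1) = k.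
  by apply/eqP/cmP => j; rewrite divcmE cmM cmU addnK.
have hm (m : {cmonom nat}) : m n.-1 != 0%N -> divcm m (ucm n.-1) = k ->
    m = (mmul k (ucm n.-1)).
  move=> mn <-; apply/eqP/cmP => j; rewrite cmM divcmE cmU; case: eqP => [<-|_] /=.
    by rewrite subn1 addn1 prednK // lt0n.
  by rewrite subn0 addn0.
under eq_bigr do rewrite mcoeffU.
case: (boolP ((mmul k (ucm n.-1)) \in msupp P)) => hs.
  rewrite (big_fsetD1 _ hs) /= hk eqxx mulr1n cmM cmUU addn1 big1_fset ?addr0 //.
  move=> m; rewrite in_fsetD1 => /andP[mk _] _.
  case: (eqVneq (m n.-1) 0%N) => [->|mn]; first by rewrite mulr0 mul0rn.
  by case: eqP => // /(hm _ mn) e; rewrite e eqxx in mk.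
rewrite (mcoeff_outdom hs) mul0r big1_fset // => m ms _.
case: (eqVneq (m n.-1) 0%N) => [->|mn]; first by rewrite mulr0 mul0rn.
by case: eqP => // /(hm _ mn) e; rewrite -e ms in hs.
Qed.

Lemma pderiv_linear n : linear (@pderiv K n).
Proof.
move=> a p q; apply/malgP => k.
have := mcoeff_pderiv n (a *: p + q) k.
have := mcoeff_pderiv n q k; have := mcoeff_pderiv n p k.
move: (pderiv n (a *: p + q)) (pderiv n p) (pderiv n q) => u w z ew ez eu.
apply: (etrans eu); apply/esym; apply: (etrans (mcoeffD k (a *: w) z)).
rewrite ez (mcoeffZ a w k) ew; move: (mmul _ _) => k'.
by rewrite (mcoeffD k' (a *: p) q) (mcoeffZ a p k') mulrDl mulrA.
Qed.

Lemma pderiv_monomial n m :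
  pderiv n (<< m >> : fock) = (m n.-1)%:R *: << divcm m (ucm n.-1) >>.
Proof.
rewrite /pderiv; have -> : msupp (<< m >> : fock) = [fset m]%fset.
  exact (@msuppU1 _ K m).
rewrite big_seq_fset1; have -> : (<< m >> : fock)@_m = 1 by exact (@mcoeffUU _ K m 1).
by rewrite mul1r monomialZ.
Qed.

Lemma pderiv1 n : pderiv n (1 : fock) = 0.
Proof. by rewrite -[1]/(<< mone >>) pderiv_monomial cm1 scale0r. Qed.

Lemma pderivD n (p q : fock) : pderiv n (p + q) = pderiv n p + pderiv n q.
Proof. exact: linear_morphD (pderiv_linear n) p q. Qed.

Lemma pderivZ n a (p : fock) : pderiv n (a *: p) = a *: pderiv n p.
Proof. exact: linear_scalable (pderiv_linear n) a p. Qed.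

Let pderiv_gen_monomial n j (m : {cmonom nat}) :
  pderiv n.+1 (x j.+1 * << m >>) =
  (n == j)%:R *: << m >> + x j.+1 * pderiv n.+1 << m >>.
Proof.
apply: (etrans (congr1 (pderiv n.+1) (monomialM (ucm j) m))).
apply: (etrans (pderiv_monomial n.+1 (mmul (ucm j) m))).
rewrite (pderiv_monomial n.+1 m) cmM cmU -scalerAr.
have -> : x j.+1 * << divcm m (ucm n.+1.-1) >> = << mmul (ucm j) (divcm m (ucm n)) >>.
  exact: (monomialM (ucm j) (divcm m (ucm n))).
rewrite -[n.+1.-1]/n.
case: (eqVneq n j) => [->|nj].
  rewrite scale1r.
  have -> : divcm (mmul (ucm j) m) (ucm j) = m.
    by apply/eqP/cmP => i; rewrite divcmE cmM cmU addKn.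
  have divK : m j != 0%N -> mmul (ucm j) (divcm m (ucm j)) = m.
    move=> mj; apply/eqP/cmP => i; rewrite cmM divcmE cmU.
    by case: eqP => [<-|_]; rewrite /= ?subn0 // add1n subn1 prednK // lt0n.
  have -> : (m j)%:R *: << mmul (ucm j) (divcm m (ucm j)) >> = (m j)%:R *: << m >> :> fock.
    case: (eqVneq (m j) 0%N) => [->|/divK ->]; last by [].
    by apply: (etrans (scale0r _)); apply/esym; apply: scale0r.
  move: << m >> => q; rewrite add1n -natr1.
  by apply: (etrans (scalerDl _ _ _)); rewrite scale1r addrC.
apply: (etrans _ (esym (etrans (congr1 (+%R^~ _) (scale0r _)) (add0r _)))).
rewrite add0n.
case: (eqVneq (m n) 0%N) => [->|mn].
  by apply: (etrans (scale0r _)); apply/esym; apply: scale0r.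
have -> : divcm (mmul (ucm j) m) (ucm n) = mmul (ucm j) (divcm m (ucm n)); last by [].
apply/eqP/cmP => i; rewrite !(cmM, divcmE, cmU).
case: (eqVneq n i) => [<-|_]; last by rewrite !subn0.
by rewrite eq_sym (negbTE nj) !add0n.
Qed.

Lemma pderiv_genM n j (P : fock) : (0 < n)%N -> (0 < j)%N ->
  pderiv n (x j * P) = (n == j)%:R *: P + x j * pderiv n P.
Proof.
case: n j => // n [//|j] _ _; rewrite eqSS.
pose Q p := pderiv n.+1 (x j.+1 * p) = (n == j)%:R *: p + x j.+1 * pderiv n.+1 p.
suff: Q P by []; rewrite (monalgE P); apply: (big_ind Q) => [|p q hp hq|m _].
- exact: (generator_rule0 _ _ (pderivD n.+1)).
- exact: (generator_ruleD (pderivD n.+1) hp hq).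
have -> : << P@_m *g m >> = P@_m *: << m >> by exact: monomialZ.
exact: (generator_ruleZ (pderivZ n.+1) _ (pderiv_gen_monomial n j m)).
Qed.

End Polynomials.

(** * Exponentials of operator series *)

Section ExpCoef.
Variable K : numFieldType.
Variable V : lmodType K.
Variable X : nat -> V -> V.
Hypothesis Xlin : forall n, linear (X n).
Hypothesis XC : forall n m P, (0 < n)%N -> (0 < m)%N -> X n (X m P) = X m (X n P).

(** The coefficients of (\sum_(n >= 1) X_n z^n)^j and, below, of
    exp (\sum_(n >= 1) X_n z^n), for operators on an arbitrary module. *)
Fixpoint series_pow (j k : nat) (P : V) : V :=
  if j is j'.+1 then \sum_(1 <= n < k.+1) X n (series_pow j' (k - n) P)
  else if k == 0%N then P else 0.

Definition series_exp (k : nat) (P : V) : V :=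
  \sum_(0 <= j < k.+1) (j`!%:R)^-1 *: series_pow j k P.

Definition extendz (F : nat -> V -> V) (k : int) (P : V) : V :=
  if k is Posz k' then F k' P else 0.

Implicit Types (k n : int) (P : V).

Definition positive_part n P : V := if n is Posz n'.+1 then X n'.+1 P else 0.
Local Notation xz := positive_part.
Let powz j := extendz (series_pow j).

Let xzD n : {morph xz n : p q / p + q}.
Proof. by case: n => [[|n]|n] p q; rewrite /positive_part ?addr0 // linear_morphD. Qed.

Let xz0 n : xz n 0 = 0. Proof. exact: morphD0 (xzD n). Qed.

Let xzZ n a P : xz n (a *: P) = a *: xz n P.
Proof. by case: n => [[|n]|n]; rewrite /positive_part ?scaler0 // linear_scalable. Qed.

Let xzC n m P : xz n (xz m P) = xz m (xz n P).
Proof.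
have X0 i : X i 0 = 0 by exact/morphD0/linear_morphD.
by case: n m => [[|n]|n] [[|m]|m]; rewrite /positive_part ?X0 // XC.
Qed.

Let xz_nonpos n P : n < 1 -> xz n P = 0.
Proof. by case: n => [[|n]|n] //; lia. Qed.

Let powz_neg j k P : k < 0 -> powz j k P = 0.
Proof. by case: k => // k; lia. Qed.

Let powz_bounded j k P (f : int -> K) : bounded (fun n => f n *: xz n (powz j (k - n) P)).
Proof.
apply: bounded_scale; apply: (@bounded_between _ 1 k) => n hn.
  exact: xz_nonpos.
by rewrite powz_neg ?xz0 //; lia.
Qed.

Let powz_bounded1 j k P : bounded (fun n => xz n (powz j (k - n) P)).
Proof.
have := powz_bounded j k P (fun=> 1).
by congr bounded; apply: funext => n; rewrite scale1r.
Qed.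

Let powzS j k P : powz j.+1 k P = zsum (fun n => xz n (powz j (k - n) P)).
Proof.
case: k => k; last first.
  apply/esym/zsum0 => n; case: (ltP n 1) => hn; first exact: xz_nonpos.
  by rewrite powz_neg ?xz0 //; lia.
rewrite (@zsum_nat _ k) => [|n hn]; last first.
  case: (ltP n 1) => hn'; first exact: xz_nonpos.
  by rewrite powz_neg ?xz0 //; lia.
rewrite /powz /=; apply: eq_big_nat => n hn.
case: n hn => [|n] hn; first by lia.
by rewrite (_ : k%:Z - n.+1%:Z = (k - n.+1)%N) //; lia.
Qed.

Let powz0 k P : powz 0 k P = if k == 0 then P else 0.
Proof. by case: k. Qed.

(* z d/dz X(z)^(j + 1) = (j + 1) (z X'(z)) X(z)^j, since the X_n commute. *)
Let powz_rec j k P : k%:~R *: powz j.+1 k P =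
  j.+1%:R *: zsum (fun n => n%:~R *: xz n (powz j (k - n) P)).
Proof.
elim: j k => [|j IH] k.
  rewrite powzS zsumZ ?scale1r //; apply: eq_zsum => n; rewrite powz0.
  by case: eqP => [/eqP|_]; rewrite ?xz0 ?scaler0 // subr_eq0 => /eqP ->.
have b2 : bounded2 (fun n m => xz n (m%:~R *: xz m (powz j (k - n - m) P))).
  exists `|k| => n m hnm; case: (ltP n 1) => n1; first exact: xz_nonpos.
  case: (ltP m 1) => m1; first by rewrite (xz_nonpos _ m1) scaler0 xz0.
  by rewrite powz_neg ?xz0 ?scaler0 ?xz0 //; lia.
have bI n : bounded (fun m => m%:~R *: xz m (powz j (k - n - m) P)).
  exact: powz_bounded.
rewrite powzS zsumZ //.
transitivity (zsum (fun n => n%:~R *: xz n (powz j.+1 (k - n) P)) +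
              zsum (fun n => xz n ((k - n)%:~R *: powz j.+1 (k - n) P))).
  rewrite -zsumD //.
    apply: eq_zsum => n; rewrite xzZ -scalerDl; congr (_ *: _).
    by rewrite intrB addrC subrK.
  have := powz_bounded j.+1 k P (fun n => (k - n)%:~R).
  by congr bounded; apply: funext => n; rewrite xzZ.
rewrite (_ : zsum (fun n => xz n _) =
  j.+1%:R *: zsum (fun n => n%:~R *: xz n (powz j.+1 (k - n) P))).
  by rewrite -{1}[zsum _]scale1r -scalerDl nat1r.
transitivity (j.+1%:R *: zsum (fun n => zsum (fun m =>
    xz n (m%:~R *: xz m (powz j (k - n - m) P))))).
  rewrite zsumZ; last first.
    case: b2 => B hB; exists B => n hn; apply: zsum0 => m; apply: hB; by left.
  apply: eq_zsum => n; rewrite IH xzZ; congr (_ *: _).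
  by rewrite (zsum_morph (xzD n)).
rewrite zsum_exchange //; congr (_ *: _); apply: eq_zsum => m.
rewrite powzS (zsum_morph (xzD m)) // zsumZ; last first.
  by apply: bounded_morph => //; exact: xzD.
apply: eq_zsum => n; rewrite xzZ xzC.
by rewrite (_ : k - n - m = k - m - n) //; ring.
Qed.

Let powz_gt j k P : k < j%:Z -> powz j k P = 0.
Proof.
elim: j k => [|j IH] k hk; first exact: powz_neg.
rewrite powzS; apply: zsum0 => n; case: (ltP n 1) => hn; first exact: xz_nonpos.
by rewrite IH ?xz0 //; lia.
Qed.

Definition expz := extendz series_exp.

Let expzE J k P : k < J%:Z ->
  expz k P = \sum_(0 <= j < J) (j`!%:R)^-1 *: powz j k P.
Proof.
case: k => k hk; last first.
  by rewrite /expz /= big1 // => j _; rewrite scaler0.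
have kJ : (k.+1 <= J)%N by lia.
rewrite /expz /= /series_exp [RHS](big_cat_nat (leq0n _) kJ) /=.
rewrite [X in _ + X]big_nat_cond [X in _ + X]big1 ?addr0 // => j hj.
by rewrite [series_pow _ _ _](powz_gt (k := k)) ?scaler0 //; lia.
Qed.

Lemma expz_neg k P : k < 0 -> expz k P = 0.
Proof. by case: k => // k; lia. Qed.

Lemma expz0 P : expz 0 P = P.
Proof. by rewrite (@expzE 1) // big_nat1 fact0 invr1 scale1r powz0 eqxx. Qed.

(** The equation z d/dz exp X(z) = (z X'(z)) exp X(z). It determines the exponential
    by series_unique, so identities between exponentials are proved by comparing
    their logarithmic derivatives. *)
Lemma expz_rec k P : k%:~R *: expz k P =
  zsum (fun n => n%:~R *: xz n (expz (k - n) P)).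
Proof.
pose J := (absz k).+1.
have hJ : k < J%:Z by lia.
rewrite (@expzE J.+1); last by lia.
rewrite big_nat_recl //= scalerDr scaler_sumr.
rewrite [X in X + _](_ : _ = 0) ?add0r; last first.
  by rewrite powz0; case: eqP => [->|_]; rewrite ?scale0r ?scaler0.
transitivity (\sum_(0 <= j < J) (j`!%:R)^-1 *:
     zsum (fun n => n%:~R *: xz n (powz j (k - n) P))).
  apply: eq_bigr => j _; rewrite scalerA mulrC -scalerA powz_rec scalerA.
  congr (_ *: _); rewrite factS natrM invfM mulrAC mulVf ?mul1r //.
  by rewrite pnatr_eq0.
rewrite -[RHS](eq_zsum (F := fun n => \sum_(0 <= j < J) (j`!%:R)^-1 *:
   (n%:~R *: xz n (powz j (k - n) P)))).
  rewrite zsum_sum => [|j]; last exact/boundedZ/powz_bounded.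
  by apply: eq_bigr => j _; rewrite zsumZ.
move=> n; case: (ltP n 1) => hn.
  by rewrite xz_nonpos // scaler0 big1 // => j _; rewrite xz_nonpos // !scaler0.
rewrite (@expzE J); last lia.
rewrite (big_morph _ (xzD n) (xz0 n)) scaler_sumr.
by apply: eq_bigr => j _; rewrite xzZ !scalerA mulrC.
Qed.

End ExpCoef.

Lemma int_strong_ind (Q : int -> Prop) : (forall k, k < 0 -> Q k) ->
  (forall k, 0 <= k -> (forall n, 0 < n -> Q (k - n)) -> Q k) -> forall k, Q k.
Proof.
move=> Qneg Qstep; suff H (N : nat) : forall k, k < N%:Z -> Q k.
  by move=> k; apply: (H (absz k).+1); lia.
elim: N => [|N IH] k hk; first exact: Qneg.
case: (ltP k 0) => k0; first exact: Qneg.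
by apply: Qstep => // n n0; apply: IH; lia.
Qed.

Lemma series_unique (K : numFieldType) (V : lmodType K) (T : int -> V -> V)
    (f g : int -> V) :
  (forall n y, n < 1 -> T n y = 0) ->
  (forall k, k < 0 -> f k = 0) -> (forall k, k < 0 -> g k = 0) -> f 0 = g 0 ->
  (forall k, k%:~R *: f k = zsum (fun n => T n (f (k - n)))) ->
  (forall k, k%:~R *: g k = zsum (fun n => T n (g (k - n)))) ->
  forall k, f k = g k.
Proof.
move=> T0 f0 g0 fg0 hf hg; elim/int_strong_ind => [k hk|k hk IH].
  by rewrite f0 ?g0.
case: (eqVneq k 0) => [->//|k0].
suff /eqP : k%:~R *: (f k - g k) = 0.
  by rewrite scaler_eq0 intr_eq0 (negbTE k0) subr_eq0 => /eqP.
rewrite scalerBr hf hg; apply/eqP; rewrite subr_eq0; apply/eqP/eq_zsum => n.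
by case: (ltP n 1) => hn; [rewrite !T0|rewrite IH //; lia].
Qed.

(** The same equation for (1 - x)^s = exp (- s \sum_(n >= 1) x^n / n). *)
Lemma binom_coef_sum (K : numFieldType) (s : K) (l : int) :
  l%:~R * binom_coef s l =
  - s * zsum (fun n : int => if n < 1 then 0 else binom_coef s (l - n)).
Proof.
pose S (k : int) := zsum (fun n : int => if n < 1 then 0 else binom_coef s (k - n)).
have hb k : bounded (fun n : int => if n < 1 then 0 else binom_coef s (k - n)).
  apply: (@bounded_between _ 1 k) => n hn; first by rewrite hn.
  by rewrite binom_coef_neg ?if_same //; lia.
have S_neg k : k < 0 -> S k = 0.
  move=> hk; apply: zsum0 => n; case: ltP => // hn.
  by rewrite binom_coef_neg //; lia.
have S_rec k : S k = S (k - 1) + binom_coef s (k - 1).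
  rewrite /S -(zsum_shift 1).
  transitivity (zsum (fun n : int => (if n < 1 then 0 else binom_coef s (k - 1 - n))
      + (if n == 0 then binom_coef s (k - 1) else 0))).
    apply: eq_zsum => n /=; case: (eqVneq n 0) => [->|n0].
      by rewrite /= ?add0r /= ?add0r; congr binom_coef; ring.
    rewrite addr0; have -> : (n + 1 < 1) = (n < 1) by apply/idP/idP; lia.
    by case: ifP => // _; congr binom_coef; lia.
  rewrite zsumD //; last first.
    by apply: (@bounded_between _ 0 0) => n hn; case: eqP => // n0; lia.
  congr (_ + _); rewrite (zsum_single (c := 0)) ?eqxx // => n n0.
  by rewrite (negbTE n0).
rewrite -/(S l); elim/int_strong_ind: l => [k hk|k hk IH].
  by rewrite binom_coef_neg // S_neg // !mulr0.
rewrite S_rec mulrDr -IH // binom_coef_rec; ring.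
Qed.

(** * Creation and annihilation exponentials *)

Section VertexOperators.
Variables (K : numFieldType) (F : comAlgType K).
Variables (x : nat -> F) (D : nat -> F -> F).
Hypothesis D_linear : forall n, linear (D n).
Hypothesis D1 : forall n, D n.+1 1 = 0.
Hypothesis D_gen : forall n j P,
  D n.+1 (x j.+1 * P) = (n == j)%:R *: P + x j.+1 * D n.+1 P.
Hypothesis F_ind : forall Q : F -> Prop, Q 1 ->
  (forall a p q, Q p -> Q q -> Q (a *: p + q)) ->
  (forall n p, Q p -> Q (x n.+1 * p)) -> forall p, Q p.

Let DD n := linear_morphD (D_linear n).
Let DZ n := linear_scalable (D_linear n).
Let D0 n : D n 0 = 0. Proof. exact: morphD0 (DD n). Qed.

Lemma derivation_comm n m P : D n.+1 (D m.+1 P) = D m.+1 (D n.+1 P).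
Proof.
elim/F_ind: P => [|a p q hp hq|j p hp].
- by rewrite !D1 !D0.
- by rewrite !D_linear hp hq.
- by rewrite !D_gen !DD !DZ !D_gen hp addrCA.
Qed.

Definition creation_term (al : K) (n : nat) (P : F) := (al / n%:R) *: (x n * P).
Definition annihilation_term (al : K) (n : nat) (P : F) := - al *: D n P.

Let cre_linear al n : linear (creation_term al n).
Proof.
move=> a p q; rewrite /creation_term mulrDr scalerDr -scalerAr !scalerA.
by rewrite [a * _]mulrC.
Qed.

Let ann_linear al n : linear (annihilation_term al n).
Proof.
by move=> a p q; rewrite /annihilation_term D_linear scalerDr !scalerA mulrC.
Qed.

Let creC al n m P : (0 < n)%N -> (0 < m)%N ->
  creation_term al n (creation_term al m P) = creation_term al m (creation_term al n P).
Proof.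
move=> _ _; rewrite /creation_term -!scalerAr !scalerA.
by congr (_ *: _); [exact: mulrC|exact: mulrCA].
Qed.

Let annC al n m P : (0 < n)%N -> (0 < m)%N ->
  annihilation_term al n (annihilation_term al m P) =
  annihilation_term al m (annihilation_term al n P).
Proof.
case: n m => [//|n] [//|m] _ _.
by rewrite /annihilation_term !DZ derivation_comm.
Qed.

(** With x_n for h_(- n), the coefficient of z^k in exp (al \sum_(n >= 1) x_n z^n / n)
    and, next, of z^(- k) in exp (- al \sum_(n >= 1) D_n z^(- n)), where n D_n is h_n.
    Of the polynomial ring only the rule for D_n on generators and the induction
    principle are used. *)
Definition cre al (k : int) : F := expz (creation_term al) k 1.
Definition ann al (k : int) (P : F) : F := expz (annihilation_term al) k P.

Let xp (n : int) : F := if n is Posz n'.+1 then x n'.+1 else 0.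
Let Dp (n : int) (P : F) : F := positive_part D n P.

Let xp_nonpos n : n < 1 -> xp n = 0.
Proof. by case: n => [[|n]|n] //; lia. Qed.

Let Dp_nonpos n P : n < 1 -> Dp n P = 0.
Proof. by case: n => [[|n]|n] //; lia. Qed.

Let Dp_linear n : linear (Dp n).
Proof.
case: n => [[|n]|n] a p q; rewrite /Dp /positive_part ?scaler0 ?addr0 //.
exact: D_linear.
Qed.

Lemma cre_neg al k : k < 0 -> cre al k = 0. Proof. exact: expz_neg. Qed.
Lemma cre0 al : cre al 0 = 1. Proof. exact: expz0. Qed.
Lemma ann_neg al k P : k < 0 -> ann al k P = 0. Proof. exact: expz_neg. Qed.
Lemma ann0 al P : ann al 0 P = P. Proof. exact: expz0. Qed.

Lemma creation_exp al k P : expz (creation_term al) k P = cre al k * P.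
Proof.
pose T (n : int) (p : F) := n%:~R *: positive_part (creation_term al) n p.
apply: (series_unique (T := T) (f := fun k => expz (creation_term al) k P)
  (g := fun k => cre al k * P)).
- by case=> [[|n]|n] p; rewrite /T ?scaler0 //; lia.
- by move=> j hj; rewrite expz_neg.
- by move=> j hj; rewrite cre_neg ?mul0r.
- by rewrite expz0 // cre0 mul1r.
- by move=> j; apply: expz_rec; [exact: cre_linear|exact: creC].
move=> j; rewrite scalerAl /cre (expz_rec (cre_linear al) (@creC al)).
rewrite (zsum_morph (f := fun p => p * P)) => [||]; first last.
- apply: (@bounded_between _ 1 j) => n hn.
    by case: n hn => [[|n]|n] // hn; rewrite ?scaler0 //; lia.
  rewrite expz_neg; last by lia.
  by case: n hn => [[|n]|n] hn; rewrite /positive_part ?scaler0 // /creation_term mulr0 !scaler0.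
- by move=> p q; rewrite mulrDl.
apply: eq_zsum => n; rewrite /T -scalerAl; congr (_ *: _).
case: n => [[|n]|n]; rewrite /positive_part ?mul0r //.
by rewrite /creation_term -scalerAl mulrA.
Qed.

Let cre_bounded al k (f : int -> K) :
  bounded (fun n => f n *: (xp n * cre al (k - n))).
Proof.
apply/bounded_scale/(@bounded_between _ 1 k) => n hn.
  by rewrite xp_nonpos ?mul0r.
by rewrite cre_neg ?mulr0 //; lia.
Qed.

Lemma cre_rec al k : k%:~R *: cre al k = zsum (fun n => al *: (xp n * cre al (k - n))).
Proof.
rewrite /cre (expz_rec (cre_linear al) (@creC al)); apply: eq_zsum => n.
case: n => [[|n]|n]; rewrite /positive_part /xp ?mul0r ?scaler0 //.
by rewrite /creation_term scalerA mulrCA mulfV ?mulr1 // intr_eq0.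
Qed.

Lemma ann_linear_op al k : linear (ann al k).
Proof.
move=> a p q.
pose T (n : int) (p : F) := n%:~R *: positive_part (annihilation_term al) n p.
have T_lin n : linear (T n).
  move=> b u w; rewrite /T; case: n => [[|n]|n]; rewrite /positive_part ?scaler0 ?addr0 //.
  rewrite ann_linear scalerDr; congr (_ + _).
  by rewrite scalerA mulrC -scalerA.
have T_nonpos n y : n < 1 -> T n y = 0.
  by case: n => [[|n]|n]; rewrite /T ?scaler0 //; lia.
have T_bounded j (f : int -> F) : (forall i, i < 0 -> f i = 0) ->
    bounded (fun n => T n (f (j - n))).
  move=> hf; apply: (@bounded_between _ 1 j) => n hn; first exact: T_nonpos.
  by rewrite hf; [exact/morphD0/linear_morphD|lia].
apply: (series_unique (T := T) (f := fun k => ann al k (a *: p + q))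
  (g := fun k => a *: ann al k p + ann al k q)) => //.
- by move=> j hj; rewrite ann_neg.
- by move=> j hj; rewrite !ann_neg // scaler0 addr0.
- by rewrite !ann0.
- by move=> j; apply: expz_rec; [exact: ann_linear|exact: annC].
move=> j; rewrite scalerDr scalerA mulrC -scalerA /ann !(expz_rec (ann_linear al) (@annC al)).
have b u : bounded (fun n => T n (ann al (j - n) u)).
  by apply: (T_bounded j (fun i => ann al i u)) => i hi; rewrite ann_neg.
have := zsumD (boundedZ a (b p)) (b q); rewrite -(zsumZ a (b p)) => <-.
by apply: eq_zsum => n; rewrite T_lin.
Qed.

Let annD al k := linear_morphD (ann_linear_op al k).
Let annZ al k := linear_scalable (ann_linear_op al k).

Lemma ann_rec al k P :
  k%:~R *: ann al k P = zsum (fun n => (- al * n%:~R) *: Dp n (ann al (k - n) P)).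
Proof.
rewrite /ann (expz_rec (ann_linear al) (@annC al)); apply: eq_zsum => n.
case: n => [[|n]|n]; rewrite /positive_part /Dp ?scaler0 //.
by rewrite /annihilation_term scalerA mulrC.
Qed.

(** The exponential of a derivation is a morphism of algebras, here the
    substitution x_n |-> x_n - al z^(- n). *)
Lemma ann_gen al k j P :
  ann al k (x j.+1 * P) = x j.+1 * ann al k P - al *: ann al (k - j.+1%:Z) P.
Proof.
pose T (n : int) (p : F) := (- al * n%:~R) *: Dp n p.
have T_bounded (k' : int) (f : int -> F) : (forall i, i < 0 -> f i = 0) ->
    bounded (fun n => T n (f (k' - n))).
  move=> hf; apply: (@bounded_between _ 1 k') => n hn; first by rewrite /T Dp_nonpos ?scaler0.
  by rewrite hf /T ?(morphD0 (linear_morphD (Dp_linear n))) ?scaler0 //; lia.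
apply: (series_unique (T := T) (f := fun k => ann al k (x j.+1 * P))
   (g := fun k => x j.+1 * ann al k P - al *: ann al (k - j.+1%:Z) P)).
- by move=> n y hn; rewrite /T Dp_nonpos ?scaler0.
- by move=> i hi; rewrite ann_neg.
- by move=> i hi; rewrite !ann_neg ?scaler0 ?mulr0 ?subr0 //; lia.
- by rewrite !ann0 ann_neg ?scaler0 ?subr0.
- by move=> i; rewrite ann_rec.
move=> i; apply/esym.
transitivity (zsum (fun n => x j.+1 * T n (ann al (i - n) P)) +
  (zsum (fun n => - al *: T n (ann al (i - j.+1%:Z - n) P)) +
   zsum (fun n => if n == j.+1%:Z then (- al * n%:~R) *: ann al (i - n) P else 0))).
  have bT k' : bounded (fun n => T n (ann al (k' - n) P)).
    by apply: (T_bounded k' (fun i => ann al i P)) => n hn; rewrite ann_neg.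
  have b3 : bounded (fun n => if n == j.+1%:Z then (- al * n%:~R) *: ann al (i - n) P else 0).
    by apply: (@bounded_between _ j.+1%:Z j.+1%:Z) => n hn; case: eqP => // e; lia.
  rewrite -zsumD //; last exact/boundedZ.
  rewrite -zsumD; [|by apply: bounded_morph => // p q; rewrite mulrDr
    |by apply: boundedD => //; exact: boundedZ].
  apply: eq_zsum => n; rewrite /T (_ : i - n - j.+1%:Z = i - j.+1%:Z - n); last by ring.
  case: n => [[|n]|n]; rewrite /Dp /positive_part ?scaler0 ?mulr0 ?addr0 //.
  rewrite -scaleNr DD !DZ D_gen !scalerDr -scalerAr !scalerA.
  rewrite eqz_nat eqSS [X in X + _ = _]addrC -addrA; congr (_ + _).
  rewrite addrC; congr (_ *: _ + _); first by ring.
  by case: eqP => _ /=; rewrite ?mulr1 ?mulr0 ?scale0r.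
rewrite -(zsum_morph (f := fun p => x j.+1 * p)); first last.
- by apply: (T_bounded i (fun i => ann al i P)) => n hn; rewrite ann_neg.
- by move=> p q; rewrite mulrDr.
rewrite -zsumZ; last by apply: (T_bounded _ (fun i => ann al i P)) => n hn; rewrite ann_neg.
rewrite -!ann_rec (zsum_single (c := j.+1%:Z)) ?eqxx => [|n /negbTE -> //].
rewrite -scalerAr scalerBr; congr (_ + _).
rewrite !scalerA -scalerDl -scaleNr; congr (_ *: _).
by rewrite intrB; ring.
Qed.

Lemma ann1 al k : ann al k 1 = if k == 0 then 1 else 0.
Proof.
case: eqP => [->|/eqP k0]; first exact: ann0.
suff /eqP : k%:~R *: ann al k 1 = 0 by rewrite scaler_eq0 intr_eq0 (negbTE k0) => /eqP.
elim/int_strong_ind: k k0 => [k hk|k hk IH] k0; first by rewrite ann_neg ?scaler0.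
rewrite ann_rec; apply: zsum0 => n; case: (ltP n 1) => hn.
  by rewrite Dp_nonpos ?scaler0.
have Dp0 : Dp n 0 = 0 := morphD0 (linear_morphD (Dp_linear n)).
case: (eqVneq (k - n) 0) => [->|kn].
  rewrite ann0; case: n hn {Dp0} => [[|n]|n] hn //=.
  by rewrite /Dp /= D1 scaler0.
have /eqP := IH n hn kn; rewrite scaler_eq0 intr_eq0 (negbTE kn) /= => /eqP ->.
by rewrite Dp0 scaler0.
Qed.

Lemma ann_truncated al P : exists B : int, forall k, B < k -> ann al k P = 0.
Proof.
elim/F_ind: P => [|a p q [B hB] [B' hB']|n p [B hB]].
- by exists 0 => k hk; rewrite ann1; case: eqP => // e; lia.
- by exists (`|B| + `|B'|) => k hk; rewrite ann_linear_op hB ?hB' ?scaler0 ?addr0 //; lia.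
- by exists (B + n.+1%:Z) => k hk; rewrite ann_gen !hB ?mulr0 ?scaler0 ?subr0 //; lia.
Qed.

Lemma ann_comm al be i j P : ann al i (ann be j P) = ann be j (ann al i P).
Proof.
elim/F_ind: P i j => [|a p q hp hq|n p hp] i j.
- have h0 ga k : ann ga k 0 = 0 := morphD0 (annD ga k).
  have e ga k (b : bool) : ann ga k (if b then 1 else 0) = if b then ann ga k 1 else 0.
    by case: b; rewrite ?h0.
  by rewrite !ann1 !e !ann1; case: (i == 0); case: (j == 0).
- by rewrite !ann_linear_op hp hq.
- have annB ga k u w : ann ga k (u - w) = ann ga k u - ann ga k w.
    by rewrite -scaleN1r annD annZ scaleN1r.
  rewrite !ann_gen !annB !annZ !ann_gen !hp.
  by rewrite addrAC.
Qed.

Let annxp al i n P : ann al i (xp n * P) =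
  xp n * ann al i P - (if n < 1 then 0 else al *: ann al (i - n) P).
Proof.
case: n => [[|n]|n] /=; last by rewrite !mul0r subr0 (morphD0 (annD al i)).
  by rewrite !mul0r subr0 (morphD0 (annD al i)).
by rewrite ann_gen.
Qed.

(** The substitution x_n |-> x_n - al z^(- n) multiplies exp (be \sum_n x_n w^n / n)
    by exp (- al be \sum_n (w / z)^n / n) = (1 - w / z)^(al be). The proof is an
    induction on j through the logarithmic derivative in w. *)
Lemma ann_cre al be i j P : ann al i (cre be j * P) =
  zsum (fun l => binom_coef (al * be) l *: (cre be (j - l) * ann al (i - l) P)).
Proof.
pose b := binom_coef (al * be).
have b_neg l : l < 0 -> b l = 0 by exact: binom_coef_neg.
pose G (j i : int) := zsum (fun l => b l *: (cre be (j - l) * ann al (i - l) P)).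
rewrite -/b -/(G j i).
have G_bounded (f : int -> K) lo j' i' : (forall l, l < lo -> f l = 0) ->
    bounded (fun l => f l *: (cre be (j' - l) * ann al (i' - l) P)).
  move=> hf; apply: (bounded_halves hf (hi := j')) => l hl.
  by rewrite cre_neg ?mul0r //; lia.
have G_neg j' i' : j' < 0 -> G j' i' = 0.
  move=> hj; apply: zsum0 => l; case: (ltP l 0) => hl; first by rewrite b_neg ?scale0r.
  by rewrite cre_neg ?mul0r ?scaler0 //; lia.
elim/int_strong_ind: j i => [j hj|j hj IH] i.
  by rewrite cre_neg // mul0r (morphD0 (annD al i)) G_neg.
case: (eqVneq j 0) => [->|j0].
  rewrite cre0 mul1r /G (zsum_single (c := 0)) => [|l l0].
    by rewrite /b binom_coef0 scale1r !subr0 cre0 mul1r.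
  case: (ltP l 0) => hl; first by rewrite b_neg ?scale0r.
  by rewrite cre_neg ?mul0r ?scaler0 //; lia.
suff /eqP : j%:~R *: (ann al i (cre be j * P) - G j i) = 0.
  by rewrite scaler_eq0 intr_eq0 (negbTE j0) subr_eq0 => /eqP.
apply/eqP; rewrite scalerBr subr_eq0 -annZ scalerAl cre_rec; apply/eqP.
rewrite (zsum_morph (f := fun p => p * P)) => [||]; first last.
- exact: (cre_bounded be j (fun=> be)).
- by move=> p q; rewrite mulrDl.
rewrite (zsum_morph (annD al i)); last first.
  apply: (bounded_morph (f := fun p => p * P)); first by move=> p q; rewrite mulrDl.
  exact: (cre_bounded be j (fun=> be)).
have bx : bounded (fun n => xp n * G (j - n) i).
  apply: (@bounded_between _ 1 j) => n hn; first by rewrite xp_nonpos ?mul0r.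
  by rewrite G_neg ?mulr0 //; lia.
have bG : bounded (fun n => if n < 1 then 0 else G (j - n) (i - n)).
  apply: (@bounded_between _ 1 j) => n hn; first by rewrite hn.
  by rewrite G_neg ?if_same //; lia.
(* The first sum is w d/dw of the creation part; the second one comes from the
   substitution and is the logarithmic derivative of the binomial series. *)
transitivity (be *: zsum (fun n => xp n * G (j - n) i)
  - (al * be) *: zsum (fun n => if n < 1 then 0 else G (j - n) (i - n))).
  rewrite zsumZ // -scaleNr zsumZ // -zsumD; [|exact: boundedZ|exact: boundedZ].
  apply: eq_zsum => n; rewrite -scalerAl annZ -mulrA annxp scalerBr.
  case: ltP => hn; first by rewrite xp_nonpos ?mul0r ?scaler0 ?subr0 // addr0.
  by rewrite !IH -?scalerAl ?scalerA ?[be * al]mulrC ?scaleNr //; lia.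
have e1 : be *: zsum (fun n => xp n * G (j - n) i) =
    zsum (fun l => (b l * (j - l)%:~R) *: (cre be (j - l) * ann al (i - l) P)).
  transitivity (be *: zsum (fun n => zsum (fun l =>
      b l *: (xp n * (cre be (j - l - n) * ann al (i - l) P))))).
    congr (_ *: _); apply: eq_zsum => n; rewrite /G.
    rewrite (zsum_morph (f := fun p => xp n * p)) => [||]; first last.
    - exact: (G_bounded _ 0).
    - by move=> p q; rewrite mulrDr.
    apply: eq_zsum => l; rewrite -scalerAr.
    by rewrite (_ : j - n - l = j - l - n) //; ring.
  rewrite zsum_exchange; last first.
    exists `|j| => n l hnl; case: (ltP n 1) => hn; first by rewrite xp_nonpos ?mul0r ?scaler0.
    case: (ltP l 0) => hl; first by rewrite b_neg ?scale0r.
    by rewrite cre_neg ?mul0r ?mulr0 ?scaler0 //; lia.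
  rewrite zsumZ; last first.
    apply: (@bounded_between _ 0 j) => l hl; apply: zsum0 => n.
      by rewrite b_neg ?scale0r.
    case: (ltP n 1) => hn; first by rewrite xp_nonpos ?mul0r ?scaler0.
    by rewrite cre_neg ?mul0r ?mulr0 ?scaler0 //; lia.
  apply: eq_zsum => l; rewrite -scalerA scalerAl cre_rec.
  rewrite (zsum_morph (f := fun p => p * ann al (i - l) P)) => [||]; first last.
  - exact: (cre_bounded be (j - l) (fun=> be)).
  - by move=> p q; rewrite mulrDl.
  have b1 : bounded (fun n => xp n * cre be (j - l - n) * ann al (i - l) P).
    apply: (bounded_morph (f := fun p => p * ann al (i - l) P)).
      by move=> p q; rewrite mulrDl.
    have := cre_bounded be (j - l) (fun=> 1).
    by congr bounded; apply: funext => n; rewrite scale1r.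
  under [in LHS]eq_zsum do rewrite mulrA.
  under [in RHS]eq_zsum do rewrite -scalerAl.
  by rewrite -zsumZ // -[in RHS]zsumZ // !scalerA mulrC.
have e2 : - (al * be) *: zsum (fun n => if n < 1 then 0 else G (j - n) (i - n)) =
    zsum (fun l => (l%:~R * b l) *: (cre be (j - l) * ann al (i - l) P)).
  transitivity (- (al * be) *: zsum (fun n => zsum (fun l =>
      (if n < 1 then 0 else b (l - n)) *: (cre be (j - l) * ann al (i - l) P)))).
    congr (_ *: _); apply: eq_zsum => n; case: ltP => hn.
      by apply/esym/zsum0 => l; rewrite scale0r.
    rewrite /G -[RHS](zsum_shift n); apply: eq_zsum => l; rewrite addrK.
    by congr (_ *: (cre _ _ * ann _ _ _)); ring.
  rewrite zsum_exchange; last first.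
    exists (`|j| + 1) => n l hnl; case: ltP => hn; first by rewrite scale0r.
    case: (ltP (l - n) 0) => hl; first by rewrite b_neg ?scale0r.
    by rewrite cre_neg ?mul0r ?scaler0 //; lia.
  have bb (l : int) : bounded (fun n : int => if n < 1 then 0 else b (l - n)).
    apply: (@bounded_between _ 1 l) => n hn; first by rewrite hn.
    by rewrite b_neg ?if_same //; lia.
  rewrite zsumZ; last first.
    apply: (@bounded_between _ 0 j) => l hl; apply: zsum0 => n; last first.
      by rewrite cre_neg ?mul0r ?scaler0 //; lia.
    by case: ltP => hn; rewrite ?scale0r // b_neg ?scale0r //; lia.
  apply: eq_zsum => l; rewrite binom_coef_sum -scalerA; congr (_ *: _).
  rewrite (zsum_morph (f := fun a => a *: (cre be (j - l) * ann al (i - l) P))) //.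
  by move=> u w; rewrite scalerDl.
rewrite e1 -scaleNr e2 -zsumDl; first last.
- by apply: (G_bounded _ 0) => l hl; rewrite b_neg ?mulr0.
- by apply: (G_bounded _ 0) => l hl; rewrite b_neg ?mul0r.
rewrite /G zsumZ; last exact: (G_bounded _ 0).
by apply: eq_zsum => l; rewrite scalerA; congr (_ *: _); rewrite intrB; ring.
Qed.

End VertexOperators.

(** * Finite differences *)

Section FiniteDifferences.
Variable K : numFieldType.

Lemma binom_coefS (s : K) (r : int) :
  binom_coef (s + 1) r = binom_coef s r - binom_coef s (r - 1).
Proof.
elim/int_strong_ind: r => [r hr|r hr IH]; first by rewrite !binom_coef_neg ?subr0 //; lia.
case: (eqVneq r 0) => [->|r0]; first by rewrite !binom_coef0 binom_coef_neg ?subr0.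
have e0 := binom_coef_rec (s + 1) r; rewrite IH // !intrB in e0.
have e1 := binom_coef_rec s r; have e2 := binom_coef_rec s (r - 1).
rewrite !intrB in e1 e2; apply: (@mulfI _ (r%:~R : K)); first by rewrite intr_eq0.
rewrite [LHS]e0 [RHS]mulrBr e1.
transitivity ((r%:~R - 1 - (s + 1)) * binom_coef s (r - 1)
  - (r%:~R - 1 - 1 - s) * binom_coef s (r - 1 - 1)); first by ring.
by rewrite -e2; ring.
Qed.

Lemma binom_coef_nat (N : nat) (r : int) : N%:Z < r -> binom_coef (N%:R : K) r = 0.
Proof.
case: r => // r hr; rewrite /binom_coef.
have hN : (N < r)%N by lia.
by rewrite (bigD1 (Ordinal hN)) //= subrr !mul0r.
Qed.

Definition falling (nu : nat) (c : K) : K := \prod_(0 <= l < nu) (c - l%:R).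

Lemma fallingS nu c : falling nu.+1 c = falling nu c * (c - nu%:R).
Proof. by rewrite /falling big_nat_recr. Qed.

Lemma falling_shift nu c : falling nu.+1 (c + 1) = (c + 1) * falling nu c.
Proof.
rewrite /falling big_nat_recl // subr0; congr (_ * _).
by apply: eq_bigr => l _; rewrite -natr1; ring.
Qed.

Lemma falling_diff nu c : falling nu.+1 (c + 1) - falling nu.+1 c = nu.+1%:R * falling nu c.
Proof. by rewrite falling_shift fallingS -natr1; ring. Qed.

Let binom_bounded (N : nat) (f : int -> K) :
  bounded (fun r => binom_coef (N%:R : K) r * f r).
Proof.
apply: (@bounded_between _ 0 N%:Z) => r hr; first by rewrite binom_coef_neg ?mul0r.
by rewrite binom_coef_nat ?mul0r.
Qed.

(** The sum is the N-th finite difference of a polynomial of degree nu < N. *)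
Lemma finite_difference (N nu : nat) (c : K) : (nu < N)%N ->
  zsum (fun r => binom_coef (N%:R : K) r * falling nu (c - r%:~R)) = 0.
Proof.
elim: N nu c => // N IH nu c hnu.
have step : zsum (fun r => binom_coef (N.+1%:R : K) r * falling nu (c - r%:~R)) =
   zsum (fun r => binom_coef (N%:R : K) r *
          (falling nu (c - r%:~R) - falling nu (c - r%:~R - 1))).
  transitivity (zsum (fun r => binom_coef (N%:R : K) r * falling nu (c - r%:~R)) +
     zsum (fun r => - (binom_coef (N%:R : K) (r - 1) * falling nu (c - r%:~R)))).
    rewrite -zsumD //; last first.
      apply: (@bounded_between _ 0 N.+1%:Z) => r hr.
        by rewrite binom_coef_neg ?mul0r ?oppr0 //; lia.
      by rewrite binom_coef_nat ?mul0r ?oppr0 //; lia.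
    by apply: eq_zsum => r; rewrite -natr1 binom_coefS mulrBl.
  rewrite -[X in _ + X](zsum_shift 1) -zsumD //.
    apply: eq_zsum => r; rewrite addrK mulrBr; congr (_ - _ * falling _ _).
    by rewrite intrD; ring.
  apply: (@bounded_between _ 0 N%:Z) => r hr; rewrite addrK.
    by rewrite binom_coef_neg ?mul0r ?oppr0 //; lia.
  by rewrite binom_coef_nat ?mul0r ?oppr0 //; lia.
rewrite step; case: nu hnu {step} => [|nu] hnu.
  by apply: zsum0 => r; rewrite /falling !big_geq // subrr mulr0.
transitivity (zsum (fun r => nu.+1%:R *
    (binom_coef (N%:R : K) r * falling nu (c - 1 - r%:~R)))).
  apply: eq_zsum => r; rewrite mulrCA; congr (_ * _).
  rewrite -falling_diff; congr (falling _ _ - falling _ _); ring.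
rewrite -(zsum_morph (f := fun a => nu.+1%:R * a)) => [||]; first last.
- exact: binom_bounded.
- by move=> a b; rewrite mulrDr.
by rewrite IH ?mulr0.
Qed.

End FiniteDifferences.

(** * Products of vertex operators *)

Section VertexProducts.
Variables (K : numFieldType) (F : comAlgType K).
Variables (x : nat -> F) (D : nat -> F -> F).
Hypothesis D_linear : forall n, linear (D n).
Hypothesis D1 : forall n, D n.+1 1 = 0.
Hypothesis D_gen : forall n j P,
  D n.+1 (x j.+1 * P) = (n == j)%:R *: P + x j.+1 * D n.+1 P.
Hypothesis F_ind : forall Q : F -> Prop, Q 1 ->
  (forall a p q, Q p -> Q q -> Q (a *: p + q)) ->
  (forall n p, Q p -> Q (x n.+1 * p)) -> forall p, Q p.

Local Notation cre := (cre x).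
Local Notation ann := (ann D).

Let cre_neg al k : k < 0 -> cre al k = 0. Proof. exact: cre_neg. Qed.
Let ann_neg al k P : k < 0 -> ann al k P = 0. Proof. exact: ann_neg. Qed.
Let ann_lin al k : linear (ann al k). Proof. exact: ann_linear_op. Qed.
Let annD al k := linear_morphD (ann_lin al k).
Let annZ al k := linear_scalable (ann_lin al k).
Let ann_trunc al P : exists B : int, forall k, B < k -> ann al k P = 0.
Proof. exact: ann_truncated. Qed.
Let ann_comm al be i j P : ann al i (ann be j P) = ann be j (ann al i P).
Proof. exact: ann_comm. Qed.

Let annE1 al k : ann al k 1 = if k == 0 then 1 else 0.
Proof. exact: (ann1 D_linear D1 D_gen F_ind). Qed.
Let annE0 al P : ann al 0 P = P.
Proof. exact: ann0. Qed.
Let annE_gen al k j P :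
  ann al k (x j.+1 * P) = x j.+1 * ann al k P - al *: ann al (k - j.+1%:Z) P.
Proof. exact: (ann_gen D_linear D1 D_gen F_ind). Qed.

Let ann_bounded al P (f : int -> F) : bounded (fun t => f t * ann al t P).
Proof.
have [B hB] := ann_trunc al P; apply: (@bounded_between _ 0 B) => t ht.
  by rewrite ann_neg ?mulr0.
by rewrite hB ?mulr0.
Qed.

Lemma cre_add al be k :
  zsum (fun i => cre al i * cre be (k - i)) = cre (al + be) k.
Proof.
pose xp (n : int) : F := if n is Posz n'.+1 then x n'.+1 else 0.
have xp_nonpos n : n < 1 -> xp n = 0 by case: n => [[|n]|n] //; lia.
pose T (n : int) (y : F) := (al + be) *: (xp n * y).
have bd k' (f : int -> F) : bounded (fun i => cre al i * cre be (k' - i)).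
  apply: (@bounded_between _ 0 k') => i hi; first by rewrite cre_neg ?mul0r.
  by rewrite [X in _ * X]cre_neg ?mulr0 //; lia.
have bx ga k' : bounded (fun n => ga *: (xp n * cre ga (k' - n))).
  apply: (@bounded_between _ 1 k') => n hn; first by rewrite xp_nonpos ?mul0r ?scaler0.
  by rewrite cre_neg ?mulr0 ?scaler0 //; lia.
pose G (k : int) := zsum (fun i => cre al i * cre be (k - i)).
have G_neg k' : k' < 0 -> G k' = 0.
  move=> hk; apply: zsum0 => i; case: (ltP i 0) => hi; first by rewrite cre_neg ?mul0r.
  by rewrite [X in _ * X]cre_neg ?mulr0 //; lia.
apply: (series_unique (T := T) (f := G) (g := cre (al + be))) => //.
- by move=> n y hn; rewrite /T xp_nonpos ?mul0r ?scaler0.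
- by move=> j hj; rewrite cre_neg.
- rewrite /G (zsum_single (c := 0)) ?subr0 ?cre0 ?mul1r // => i i0.
  case: (ltP i 0) => hi; first by rewrite cre_neg ?mul0r.
  by rewrite [X in _ * X]cre_neg ?mulr0 //; lia.
- move=> j.
  have bG : bounded (fun n => xp n * G (j - n)).
    apply: (@bounded_between _ 1 j) => n hn; first by rewrite xp_nonpos ?mul0r.
    by rewrite G_neg ?mulr0 //; lia.
  transitivity (zsum (fun i => (i%:~R *: cre al i) * cre be (j - i)) +
    zsum (fun i => cre al i * ((j - i)%:~R *: cre be (j - i)))).
    rewrite -zsumD; first last.
    - have := bounded_scale (fun i => (j - i)%:~R : K) (bd j (fun=> 0)).
      by congr bounded; apply: funext => i; rewrite scalerAr.
    - have := bounded_scale (fun i => i%:~R : K) (bd j (fun=> 0)).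
      by congr bounded; apply: funext => i; rewrite scalerAl.
    rewrite /G zsumZ; last exact: (bd j (fun=> 0)).
    apply: eq_zsum => i; rewrite -scalerAl -scalerAr -scalerDl; congr (_ *: _).
    by rewrite intrB addrC subrK.
  have e1 : zsum (fun i => (i%:~R *: cre al i) * cre be (j - i)) =
      al *: zsum (fun n => xp n * G (j - n)).
    transitivity (zsum (fun i => zsum (fun n =>
       al *: (xp n * (cre al (i - n) * cre be (j - i)))))).
      apply: eq_zsum => i; rewrite cre_rec (zsum_morph (f := fun p => p * cre be (j - i))) => [||].
      - by apply: eq_zsum => n; rewrite -scalerAl mulrA.
      - by move=> p q; rewrite mulrDl.
      - exact: bx.
    rewrite zsum_exchange; last first.
      exists `|j| => i n hin; case: (ltP n 1) => hn; first by rewrite xp_nonpos ?mul0r ?scaler0.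
      case: (ltP (i - n) 0) => hi; first by rewrite cre_neg ?mul0r ?mulr0 ?scaler0.
      by rewrite [cre be _]cre_neg ?mulr0 ?scaler0 //; lia.
    rewrite zsumZ //; apply: eq_zsum => n.
    rewrite -[LHS](zsum_shift n).
    rewrite /G (zsum_morph (f := fun p => xp n * p)) => [||]; first last.
    - exact: (bd _ (fun=> 0)).
    - by move=> p q; rewrite mulrDr.
    rewrite zsumZ; last first.
      apply: (bounded_morph (f := fun p => xp n * p)); first by move=> p q; rewrite mulrDr.
      exact: (bd _ (fun=> 0)).
    apply: eq_zsum => i; rewrite addrK (_ : j - (i + n) = j - n - i) //; ring.
  have e2 : zsum (fun i => cre al i * ((j - i)%:~R *: cre be (j - i))) =
      be *: zsum (fun n => xp n * G (j - n)).
    transitivity (zsum (fun i => zsum (fun n =>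
       be *: (xp n * (cre al i * cre be (j - n - i)))))).
      apply: eq_zsum => i; rewrite cre_rec (zsum_morph (f := fun p => cre al i * p)) => [||].
      - apply: eq_zsum => n; rewrite -scalerAr mulrCA (_ : j - i - n = j - n - i) //; ring.
      - by move=> p q; rewrite mulrDr.
      - exact: bx.
    rewrite zsum_exchange; last first.
      exists `|j| => i n hin; case: (ltP n 1) => hn; first by rewrite xp_nonpos ?mul0r ?scaler0.
      case: (ltP i 0) => hi; first by rewrite cre_neg ?mul0r ?mulr0 ?scaler0.
      by rewrite [cre be _]cre_neg ?mulr0 ?scaler0 //; lia.
    rewrite zsumZ //; apply: eq_zsum => n.
    rewrite /G (zsum_morph (f := fun p => xp n * p)) => [||]; first last.
    - exact: (bd _ (fun=> 0)).
    - by move=> p q; rewrite mulrDr.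
    rewrite zsumZ //.
    apply: (bounded_morph (f := fun p => xp n * p)); first by move=> p q; rewrite mulrDr.
    exact: (bd _ (fun=> 0)).
  by rewrite e1 e2 -scalerDl zsumZ.
- move=> j; exact: cre_rec.
Qed.

Lemma ann_add al be k P :
  zsum (fun i => ann al i (ann be (k - i) P)) = ann (al + be) k P.
Proof.
have bd j p : bounded (fun i => ann al i (ann be (j - i) p)).
  apply: (@bounded_between _ 0 j) => i hi; first by rewrite ann_neg.
  by rewrite [X in ann al i X]ann_neg ?(morphD0 (annD al i)) //; lia.
elim/F_ind: P k => [|a p q hp hq|n p hp] k.
- rewrite annE1 (zsum_single (c := 0)) => [|i i0].
    by rewrite annE0 subr0 annE1.
  by rewrite ann_comm annE1 (negbTE i0) (morphD0 (annD be _)).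
- rewrite ann_lin -hp -hq zsumZ // -zsumD //; last exact: boundedZ.
  by apply: eq_zsum => i; rewrite !ann_lin.
- rewrite annE_gen -!hp.
  rewrite (zsum_morph (f := fun u => x n.+1 * u)) => [||//]; last by move=> u w; rewrite mulrDr.
  rewrite scalerDl opprD addrA.
  rewrite -[X in _ - al *: X - _](zsum_shift (- n.+1%:Z)) -!scaleNr zsumZ; last first.
    exact: (@bounded_shift _ (- n.+1%:Z) (fun i => ann al i (ann be (k - n.+1%:Z - i) p))).
  rewrite zsumZ // -zsumD; first last.
  - apply: boundedZ.
    exact: (@bounded_shift _ (- n.+1%:Z) (fun i => ann al i (ann be (k - n.+1%:Z - i) p))).
  - by apply: bounded_morph => // u w; rewrite mulrDr.
  rewrite -zsumD; first last.
  - exact: boundedZ.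
  - apply: boundedD; first by apply: bounded_morph => // u w; rewrite mulrDr.
    apply: boundedZ.
    exact: (@bounded_shift _ (- n.+1%:Z) (fun i => ann al i (ann be (k - n.+1%:Z - i) p))).
  apply: eq_zsum => i; rewrite annE_gen -scaleNr annD annZ annE_gen -scaleNr.
  congr (_ + _ *: ann _ _ (ann _ _ _) + _ *: ann _ _ (ann _ _ _)); ring.
Qed.

(** The coefficients of exp (al \sum_n x_n z^n / n) exp (- al \sum_n D_n z^(- n)) and,
    next, of the normally ordered product of two such operators. *)
Definition vertex al (d : int) (P : F) : F :=
  zsum (fun t => cre al (d + t) * ann al t P).

Definition normal_product al be (m n : int) (P : F) : F :=
  zsum (fun k => zsum (fun l =>
    cre al (m + k) * cre be (n + l) * ann al k (ann be l P))).
Local Notation nop := normal_product.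

Lemma vertex_linear al d : linear (vertex al d).
Proof.
move=> a p q; rewrite /vertex zsumZ; last exact: ann_bounded.
rewrite -zsumD; [|exact/boundedZ/ann_bounded|exact: ann_bounded].
by apply: eq_zsum => t; rewrite ann_lin mulrDr scalerAr.
Qed.

Let box al be P : exists B : int, (forall k l, B < k -> ann al k (ann be l P) = 0) /\
  (forall k l, B < l -> ann al k (ann be l P) = 0).
Proof.
have [B hB] := ann_trunc al P; have [B' hB'] := ann_trunc be P.
exists (`|B| + `|B'|); split=> k l hkl.
  by rewrite ann_comm hB ?(morphD0 (annD be _)) //; lia.
by rewrite hB' ?(morphD0 (annD al _)) //; lia.
Qed.

Let ann2_neg al be k l P : k < 0 \/ l < 0 -> ann al k (ann be l P) = 0.
Proof.
case=> h; first by rewrite ann_neg.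
by rewrite [X in ann al k X]ann_neg // (morphD0 (annD al _)).
Qed.

Lemma vertex_truncated al P : exists B : int, forall d, d < B -> vertex al d P = 0.
Proof.
have [B hB] := ann_trunc al P; exists (- B) => d hd; apply: zsum0 => t.
case: (ltP B t) => ht; first by rewrite hB ?mulr0.
by rewrite cre_neg ?mul0r //; lia.
Qed.

Lemma normal_product_truncated al be P :
  exists B : int, forall m n, m < B \/ n < B -> nop al be m n P = 0.
Proof.
have [B [h1 h2]] := box al be P; exists (- B) => m n hmn.
apply: zsum0 => k; apply: zsum0 => l.
case: (ltP B k) => hk; first by rewrite h1 ?mulr0.
case: (ltP B l) => hl; first by rewrite h2 ?mulr0.
case: hmn => h; first by rewrite cre_neg ?mul0r //; lia.
by rewrite [cre be _]cre_neg ?mulr0 ?mul0r //; lia.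
Qed.

Lemma normal_product_sym al m n P : nop al al m n P = nop al al n m P.
Proof.
have [B [h1 h2]] := box al al P.
rewrite /normal_product zsum_exchange; last first.
  exists `|B| => k l hkl; case: (ltP k 0) => hk; first by rewrite ann2_neg ?mulr0 //; left.
  case: (ltP l 0) => hl; first by rewrite ann2_neg ?mulr0 //; right.
  by case: hkl => h; [rewrite h1|rewrite h2]; rewrite ?mulr0 //; lia.
by apply: eq_zsum => l; apply: eq_zsum => k; rewrite ann_comm [cre _ _ * cre _ _]mulrC.
Qed.

(** phi_al(z) phi_be(w) = (1 - w / z)^(al be) :phi_al(z) phi_be(w):, up to the powers
    of z and w that come from the charges. *)
Lemma vertex_mul al be m n P : vertex al m (vertex be n P) =
  zsum (fun r => binom_coef (al * be) r *: nop al be (m + r) (n - r) P).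
Proof.
have [B [h1 h2]] := box al be P.
have [B' hB'] := ann_trunc be P.
pose b := binom_coef (al * be).
have b_neg r : r < 0 -> b r = 0 by exact: binom_coef_neg.
pose T (k l r : int) := b r *:
  (cre al (m + k) * cre be (n + l - r) * ann al (k - r) (ann be l P)).
pose C := `|B| + `|n| + `|m| + `|B|.
have T0 k l r : [\/ C < `|k|, C < `|l| | C < `|r|] -> T k l r = 0.
  move=> h; rewrite /T; case: (ltP r 0) => r0; first by rewrite b_neg ?scale0r.
  case: (ltP l 0) => l0; first by rewrite ann2_neg ?mulr0 ?scaler0 //; right.
  case: (ltP (k - r) 0) => k0; first by rewrite ann2_neg ?mulr0 ?scaler0 //; left.
  case: (ltP B l) => hl; first by rewrite h2 ?mulr0 ?scaler0.
  case: (ltP B (k - r)) => hk; first by rewrite h1 ?mulr0 ?scaler0.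
  rewrite [cre be _]cre_neg ?mulr0 ?mul0r ?scaler0 //.
  by rewrite /C in h; case: h => h; lia.
transitivity (zsum (fun k => zsum (fun l => zsum (fun r => T k l r)))).
  apply: eq_zsum => k; rewrite (zsum_morph (annD al k)); last exact: ann_bounded.
  rewrite (zsum_morph (f := fun p => cre al (m + k) * p)) => [||]; first last.
  - by apply: bounded_morph; [exact: annD|exact: ann_bounded].
  - by move=> p q; rewrite mulrDr.
  apply: eq_zsum => l.
  rewrite (ann_cre D_linear D1 D_gen F_ind).
  rewrite (zsum_morph (f := fun p => cre al (m + k) * p)) => [||].
  - by apply: eq_zsum => r; rewrite -scalerAr mulrA.
  - by move=> p q; rewrite mulrDr.
  apply: (@bounded_between _ 0 (n + l)) => r hr; first by rewrite binom_coef_neg ?scale0r.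
  by rewrite cre_neg ?mul0r ?scaler0 //; lia.
rewrite (zsum_rotate T0); apply: eq_zsum => r.
rewrite -[LHS](zsum_shift r) /normal_product zsumZ; last first.
  apply: (@bounded_between _ 0 B) => k hk; apply: zsum0 => l.
    by rewrite ann2_neg ?mulr0 //; left.
  by rewrite h1 ?mulr0.
apply: eq_zsum => k; rewrite zsumZ; last first.
  apply: (@bounded_between _ 0 B) => l hl; first by rewrite ann2_neg ?mulr0 //; right.
  by rewrite h2 ?mulr0.
apply: eq_zsum => l; rewrite /T addrK.
by rewrite (_ : m + (k + r) = m + r + k) 1?(_ : n + l - r = n - r + l) //; ring.
Qed.

(** :phi_al(z) phi_al(z): is phi_(2 al)(z), by adding exponents of exponentials. *)
Lemma vertex_diagonal al q P :
  zsum (fun m => nop al al m (q - m) P) = vertex (al + al) q P.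
Proof.
have [B [h1 h2]] := box al al P.
pose T (k l m : int) := cre al (m + k) * cre al (q - m + l) * ann al k (ann al l P).
pose C := `|B| + `|q| + `|B|.
have T0 k l m : [\/ C < `|k|, C < `|l| | C < `|m|] -> T k l m = 0.
  move=> h; rewrite /T.
  case: (ltP l 0) => l0; first by rewrite ann2_neg ?mulr0 //; right.
  case: (ltP k 0) => k0; first by rewrite ann2_neg ?mulr0 //; left.
  case: (ltP B l) => hl; first by rewrite h2 ?mulr0.
  case: (ltP B k) => hk; first by rewrite h1 ?mulr0.
  case: (ltP (m + k) 0) => hm; first by rewrite cre_neg ?mul0r.
  rewrite [X in _ * X * _]cre_neg ?mulr0 ?mul0r //.
  by rewrite /C in h; case: h => h; lia.
transitivity (zsum (fun k => zsum (fun l => zsum (fun m => T k l m)))).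
  by rewrite (zsum_rotate T0).
transitivity (zsum (fun k => zsum (fun t =>
    cre (al + al) (q + t) * ann al k (ann al (t - k) P)))).
  apply: eq_zsum => k; rewrite -[RHS](zsum_shift k); apply: eq_zsum => l.
  rewrite addrK -cre_add (zsum_morph (f := fun p => p * ann al k (ann al l P))) => [||].
  - rewrite -[RHS](zsum_shift k); apply: eq_zsum => m.
    by rewrite /T (_ : q + (l + k) - (m + k) = q - m + l) //; ring.
  - by move=> p r; rewrite mulrDl.
  apply: (@bounded_between _ 0 (q + (l + k))) => i hi; first by rewrite cre_neg ?mul0r.
  by rewrite [X in _ * X]cre_neg ?mulr0 //; lia.
rewrite zsum_exchange; last first.
  exists C => k t hkt; case: (ltP (t - k) 0) => l0; first by rewrite ann2_neg ?mulr0 //; right.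
  case: (ltP k 0) => k0; first by rewrite ann2_neg ?mulr0 //; left.
  case: (ltP B (t - k)) => hl; first by rewrite h2 ?mulr0.
  case: (ltP B k) => hk; first by rewrite h1 ?mulr0.
  by rewrite /C in hkt; case: hkt => h; lia.
apply: eq_zsum => t; rewrite -ann_add (zsum_morph (f := fun p => cre (al + al) (q + t) * p)) //.
  by move=> p r; rewrite mulrDr.
apply: (@bounded_between _ 0 t) => k hk; rewrite ann2_neg //; [left|right]; lia.
Qed.

(** For al be = N the binomial series is a polynomial, so the powers of
    z and w in the product are bounded below. *)
Lemma vertex_mul_truncated (N : nat) al be P : al * be = N%:R ->
  exists B : int, forall m n, m < B \/ n < B -> vertex al m (vertex be n P) = 0.
Proof.
move=> hN; have [B hB] := normal_product_truncated al be P.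
have [B' hB'] := vertex_truncated be P.
exists (- (`|B| + `|B'| + N%:Z)) => m n [] h; last first.
  rewrite hB'; last by lia.
  exact: morphD0 (linear_morphD (vertex_linear al m)).
rewrite vertex_mul hN; apply: zsum0 => r.
case: (ltP r 0) => r0; first by rewrite binom_coef_neg ?scale0r.
case: (ltP N%:Z r) => rN; first by rewrite binom_coef_nat ?scale0r.
by rewrite hB ?scaler0 //; left; lia.
Qed.

(** The polynomial (1 - w / z)^N divides phi_al(z) phi_be(w) when N = al be, hence
    the derivatives of order less than N in w vanish at w = z. The constant c
    allows for a shift of the exponents of w. *)
Lemma vertex_vanishing (N nu : nat) al be q (c : K) P :
  al * be = N%:R -> (nu < N)%N ->
  zsum (fun j => falling nu (c - j%:~R) *: vertex al (q - j) (vertex be j P)) = 0.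
Proof.
move=> hN hnu; have [B hB] := normal_product_truncated al be P.
pose T (j r : int) := (falling nu (c - j%:~R) * binom_coef (N%:R : K) r) *:
  nop al be (q - j + r) (j - r) P.
have hb j : bounded (fun r => binom_coef (N%:R : K) r *: nop al be (q - j + r) (j - r) P).
  apply: (@bounded_between _ 0 N%:Z) => r hr; first by rewrite binom_coef_neg ?scale0r.
  by rewrite binom_coef_nat ?scale0r.
transitivity (zsum (fun j => zsum (fun r => T j r))).
  apply: eq_zsum => j; rewrite vertex_mul hN zsumZ //.
  by apply: eq_zsum => r; rewrite scalerA.
rewrite zsum_exchange; last first.
  exists (`|B| + `|q| + `|B| + N%:Z) => j r hjr; rewrite /T.
  case: (ltP r 0) => r0; first by rewrite binom_coef_neg ?mulr0 ?scale0r.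
  case: (ltP N%:Z r) => rN; first by rewrite binom_coef_nat ?mulr0 ?scale0r.
  rewrite hB ?scaler0 //.
  case: (ltP (q - j + r) B) => h; first by left.
  by right; case: hjr => h'; lia.
transitivity (zsum (fun r => zsum (fun j =>
   (binom_coef (N%:R : K) r * falling nu (c - j%:~R - r%:~R)) *: nop al be (q - j) j P))).
  apply: eq_zsum => r; rewrite -[LHS](zsum_shift r); apply: eq_zsum => j; rewrite /T addrK.
  rewrite (_ : q - (j + r) + r = q - j); last by ring.
  by rewrite mulrC; congr ((_ * falling _ _) *: _); rewrite intrD; ring.
rewrite zsum_exchange; last first.
  exists (`|B| + `|q| + N%:Z) => r j hjr.
  case: (ltP r 0) => r0; first by rewrite binom_coef_neg ?mul0r ?scale0r.
  case: (ltP N%:Z r) => rN; first by rewrite binom_coef_nat ?mul0r ?scale0r.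
  rewrite hB ?scaler0 //.
  case: (ltP (q - j) B) => h; first by left.
  by right; case: hjr => h'; lia.
apply: zsum0 => j.
rewrite -(zsum_morph (f := fun a => a *: nop al be (q - j) j P)) => [||].
- by rewrite finite_difference // scale0r.
- by move=> a a'; rewrite scalerDl.
apply: (@bounded_between _ 0 N%:Z) => r hr; first by rewrite binom_coef_neg ?mul0r.
by rewrite binom_coef_nat ?mul0r.
Qed.

End VertexProducts.

(** * Vertex operators on the Fock space *)

(** Pairs of given difference d are parametrized by their second entry. *)
Lemma fsum_difference (V : zmodType) (G : nat -> nat -> V) (H : int -> V) (d : int) :
  (forall t1 t2 : nat, t1%:Z - t2%:Z = d -> G t1 t2 = H t2%:Z) ->
  (forall t : int, t < 0 \/ d + t < 0 -> H t = 0) ->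
  \sum_(t \in [set t : nat * nat | t.1%:Z - t.2%:Z = d]) G t.1 t.2 = zsum H.
Proof.
move=> GH H0; rewrite /zsum.
rewrite -(@fsbig_widen _ _ _ _ [set t : int | 0 <= t /\ 0 <= d + t]) //; last first.
  by move=> t [_ /= ht]; apply: H0; lia.
rewrite (@reindex_fsbig _ _ _ _ _ (fun t : nat * nat => t.2%:Z)
  [set t : nat * nat | t.1%:Z - t.2%:Z = d]); last first.
  split=> [t /= <-|t u|t /= [t0 dt]]; first by lia.
    rewrite !inE /= => ht hu e; case: t u ht hu e => [t1 t2] [u1 u2] /= ht hu e.
    by congr pair; lia.
  by exists (absz (d + t)%R, absz t); rewrite /=; lia.
by apply: eq_fsbigr => t; rewrite inE => /= ht; exact: GH.
Qed.

Section FockSpace.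
Variable K : numFieldType.
Local Notation fock := (ipoly K).

Lemma exp_coef_series (X Y : nat -> fock -> fock) k P :
  (forall n p, (0 < n)%N -> X n p = Y n p) -> exp_coef X k P = series_exp Y k P.
Proof.
move=> XY; apply: eq_bigr => j _; congr (_ *: _).
elim: j k P => [|j IH] k P //=; apply: eq_big_nat => n /andP[n0 _].
by rewrite XY // IH.
Qed.

Lemma creation_coefE gamma al k P :
  creation_coef gamma al k P = cre (pgen K) al k%:Z * P.
Proof.
apply: (etrans _ (creation_exp (pgen K) al k%:Z P)).
apply: exp_coef_series => n p; case: n => [n0|n _]; first by discriminate n0.
have -> : al / (- n.+1%:Z)%:~R = - (al / n.+1%:R) by rewrite mulrNz invrN mulrN.
by rewrite opprK.
Qed.

Lemma annihilation_coefE gamma al k P :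
  annihilation_coef gamma al k P = ann (@pderiv K) al k%:Z P.
Proof.
apply: exp_coef_series => n p; case: n => [n0|n _]; first by discriminate n0.
apply: (etrans (scalerA _ _ _)).
have -> : - (al / n.+1%:R) * n.+1%:R = - al by rewrite mulNr divfK ?pnatr_eq0.
by [].
Qed.

Lemma phi_modeE gamma al d P :
  phi_mode gamma al d P = vertex (pgen K) (@pderiv K) al d P.
Proof.
apply: (@fsum_difference _
  (fun t1 t2 => creation_coef (gamma + al) al t1 (annihilation_coef gamma al t2 P))
  (fun t => cre (pgen K) al (d + t) * ann (@pderiv K) al t P)) => [t1 t2 <-|t ht].
  rewrite annihilation_coefE creation_coefE.
  by have -> : t1%:Z - t2%:Z + t2%:Z = t1%:Z by rewrite subrK.
case: ht => ht; last by rewrite cre_neg //; apply: mul0r.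
by rewrite ann_neg //; apply: mulr0.
Qed.

End FockSpace.

(** * Products of a field and a vertex operator *)

Section TensorMaps.
Variables (K : fieldType) (U V U' V' : lmodType K).
Variables (f : U -> U') (g : V -> V').
Hypotheses (f_linear : linear f) (g_linear : linear g).

Let bil : bilinear_map (fun u v => tpure (f u) (g v)).
Proof.
have [tl tr] := @tpure_bilinear K U' V'.
by split=> a u w w'; rewrite ?f_linear ?g_linear ?tl ?tr.
Qed.

Lemma tmap_linear : linear (tmap f g).
Proof. exact: tlift_linear. Qed.

Lemma tmap_pure u v : tmap f g (tpure u v) = tpure (f u) (g v).
Proof. exact: tlift_pure. Qed.

End TensorMaps.

Section PureTensors.
Variables (K : fieldType) (U V : lmodType K).
Implicit Types (u : U) (v : V).

Lemma tpure_linearl v : linear (fun u => tpure u v).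
Proof. by move=> a u u'; case: (@tpure_bilinear K U V) => h _; rewrite h. Qed.

Lemma tpure_linearr u : linear (fun v => tpure u v).
Proof. by move=> a v v'; case: (@tpure_bilinear K U V) => _ h; rewrite h. Qed.

Lemma tpure0l v : tpure (0 : U) v = 0.
Proof. exact: morphD0 (linear_morphD (tpure_linearl v)). Qed.

Lemma tpure0r u : tpure u (0 : V) = 0.
Proof. exact: morphD0 (linear_morphD (tpure_linearr u)). Qed.

Lemma tpureZl a u v : tpure (a *: u) v = a *: tpure u v.
Proof. exact: (linear_scalable (tpure_linearl v)). Qed.

Lemma tpureZr a u v : tpure u (a *: v) = a *: tpure u v.
Proof. exact: (linear_scalable (tpure_linearr u)). Qed.

Lemma tensor_ind (Q : tensor U V -> Prop) : Q 0 ->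
  (forall s t, Q s -> Q t -> Q (s + t)) -> (forall u v, Q (tpure u v)) ->
  forall t, Q t.
Proof.
move=> Q0 QD Qp t; have [s ->] := tensor_sum t.
by apply: (big_ind Q) => // x _; exact: Qp.
Qed.

End PureTensors.

Section FieldTimesVertex.
Variables (K : numFieldType) (F : lmodType K) (phi : int -> F -> F).
Hypothesis phi_linear : forall d, linear (phi d).
Hypothesis phi_trunc : forall P, exists B : int, forall d, d < B -> phi d P = 0.
Variables (M M' : lmodType K) (psi : int -> {linear M -> M'}).
Hypothesis psi_trunc : forall u, exists B : int, forall j, B < j -> psi j u = 0.

(** The mode a_k of psi(z) phi(z), where e collects the powers of z due to the
    charge and to the sector of psi. *)
Definition product_mode (e k : int) (x : tensor M F) : tensor M' F :=
  zsum (fun i => tmap (psi i) (phi (i - k - 1 - e)) x).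

Let T i j := tmap_linear (linearP (psi i)) (phi_linear j).

Lemma product_mode_bounded e k x :
  bounded (fun i => tmap (psi i) (phi (i - k - 1 - e)) x).
Proof.
elim/tensor_ind: x => [|s t hs ht|u P].
- by exists 0 => i _; exact: morphD0 (linear_morphD (T i _)).
- rewrite (_ : (fun i => _) = (fun i => tmap (psi i) (phi (i - k - 1 - e)) s +
     tmap (psi i) (phi (i - k - 1 - e)) t)); first exact: boundedD.
  by apply: funext => i; exact: (linear_morphD (T i _)).
have [B hB] := psi_trunc u; have [B' hB'] := phi_trunc P.
apply: (@bounded_between _ (B' + k + 1 + e) B) => i hi.
  by rewrite tmap_pure //; [rewrite hB' ?tpure0r //; lia|exact: linearP].
by rewrite tmap_pure //; [rewrite hB ?tpure0l //; lia|exact: linearP].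
Qed.

Lemma product_mode_linear e k : linear (product_mode e k).
Proof.
move=> a s t; have hb := product_mode_bounded e k.
rewrite /product_mode zsumZ // -zsumD //; last exact: boundedZ.
by apply: eq_zsum => i; exact: T.
Qed.

Lemma product_mode_pure e k u P : product_mode e k (tpure u P) =
  zsum (fun i => tpure (psi i u) (phi (i - k - 1 - e) P)).
Proof. by apply: eq_zsum => i; rewrite tmap_pure //; exact: linearP. Qed.

Lemma product_mode_truncated e x :
  exists B : int, forall k, B < k -> product_mode e k x = 0.
Proof.
elim/tensor_ind: x => [|s t [B hB] [B' hB']|u P].
- by exists 0 => k _; exact: morphD0 (linear_morphD (product_mode_linear e k)).
- exists (`|B| + `|B'|) => k hk.
  by rewrite (linear_morphD (product_mode_linear e k)) hB ?hB' ?addr0 //; lia.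
have [B hB] := psi_trunc u; have [B' hB'] := phi_trunc P.
exists (B - 1 - e - B') => k hk; rewrite product_mode_pure; apply: zsum0 => i.
case: (ltP B i) => hi; first by rewrite hB ?tpure0l.
by rewrite hB' ?tpure0r //; lia.
Qed.

End FieldTimesVertex.

(** * Two modes: commutation and the square *)

Section TwoModes.
Variables (K : numFieldType) (F : lmodType K) (hf : K).
Variables (phi phi2 : int -> F -> F) (nop : int -> int -> F -> F).
Hypothesis phi_linear : forall d, linear (phi d).
Hypothesis phi_trunc : forall P, exists B : int, forall d, d < B -> phi d P = 0.
Hypothesis phi_mul : forall m n P, phi m (phi n P) =
  zsum (fun r => binom_coef (hf + hf) r *: nop (m + r) (n - r) P).
Hypothesis nop_trunc : forall P,
  exists B : int, forall m n, m < B \/ n < B -> nop m n P = 0.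
Hypothesis nop_sym : forall m n P, nop m n P = nop n m P.
Hypothesis nop_diag : forall q P, zsum (fun m => nop m (q - m) P) = phi2 q P.

Variables (N : int) (M M' : lmodType K).
Variables (psi : int -> {linear M -> M'}) (psi' : int -> {linear M' -> M}).
Hypothesis psi_trunc : forall u, exists B : int, forall j, B < j -> psi j u = 0.
Hypothesis psi_trunc' : forall u, exists B : int, forall j, B < j -> psi' j u = 0.
Hypothesis psi_trunc2 : forall u,
  exists B : int, forall i j, B < i + j -> psi' i (psi j u) = 0.

Local Notation H := (product_coef hf N psi psi').
Local Notation bin := (binom_coef (hf + hf)).
Hypothesis H_trunc : forall u, exists B : int, forall a b, B < b -> H a b u = 0.
Hypothesis H_sym : forall a b u, H a b u = H b a u.
Variable kappa : K.
Hypothesis H_diag : forall q u,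
  diagonal_coef hf N psi psi' q u = if q == - N then kappa *: u else 0.

Variable e : int.
Local Notation A := (product_mode phi psi e).
Local Notation A' := (product_mode phi psi' (e + N)).

(** The binomial coefficients that come from the product of the two vertex
    operators are absorbed in psi'(z) psi(w). *)
Lemma two_modes_pure k l u P : A' k (A l (tpure u P)) =
  zsum (fun a => zsum (fun b => tpure (H a b u) (nop (a - k - 1 - e) (b - l - 1 - e) P))).
Proof.
have [J hJ] := psi_trunc u; have [C hC] := psi_trunc2 u; have [B hB] := nop_trunc P.
have bin_neg r : r < 0 -> bin r = 0 by exact: binom_coef_neg.
(* S is the summand in terms of the modes of psi' and psi. Truncation confines
   its support to a box, of which X is a crude size. *)
pose S (i j r : int) := bin r *: tpure (psi' i (psi j u))
  (nop (i - k - 1 - (e + N) + r) (j - l - 1 - e - r) P).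
pose X := `|J| + `|C| + `|B| + `|k| + `|l| + `|e| + `|N| + 2.
have S0 i j r : 3%:R * X < `|i| \/ X + X < `|j| \/ X + X < `|r| -> S i j r = 0.
  move=> h; rewrite /S; case: (ltP r 0) => r0; first by rewrite bin_neg ?scale0r.
  case: (ltP J j) => hj; first by rewrite hJ // linear0 tpure0l scaler0.
  case: (ltP C (i + j)) => hij; first by rewrite hC // tpure0l scaler0.
  rewrite hB ?tpure0r ?scaler0 //.
  case: (ltP (j - l - 1 - e - r) B) => h1; first by right.
  by left; rewrite /X in h; lia.
have S0' i j r : [\/ 4%:R * X < `|i|, 4%:R * X < `|j| | 4%:R * X < `|r|] -> S j i r = 0.
  by move=> h; apply: S0; rewrite /X in h *; case: h => h; lia.
transitivity (zsum (fun j => zsum (fun i => zsum (fun r => S i j r)))).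
  have A'_linear := product_mode_linear phi_linear phi_trunc psi_trunc' (e + N) k.
  rewrite product_mode_pure // (zsum_morph (linear_morphD A'_linear)).
    apply: eq_zsum => j; rewrite product_mode_pure //; apply: eq_zsum => i.
    rewrite phi_mul (zsum_morph (linear_morphD (tpure_linearr (psi' i (psi j u))))).
      by apply: eq_zsum => r; rewrite tpureZr.
    apply: (@bounded_between _ 0 (j - l - 1 - e - B)) => r hr; first by rewrite bin_neg ?scale0r.
    by rewrite hB ?scaler0 //; right; lia.
  have [B' hB'] := phi_trunc P.
  apply: (@bounded_between _ (B' + l + 1 + e) J) => j hj.
    by rewrite hB' ?tpure0r //; lia.
  by rewrite hJ // tpure0l.
rewrite (zsum_rotate S0').
pose S' (a b r : int) := bin r *: tpure (psi' (a + N - r) (psi (b + r) u))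
  (nop (a - k - 1 - e) (b - l - 1 - e) P).
transitivity (zsum (fun r => zsum (fun a => zsum (fun b => S' a b r)))).
  apply: eq_zsum => r; rewrite zsum_exchange; last first.
    by exists (4%:R * X) => i j h; apply: S0'; case: h => h; [apply: Or31|apply: Or32].
  (* The new indices a and b absorb r, as in the definition of product_coef. *)
  rewrite -[LHS](zsum_shift (N - r)); apply: eq_zsum => a.
  rewrite -[LHS](zsum_shift r); apply: eq_zsum => b; rewrite /S /S'.
  rewrite (_ : a + (N - r) = a + N - r); last by ring.
  rewrite (_ : a + N - r - k - 1 - (e + N) + r = a - k - 1 - e); last by ring.
  by rewrite (_ : b + r - l - 1 - e - r = b - l - 1 - e) //; ring.
rewrite -(@zsum_rotate _ _ (6%:R * X)); last first.
  move=> a b r h; rewrite /S'; case: (ltP r 0) => r0; first by rewrite bin_neg ?scale0r.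
  case: (ltP J (b + r)) => hj; first by rewrite hJ // linear0 tpure0l scaler0.
  case: (ltP C (a + N - r + (b + r))) => hij; first by rewrite hC // tpure0l scaler0.
  rewrite hB ?tpure0r ?scaler0 //.
  case: (ltP (b - l - 1 - e) B) => h1; first by right.
  by left; rewrite /X in h; case: h => h; lia.
apply: eq_zsum => a; apply: eq_zsum => b.
rewrite /product_coef (zsum_morph (linear_morphD (tpure_linearl _))).
  by apply: eq_zsum => r; rewrite tpureZl.
apply: (@bounded_between _ 0 (J - b)) => r hr; first by rewrite bin_neg ?scale0r.
by rewrite hJ ?linear0 ?scaler0 //; lia.
Qed.

Let bounded_H u P c c' : bounded2 (fun a b => tpure (H a b u) (nop (a - c) (b - c') P)).
Proof.
have [J hJ] := H_trunc u; have [B hB] := nop_trunc P.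
exists (`|J| + `|B| + `|c| + `|c'|) => a b h.
case: (ltP J b) => hb; first by rewrite hJ ?tpure0l.
case: (ltP J a) => ha; first by rewrite H_sym hJ ?tpure0l.
by rewrite hB ?tpure0r //; case: h => h; [left|right]; lia.
Qed.

Let A_lin k := product_mode_linear phi_linear phi_trunc psi_trunc e k.
Let A_lin' k := product_mode_linear phi_linear phi_trunc psi_trunc' (e + N) k.

(** Both factors are symmetric under the exchange of z and w. *)
Lemma two_modes_comm k l x : A' k (A l x) = A' l (A k x).
Proof.
elim/tensor_ind: x => [|s t hs ht|u P].
- have z l' : A l' 0 = 0 := morphD0 (linear_morphD (A_lin l')).
  have z' l' : A' l' 0 = 0 := morphD0 (linear_morphD (A_lin' l')).
  by rewrite !z !z'.
- by rewrite !(linear_morphD (A_lin _)) !(linear_morphD (A_lin' _)) hs ht.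
rewrite !two_modes_pure zsum_exchange.
  apply: eq_zsum => b; apply: eq_zsum => a.
  by rewrite H_sym nop_sym.
have := bounded_H u P (k + 1 + e) (l + 1 + e).
by congr bounded2; apply: funext => a; apply: funext => b; congr (tpure _ (nop _ _ _)); ring.
Qed.

(** At w = z the first factor is the scalar kappa and the second one a single vertex
    operator. *)
Lemma two_modes_diagonal q u P : zsum (fun i => A' i (A (q - i) (tpure u P))) =
  kappa *: tpure u (phi2 (- N - q - 2%:R - e - e) P).
Proof.
have [J hJ] := H_trunc u; have [B hB] := nop_trunc P.
pose S (a b i : int) := tpure (H (a + i) (b - i) u) (nop (a - 1 - e) (b - q - 1 - e) P).
pose X := `|J| + `|B| + `|q| + `|e| + 1.
have S0 a b i : [\/ 4%:R * X < `|a|, 4%:R * X < `|b| | 4%:R * X < `|i|] -> S a b i = 0.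
  move=> h; rewrite /S.
  case: (ltP J (b - i)) => hb; first by rewrite hJ ?tpure0l.
  case: (ltP J (a + i)) => ha; first by rewrite H_sym hJ ?tpure0l.
  rewrite hB ?tpure0r //.
  case: (ltP (a - 1 - e) B) => h1; first by left.
  by right; rewrite /X in h; case: h => h; lia.
transitivity (zsum (fun i => zsum (fun a => zsum (fun b => S a b i)))).
  apply: eq_zsum => i; rewrite two_modes_pure -[LHS](zsum_shift i); apply: eq_zsum => a.
  rewrite -[LHS](zsum_shift (- i)); apply: eq_zsum => b; rewrite /S.
  by congr (tpure _ (nop _ _ _)); ring.
rewrite -(zsum_rotate S0).
transitivity (zsum (fun a => kappa *: tpure u (nop (a - 1 - e) (- N - a - q - 1 - e) P))).
  apply: eq_zsum => a.
  transitivity (zsum (fun b => tpure (diagonal_coef hf N psi psi' (a + b) u)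
     (nop (a - 1 - e) (b - q - 1 - e) P))).
    apply: eq_zsum => b; rewrite /diagonal_coef.
    rewrite (zsum_morph (linear_morphD (tpure_linearl _))).
      rewrite -[RHS](zsum_shift a); apply: eq_zsum => i; rewrite /S.
      by rewrite (_ : a + b - (i + a) = b - i) 1?(addrC i a) //; ring.
    apply: (@bounded_between _ (a + b - J) J) => i hi; first by apply: hJ; lia.
    by rewrite H_sym; apply: hJ; lia.
  rewrite (zsum_single (c := - N - a)) => [|b hb].
    by rewrite H_diag addrC subrK eqxx tpureZl.
  rewrite H_diag; case: eqP => [hab|_]; last by rewrite tpure0l.
  by move/eqP: hb; case; lia.
rewrite -nop_diag -[LHS](zsum_shift (1 + e)).
rewrite (zsum_morph (linear_morphD (tpure_linearr u))); last first.
  apply: (@bounded_between _ B (- N - q - 2%:R - e - e - B)) => m hm; apply: hB; [left|right]; lia.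
rewrite zsumZ; last first.
  apply: (@bounded_between _ B (- N - q - 2%:R - e - e - B)) => m hm.
    by rewrite hB ?tpure0r //; left; lia.
  by rewrite hB ?tpure0r //; right; lia.
by apply: eq_zsum => m; congr (_ *: tpure _ (nop _ _ _)); ring.
Qed.

End TwoModes.

(** * Three modes *)

Section ThreeModes.
Variables (K : numFieldType) (F : lmodType K).
Variables (phi phi2 : int -> F -> F).
Hypothesis phi_linear : forall d, linear (phi d).
Hypothesis phi_trunc : forall P, exists B : int, forall d, d < B -> phi d P = 0.
Hypothesis phi2_linear : forall d, linear (phi2 d).
Hypothesis phi2_trunc : forall P,
  exists B : int, forall m n, m < B \/ n < B -> phi2 m (phi n P) = 0.
Variable nu : nat.
Hypothesis phi2_vanishing : forall q (c : K) P,
  zsum (fun j => falling nu (c - j%:~R) *: phi2 (q - j) (phi j P)) = 0.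

Variables (M M' : lmodType K) (psi : int -> {linear M -> M'}).
Hypothesis psi_trunc : forall u, exists B : int, forall j, B < j -> psi j u = 0.
Variable V2 : lmodType K.
Variables (A1 : int -> tensor M' F -> V2) (A2 : int -> V2 -> tensor M' F).
Hypothesis A1_linear : forall k, linear (A1 k).
Hypothesis A2_linear : forall k, linear (A2 k).
Hypothesis A1_trunc : forall y, exists B : int, forall k, B < k -> A1 k y = 0.
Hypothesis A_comm : forall k l y, A2 k (A1 l y) = A2 l (A1 k y).
Variables (e C : int) (kappa : K).
Hypothesis A_diag : forall q u P, zsum (fun i => A2 i (A1 (q - i) (tpure u P))) =
  kappa *: tpure u (phi2 (C - q) P).
Local Notation A0 := (product_mode phi psi e).

(** This is where commutation makes the square of the field well defined. *)
Lemma square_bounded q y : bounded (fun i => A2 i (A1 (q - i) y)).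
Proof.
have [B hB] := A1_trunc y.
have z k : A2 k 0 = 0 := morphD0 (linear_morphD (A2_linear k)).
apply: (@bounded_between _ (q - B) B) => i hi; first by rewrite hB ?z //; lia.
by rewrite A_comm hB ?z.
Qed.

Let W q y := zsum (fun i => A2 i (A1 (q - i) y)).

Let W_linear q : linear (W q).
Proof.
move=> a s t; have hb := square_bounded q.
rewrite /W zsumZ // -zsumD //; last exact: boundedZ.
by apply: eq_zsum => i; rewrite A1_linear A2_linear.
Qed.

Let WD q := linear_morphD (W_linear q).
Let A0_linear k := product_mode_linear phi_linear phi_trunc psi_trunc e k.
Let A0D k := linear_morphD (A0_linear k).

Let pure_bounded u P k :
  bounded (fun j => tpure (psi j u) (phi (j - k - 1 - e) P)).
Proof.
have [B' hB'] := phi_trunc P; have [J hJ] := psi_trunc u.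
apply: (@bounded_between _ (B' + k + 1 + e) J) => j hj.
  by rewrite hB' ?tpure0r //; lia.
by rewrite hJ // tpure0l.
Qed.

Let W_pure q k u P : W q (A0 k (tpure u P)) =
  zsum (fun j => kappa *: tpure (psi j u) (phi2 (C - q) (phi (j - k - 1 - e) P))).
Proof.
rewrite product_mode_pure // (zsum_morph (WD q)) //.
by apply: eq_zsum => j; rewrite /W A_diag.
Qed.

Let term_bounded2 q u P (c : int -> K) : bounded2 (fun k j => c k *: (kappa *:
  tpure (psi j u) (phi2 (C - (q - k)) (phi (j - (k - nu%:Z) - 1 - e) P)))).
Proof.
have [B hB] := phi2_trunc P; have [J hJ] := psi_trunc u.
exists (`|B| + `|B| + `|J| + `|C| + `|q| + `|e| + `|nu%:Z| + 1 + `|B|) => k j hkj.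
case: (ltP J j) => hj; first by rewrite hJ // tpure0l !scaler0.
rewrite hB ?tpure0r ?scaler0 //.
case: (ltP (C - (q - k)) B) => h1; first by left.
by right; case: hkj => h; lia.
Qed.

Let term_bounded q x (c : int -> K) :
  bounded (fun k => c k *: W (q - k) (A0 (k - nu%:Z) x)).
Proof.
apply: bounded_scale; elim/tensor_ind: x => [|s t hs ht|u P].
- exists 0 => k _; rewrite (morphD0 (A0D _)) (morphD0 (WD _)) //.
- rewrite (_ : (fun k => _) = (fun k => W (q - k) (A0 (k - nu%:Z) s) +
    W (q - k) (A0 (k - nu%:Z) t))); first exact: boundedD.
  by apply: funext => k; rewrite A0D WD.
have [B hB] := term_bounded2 q u P (fun=> 1).
exists B => k hk; rewrite W_pure; apply: zsum0 => j.
by have := hB k j (or_introl hk); rewrite scale1r.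
Qed.

(** After a(z)^2 has been replaced by a multiple of phi2(z), the factor psi(w) of the
    third field is inert and only phi2(z) phi(w) and its derivatives at w = z remain. *)
Lemma three_modes_zero q x :
  zsum (fun k => zsum (fun i => falling nu (k%:~R) *:
     A2 i (A1 (q - k - i) (A0 (k - nu%:Z) x)))) = 0.
Proof.
transitivity (zsum (fun k => falling nu (k%:~R) *: W (q - k) (A0 (k - nu%:Z) x))).
  by apply: eq_zsum => k; rewrite /W zsumZ //; exact: square_bounded.
elim/tensor_ind: x => [|s t hs ht|u P].
- by apply: zsum0 => k; rewrite (morphD0 (A0D _)) (morphD0 (WD _)) scaler0.
- rewrite -[RHS]addr0 -{1}hs -ht -zsumD; [|exact: term_bounded|exact: term_bounded].
  by apply: eq_zsum => k; rewrite A0D WD scalerDr.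
transitivity (zsum (fun k => zsum (fun j => falling nu (k%:~R) *: (kappa *:
  tpure (psi j u) (phi2 (C - (q - k)) (phi (j - (k - nu%:Z) - 1 - e) P)))))).
  apply: eq_zsum => k; rewrite W_pure zsumZ //; apply: boundedZ.
  have [B hB] := term_bounded2 q u P (fun=> 1).
  have [J hJ] := psi_trunc u; have [B' hB'] := phi_trunc P.
  apply: (@bounded_between _ (B' + (k - nu%:Z) + 1 + e) J) => j hj; last by rewrite hJ // tpure0l.
  by rewrite [phi _ _]hB' ?(morphD0 (linear_morphD (phi2_linear _))) ?tpure0r //; lia.
rewrite zsum_exchange; last exact: term_bounded2.
(* For a fixed mode j of psi, the index k of the third field is traded for the
   mode m = Z - k of phi. *)
apply: zsum0 => j; pose Z := j + nu%:Z - 1 - e.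
rewrite -(zsum_reflect Z).
transitivity (zsum (fun m => kappa *: tpure (psi j u)
   (falling nu (Z%:~R - m%:~R) *: phi2 (C - q + Z - m) (phi m P)))).
  apply: eq_zsum => m; rewrite tpureZr !scalerA [kappa * _]mulrC.
  rewrite (_ : C - (q - (Z - m)) = C - q + Z - m); last by ring.
  rewrite (_ : j - (Z - m - nu%:Z) - 1 - e = m); last by rewrite /Z; ring.
  by rewrite intrB.
have bb : bounded (fun m => falling nu (Z%:~R - m%:~R : K) *: phi2 (C - q + Z - m) (phi m P)).
  have [B hB] := phi2_trunc P; apply: bounded_scale.
  by apply: (@bounded_between _ B (C - q + Z - B)) => m hm; apply: hB; [right|left; lia].
rewrite -zsumZ -1?(zsum_morph (linear_morphD (tpure_linearr (psi j u)))) //.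
  by rewrite phi2_vanishing tpure0r scaler0.
by apply: bounded_morph => //; exact: (linear_morphD (tpure_linearr _)).
Qed.

End ThreeModes.

(** * Specialization to the Fock space *)

(** The condition on powers of z in the definition of the modes determines the
    second index from the first. *)
Lemma fsum_graph (V : zmodType) (G : int -> int -> V) (g : int -> int)
    (S : set (int * int)) : (forall t, S t <-> t.2 = g t.1) ->
  \sum_(t \in S) G t.1 t.2 = zsum (fun i => G i (g i)).
Proof.
move=> hS; rewrite /zsum (@reindex_fsbig _ _ _ _ _ (fun i : int => (i, g i)) [set: int] S) //.
split=> [i _|i j _ _ [//]|[i j] /hS /= ->].
  by apply/hS.
by exists i.
Qed.

Section VertexFock.
Variables (K : numFieldType).
Local Notation fock := (ipoly K).
Local Notation phi be := (vertex (pgen K) (@pderiv K) be).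
Let Dl := @pderiv_linear K.
Let D1 n : pderiv n.+1 (1 : fock) = 0. Proof. exact: pderiv1. Qed.
Let Dg n j (P : fock) : pderiv n.+1 (pgen K j.+1 * P) =
  (n == j)%:R *: P + pgen K j.+1 * pderiv n.+1 P.
Proof. exact: pderiv_genM. Qed.

Definition fock_phi_linear be := vertex_linear Dl D1 Dg (@ipoly_ind K) be.
Definition fock_phi_truncated be := vertex_truncated Dl D1 Dg (@ipoly_ind K) be.
Definition fock_nop_truncated al be := normal_product_truncated Dl D1 Dg (@ipoly_ind K) al be.
Definition fock_nop_sym al := normal_product_sym Dl D1 Dg (@ipoly_ind K) al.
Definition fock_phi_mul al be := vertex_mul Dl D1 Dg (@ipoly_ind K) al be.
Definition fock_phi_diagonal al := vertex_diagonal Dl D1 Dg (@ipoly_ind K) al.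
Definition fock_phi_vanishing N nu al be :=
  @vertex_vanishing K _ _ _ Dl D1 Dg (@ipoly_ind K) N nu al be.
Definition fock_phi_mul_truncated N al be :=
  @vertex_mul_truncated K _ _ _ Dl D1 Dg (@ipoly_ind K) N al be.
Lemma vertex_vacuum be d : d < 0 -> phi be d (1 : fock) = 0.
Proof.
move=> hd; apply: zsum0 => t; have e := ann1 Dl D1 Dg (@ipoly_ind K) be t.
have [t0|t0] := eqVneq t 0; last first.
  rewrite (negbTE t0) in e; apply: (etrans (congr1 ( *%R _) e)); exact: mulr0.
have -> : cre (pgen K) be (d + t) = 0 by rewrite cre_neg // t0 addr0.
exact: mul0r.
Qed.

End VertexFock.

(** * The two sectors of the minimal model *)

(** The properties of psi'(z) psi(w) that enter the product with vertex operators: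
    truncation, locality and a scalar restriction to z = w. *)
Definition local_pair (K : numFieldType) (hf : K) (N : int) (M M' : lmodType K)
    (psi : int -> {linear M -> M'}) (psi' : int -> {linear M' -> M}) : Prop :=
  [/\ forall u, exists B : int, forall j, B < j -> psi j u = 0,
      forall u, exists B : int, forall i j, B < i + j -> psi' i (psi j u) = 0,
      forall u, exists B : int, forall a b, B < b -> product_coef hf N psi psi' a b u = 0,
      forall a b u, product_coef hf N psi psi' a b u = product_coef hf N psi psi' b a u
    & exists kappa : K, forall q u,
        diagonal_coef hf N psi psi' q u = if q == - N then kappa *: u else 0].

Lemma primary_local_pair (K : numFieldType) (c h h' hf delta delta' : K) (N : int)
    (M M' : lmodType K) (L : int -> {linear M -> M}) (L' : int -> {linear M' -> M'})
    (v : M) (v' : M')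
    (psi : int -> {linear M -> M'}) (psi' : int -> {linear M' -> M}) :
  irreducible_hw_module c h L v -> irreducible_hw_module c h' L' v' ->
  primary_field hf delta L L' psi -> primary_field hf delta' L' L psi' ->
  h + hf = h' + delta -> h' + hf = h + delta' -> N%:~R = delta + delta ->
  (forall n, binom_conv (hf + hf) (fun n => psi' n (psi (- n) v)) n =
     binom_conv (hf + hf) (fun n => psi' n (psi (- n) v)) (N - n)) ->
  local_pair hf N psi psi'.
Proof.
move=> hM hM' hpsi hpsi' hd hd' hN top.
have sym : forall a b, a + b + N = 0 ->
    product_coef hf N psi psi' a b v = product_coef hf N psi psi' b a v.
  move=> a b hab; rewrite product_coef_top // product_coef_top; last by lia.
  by rewrite top; congr binom_conv; lia.
split.
- exact: (primary_truncated hM hM' hpsi hd).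
- move=> u; elim/(homogeneous_ind hM): u => [|x y [B hB] [B' hB']|k x hx].
  + by exists 0 => i j _; rewrite !linear0.
  + by exists (`|B| + `|B'|) => i j hij; rewrite !linearD hB ?hB' ?addr0 //; lia.
  + exists k => i j hij.
    have := primary_homogeneous hpsi' hd' i (primary_homogeneous hpsi hd j hx).
    by move/(homogeneous_neg hM); apply; lia.
- exact: (product_coef_truncated N psi' hM hM' hpsi hd).
- exact: (product_sym hM hM' hpsi hpsi' hd hd' hN sym).
- exact: (diagonal_coef_scalar hM hM' hpsi hpsi' hd hd' hN sym).
Qed.

Section Sectors.
Variables (R : realType) (p : nat).
Local Notation C := (R[i])%C.
Hypotheses (hp : (4 <= p)%N) (hp3 : ~~ (3 %| p)%N).
Local Notation h := (weight21 R p).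
Local Notation s := (shift21 R p).

Lemma shift21E : s = h + h.
Proof. by rewrite /shift21 /weight21; field. Qed.

Lemma shift21D : (p - 2)%N%:R = s + s.
Proof. by rewrite natrB ?(leq_trans _ hp) // /shift21; field. Qed.

Lemma beta_sq : beta R p * beta R p = s.
Proof.
have b0 : 0 <= (p%:R - 2%:R) / 2%:R :> R.
  by rewrite divr_ge0 ?ler0n // subr_ge0 ler_nat (leq_trans _ hp).
rewrite /beta -rmorphM /= -expr2 sqr_sqrtr //.
by rewrite /shift21 rmorphM rmorphB /= fmorphV !rmorph_nat.
Qed.

(* The coefficient of the null vector L_(-1)^2 - t L_(-2) of M_(2,1). *)
Let t : C := p%:R / 3%:R.

Let t_h : 3%:R * t = 2%:R + 4%:R * h.
Proof. by rewrite /t /weight21; field. Qed.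

Let c_t : central_charge R p * t = 12%:R * h - 8%:R * h * t.
Proof.
rewrite /t /weight21 /central_charge; field.
by rewrite pnatr_eq0; case: p hp.
Qed.

Let t_nint (n : int) : n%:~R != t.
Proof.
apply/eqP => e; have : (3 * n)%:~R = (p%:Z)%:~R :> C.
  by rewrite intrM e /t; field.
move/eqP; rewrite eqr_int => /eqP e3; move/negP: hp3; apply.
by apply/dvdnP; exists (absz n); lia.
Qed.

Let t2_nint (n : int) : n%:~R != t + t.
Proof.
apply/eqP => e; have : (3 * n)%:~R = ((p + p)%N%:Z)%:~R :> C.
  by rewrite intrM e PoszD intrD /t; field.
move/eqP; rewrite eqr_int => /eqP e3; move/negP: hp3; apply.
have : (3 %| 2 * p)%N by apply/dvdnP; exists (absz n); lia.
by rewrite Gauss_dvdr.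
Qed.

Variables (M11 M21 : lmodType C).
Variables (L11 : int -> {linear M11 -> M11}) (L21 : int -> {linear M21 -> M21}).
Variables (v11 : M11) (v21 : M21).
Variables (psi12 : int -> {linear M11 -> M21}) (psi21 : int -> {linear M21 -> M11}).
Hypothesis hM11 : irreducible_hw_module (central_charge R p) 0 L11 v11.
Hypothesis hM21 : irreducible_hw_module (central_charge R p) h L21 v21.
Hypothesis hpsi12 : primary_field h 0 L11 L21 psi12.
Hypothesis hpsi21 : primary_field h s L21 L11 psi21.

Let d0 : 0 + h = h + 0. Proof. by rewrite addrC. Qed.
Let d1 : h + h = 0 + s. Proof. by rewrite add0r shift21E. Qed.

(** On M_(1,1) the matrix element is constant, which is symmetric as N = 0. *)
Lemma vacuum_local_pair : local_pair h 0 psi12 psi21.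
Proof.
apply: (primary_local_pair hM11 hM21 hpsi12 hpsi21) => //; first by rewrite addr0.
move=> n; case: (eqVneq n 0) => [->|n0]; first by rewrite subr0.
have y_neg := top_coef_neg psi21 hM11 hM21 hpsi12 d0.
have y_rec := vacuum_recursion hM11 hpsi12 hpsi21 d0 d1 erefl (vacuum_null hM11).
by rewrite !(binom_conv_inverse y_neg y_rec) // sub0r oppr_eq0.
Qed.

Lemma level2_local_pair : local_pair h (p - 2)%N psi21 psi12.
Proof.
apply: (primary_local_pair hM21 hM11 hpsi21 hpsi12) => //; first exact: shift21D.
have y_neg := top_coef_neg psi12 hM21 hM11 hpsi21 d1.
have y_rec := level2_recursion hM21 hM11 hpsi21 hpsi12 d1 d0 erefl shift21E t_h
  (level2_null hM21 t_h c_t).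
have hN : (p - 2)%N%:R = (h + h) + (h + h) by rewrite -shift21E shift21D.
exact: (conv_palindromic erefl t_h hN t_nint t2_nint y_neg y_rec).
Qed.

End Sectors.

(** * The modes of a(z) on the homogeneous components *)

(** A plane of triples is parametrized by two of its coordinates. *)
Lemma fsum_triple (V : zmodType) (n : int) (G : int -> int -> int -> V) :
  bounded2 (fun k i => G i (n - k - i) k) ->
  \sum_(t \in [set t : int * int * int | t.1.1 + t.1.2 + t.2 = n]) G t.1.1 t.1.2 t.2 =
  zsum (fun k => zsum (fun i => G i (n - k - i) k)).
Proof.
case=> B hB; pose g (q : int * int) := G q.2 (n - q.1 - q.2) q.1.
rewrite (@reindex_fsbig _ _ _ _ _ (fun q : int * int => (q.2, n - q.1 - q.2, q.1))
  [set: int * int]); last first.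
  split=> [[k i] _ /=|[k i] [k' i'] _ _ /= [-> _ ->] //|[[i j] k] /= <-].
    by ring.
  by exists (k, i) => //=; congr (_, _, _); ring.
rewrite -/(g _).
rewrite -(@fsbig_widen _ _ _ _ ([set` int_range (absz B)] `*` [set` int_range (absz B)])) //;
  last first.
  move=> [k i] [_ /= hki]; apply: hB; apply: contrapT => h; apply: hki.
  by split; rewrite /= mem_int_range; apply/negP => h'; apply: h; [left|right]; lia.
rewrite -(@pair_fsbig _ _ _ _ _ _ _ (fun k i => G i (n - k - i) k));
  [|exact: finite_seq|exact: finite_seq].
rewrite (@zsumE _ (absz B)); last first.
  by move=> k hk; apply: zsum0 => i; apply: hB; left; lia.
rewrite -fsbig_seq ?int_range_uniq //; apply: eq_bigr => k _.
rewrite -fsbig_seq ?int_range_uniq // (@zsumE _ (absz B)) // => i hi.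
by apply: hB; right; lia.
Qed.

(** Differentiating \sum_k A_k z^(- k - 1) shifts the index and multiplies by - k. *)
Lemma iter_field_deriv (K : numFieldType) (V : lmodType K) (A : int -> V -> V) nu k x :
  iter nu (@field_deriv K V) A k x = ((-1) ^+ nu * falling nu (k%:~R)) *: A (k - nu%:Z) x.
Proof.
elim: nu k => [|nu IH] k; first by rewrite /falling big_geq // mul1r scale1r subr0.
rewrite /= /field_deriv IH scalerA (_ : k - 1 - nu%:Z = k - nu.+1%:Z); last by lia.
congr (_ *: _); rewrite -[k%:~R in RHS](subrK 1) falling_shift intrB exprS; ring.
Qed.

Section Grading.
Variable p : nat.

(** The integer part of n / 2, also for negative n. *)
Definition half (n : int) : int :=
  match n with Posz m => m./2%:Z | Negz m => - (uphalf m.+1)%:Z end.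

Lemma halfE n : n = half n + half n + (oddz n)%:Z.
Proof. by case: n => n; rewrite /oddz /half /=; lia. Qed.

Lemma oddzB n : oddz n = ~~ oddz (n - 1).
Proof. by rewrite /oddz; lia. Qed.

(** On V_n the field a(z) carries the power z^(n beta^2) from the charge, and z^(- s)
    from psi if n is odd. As beta^2 = s, the total exponent is the integer
    (p - 2) (integer part of n / 2). *)
Definition charge_shift (n : int) : int := half n * (p - 2)%N%:Z.

Definition parity_shift (b : bool) : int := if b then (p - 2)%N%:Z else 0.

Lemma charge_shiftS n : charge_shift n = charge_shift (n - 1) + parity_shift (oddz (n - 1)).
Proof.
have e1 := halfE n; have e2 := halfE (n - 1); have := oddzB n.
rewrite /charge_shift /parity_shift; move: e1 e2.
case: (oddz (n - 1)) => /= e1 e2 e3; rewrite e3 /= in e1.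
  by rewrite (_ : half n = half (n - 1) + 1); [rewrite mulrDl mul1r|lia].
by rewrite (_ : half n = half (n - 1)) ?addr0 //; lia.
Qed.

End Grading.

Section Components.
Variables (R : realType) (p : nat).
Local Notation C := (R[i])%C.
Hypotheses (hp : (4 <= p)%N).
Variables (M11 M21 : lmodType C).
Variables (psi12 : int -> {linear M11 -> M21}) (psi21 : int -> {linear M21 -> M11}).
Local Notation h := (weight21 R p).
Hypothesis pair12 : local_pair h 0 psi12 psi21.
Hypothesis pair21 : local_pair h (p - 2)%N psi21 psi12.
Local Notation fock := (ipoly C).
Local Notation phi := (vertex (pgen C) (@pderiv C)).
Local Notation Mpar := (Mpar M11 M21).

(** The modes of psi bundled as linear maps, for every pair of parities. *)
Definition psi_linear (b b' : bool) (i : int) : {linear Mpar b -> Mpar b'} :=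
  match b, b' return {linear Mpar b -> Mpar b'} with
  | false, true => psi12 i
  | true, false => psi21 i
  | _, _ => \0%R
  end.

Lemma psi_linearE b b' i x : psi_mode psi12 psi21 b' i x = psi_linear b b' i x.
Proof. by case: b b' x => [] []. Qed.

Lemma psi_local_pair b :
  local_pair h (parity_shift p b) (psi_linear b (~~ b)) (psi_linear (~~ b) b).
Proof. by case: b. Qed.

Definition mode b b' e k : tensor (Mpar b) fock -> tensor (Mpar b') fock :=
  product_mode (phi (beta R p)) (psi_linear b b') e k.
Arguments mode : clear implicits.

Lemma charge_shiftE n : (charge_shift p n)%:~R =
  n%:~R * shift21 R p - psi_shift R p (oddz n) :> C.
Proof.
rewrite {2}(halfE n) /charge_shift intrM -[(p - 2)%N%:~R]/((p - 2)%N%:R) shift21D //.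
rewrite !intrD /psi_shift; case: (oddz n) => /=.
  by rewrite -[1%:~R]/1; ring.
by rewrite mulr0z; ring.
Qed.

Lemma a_compE k n (x : Vn M11 M21 (n - 1)) : a_comp p psi12 psi21 k x =
  mode (oddz (n - 1)) (oddz n) (charge_shift p (n - 1)) k x.
Proof.
rewrite /a_comp /mode /product_mode.
rewrite (@fsum_graph _ (fun i j => tmap (@psi_mode R M11 M21 psi12 psi21 (oddz (n - 1)) (oddz n) i)
  (phi_mode ((n - 1)%:~R * beta R p) (beta R p) j) x)
  (fun i => i - k - 1 - charge_shift p (n - 1))).
  apply: eq_zsum => i; congr (tlift _ x); apply: funext => u; apply: funext => P.
  by rewrite psi_linearE phi_modeE.
move=> [i j] /=; rewrite mulrCA beta_sq // -[psi_shift _ _ _](subKr ((n - 1)%:~R * shift21 R p)).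
rewrite -charge_shiftE; set q := _ * shift21 R p; set e := charge_shift p (n - 1).
split=> [hq|->].
  apply/eqP; rewrite -(eqr_int C); apply/eqP; rewrite !intrB.
  have -> : j%:~R = (- i%:~R - (q - e%:~R) + (j%:~R + q)) + i%:~R - e%:~R :> C by ring.
  by rewrite hq; ring.
by rewrite !intrB; ring.
Qed.

Let psi_trunc b b' u : exists B : int, forall j, B < j -> psi_linear b b' j u = 0.
Proof.
case: b b' u => [] [] u /=; try by exists 0.
  by have [h1 _ _ _ _] := pair21; exact: h1.
by have [h1 _ _ _ _] := pair12; exact: h1.
Qed.

Let phi_lin := @fock_phi_linear C.
Let phi_trunc := @fock_phi_truncated C.

Lemma mode_linear b b' e k : linear (mode b b' e k).
Proof. exact: (product_mode_linear (phi_lin _) (phi_trunc _) (@psi_trunc b b')). Qed.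

Lemma mode_truncated b b' e x : exists B : int, forall k, B < k -> mode b b' e k x = 0.
Proof. exact: (product_mode_truncated (phi_lin _) (phi_trunc _) (@psi_trunc b b')). Qed.

Let beta_h : beta R p * beta R p = h + h.
Proof. by rewrite beta_sq // shift21E. Qed.

Let phi_mul m n P : phi (beta R p) m (phi (beta R p) n P) =
  zsum (fun r => binom_coef (h + h) r *:
    normal_product (pgen C) (@pderiv C) (beta R p) (beta R p) (m + r) (n - r) P).
Proof. by rewrite fock_phi_mul beta_h. Qed.

Lemma mode_comm b e k l x :
  mode (~~ b) b (e + parity_shift p b) k (mode b (~~ b) e l x) =
  mode (~~ b) b (e + parity_shift p b) l (mode b (~~ b) e k x).
Proof.
have [h1 h2 h3 h4 [kappa h5]] := psi_local_pair b.
exact: (two_modes_comm (phi_lin _) (phi_trunc _) phi_mul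
  (fock_nop_truncated _ _) (fock_nop_sym _) h1 (@psi_trunc (~~ b) b) h2 h3 h4).
Qed.

Lemma mode_diagonal b e : exists kappa : C, forall q u P,
  zsum (fun i => mode (~~ b) b (e + parity_shift p b) i
     (mode b (~~ b) e (q - i) (tpure u P))) =
  kappa *: tpure u (phi (beta R p + beta R p) (- parity_shift p b - q - 2%:R - e - e) P).
Proof.
have [h1 h2 h3 h4 [kappa h5]] := psi_local_pair b; exists kappa => q u P.
exact: (two_modes_diagonal (phi_lin _) (phi_trunc _) phi_mul
  (fock_nop_truncated _ _) (fock_phi_diagonal _) h1 (@psi_trunc (~~ b) b) h2 h3 h4 h5).
Qed.

Lemma mode_three_zero nu b e q x : (nu <= p - 3)%N ->
  let e1 := e + parity_shift p b in let e2 := e1 + parity_shift p (~~ b) in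
  zsum (fun k => zsum (fun i => falling nu (k%:~R) *:
     mode b (~~ b) e2 i (mode (~~ b) b e1 (q - k - i)
       (mode b (~~ b) e (k - nu%:Z) x)))) = 0.
Proof.
move=> hnu e1 e2.
have hN : (beta R p + beta R p) * beta R p = (p - 2)%N%:R.
  by rewrite mulrDl beta_sq // shift21D.
have hnu' : (nu < p - 2)%N by lia.
have [kappa hk] := mode_diagonal (~~ b) e1; rewrite negbK in hk.
apply: (@three_modes_zero _ _ _ _ (phi_lin _) (phi_trunc _) (phi_lin _)
   (fun P => fock_phi_mul_truncated P hN) nu
   (fun q c P => fock_phi_vanishing q c P hN hnu') _ _ _ (@psi_trunc b (~~ b)) _
   (mode (~~ b) b e1) (mode b (~~ b) e2)).
- by move=> k; exact: mode_linear.
- by move=> k; exact: mode_linear.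
- by move=> y; exact: mode_truncated.
- by move=> k l y; have := @mode_comm (~~ b) e1 k l y; rewrite negbK.
- move=> q' u P.
  rewrite (_ : zsum _ = kappa *: tpure u (phi (beta R p + beta R p)
    (- parity_shift p (~~ b) - q' - 2%:R - e1 - e1) P)); last exact: hk.
  rewrite (_ : - parity_shift p (~~ b) - q' - 2%:R - e1 - e1 =
    (- parity_shift p (~~ b) - 2%:R - e1 - e1) - q'); last by ring.
  by [].
Qed.

End Components.

(** * The modes of a(z) on the direct sum *)

Section IntegerDirectSum.
Variables (K : fieldType) (W : int -> lmodType K).
Implicit Types x y : dsum W.

Lemma dsum_bounded x : exists B : nat, forall n, B%:Z < `|n| -> x n = 0.
Proof.
have [s hs] : exists s : seq int, forall n, x n != 0 -> n \in s.
  have /finite_seqP[s hs] := dsum_fin x; exists s => n hn.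
  by have : [set` s] n by rewrite -hs.
pose b := (\max_(n <- s) absz n)%N; exists b => n hn; apply/eqP; apply: contraT => /hs ns.
have : (absz n <= b)%N by exact: (@leq_bigmax_seq int s xpredT absz n ns isT).
by move: b hn => b; lia.
Qed.

Lemma dsum_inj_val n m (y : W n) : m != n -> dsum_inj y m = 0.
Proof. by move=> mn; rewrite /dsum_inj /= dfwith_out // eq_sym. Qed.

Lemma dsum_inj_same n (y : W n) : dsum_inj y n = y.
Proof. by rewrite /dsum_inj /= dfwith_in. Qed.

Lemma zsum_dsum_val (F : int -> dsum W) n : bounded F ->
  zsum F n = zsum (fun m => F m n).
Proof. by move=> hF; apply: (zsum_morph (f := fun x : dsum W => x n)). Qed.

End IntegerDirectSum.

Arguments mode {R} p {M11 M21} psi12 psi21 b b' e k x : rename.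

Section Modes.
Variables (R : realType) (p : nat).
Local Notation C := (R[i])%C.
Hypotheses (hp : (4 <= p)%N).
Variables (M11 M21 : lmodType C).
Variables (psi12 : int -> {linear M11 -> M21}) (psi21 : int -> {linear M21 -> M11}).
Local Notation h := (weight21 R p).
Hypothesis pair12 : local_pair h 0 psi12 psi21.
Hypothesis pair21 : local_pair h (p - 2)%N psi21 psi12.
Local Notation V := (Vspace M11 M21).
Local Notation a := (a_mode p psi12 psi21).
Local Notation ac := (a_comp p psi12 psi21).

Lemma a_comp_linear k n : linear (@a_comp R p M11 M21 psi12 psi21 k n).
Proof. by move=> al x y; rewrite !(a_compE hp); exact: mode_linear. Qed.

Let acD k n := linear_morphD (@a_comp_linear k n).

Lemma a_comp_truncated n (x : Vn M11 M21 (n - 1)) :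
  exists B : int, forall k, B < k -> ac k x = 0.
Proof.
have [B hB] := mode_truncated pair12 pair21 (oddz n) (charge_shift p (n - 1)) x.
by exists B => k hk; rewrite a_compE // hB.
Qed.

Lemma a_comp_comm k l n (x : Vn M11 M21 (n - 1 - 1)) :
  ac k (ac l x : Vn M11 M21 (n - 1)) = ac l (ac k x : Vn M11 M21 (n - 1)) :> Vn M11 M21 n.
Proof.
rewrite !(a_compE hp) (charge_shiftS p (n - 1)).
(* All parities and shifts are expressed through those of the source, so that
   one general sector b with an arbitrary shift e remains. *)
have e1 := oddzB n; have e2 := oddzB (n - 1); rewrite e2 negbK in e1.
move: (charge_shift p (n - 1 - 1)) => e; move: x; rewrite /Vn.
rewrite e1 e2; move: (oddz (n - 1 - 1)) => b x.
exact: mode_comm.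
Qed.

Lemma a_comp_three_zero nu q n (x : Vn M11 M21 (n - 1 - 1 - 1)) : (nu <= p - 3)%N ->
  zsum (fun k => zsum (fun i => falling nu (k%:~R) *:
    (ac i (ac (q - k - i) (ac (k - nu%:Z) x : Vn M11 M21 (n - 1 - 1)) : Vn M11 M21 (n - 1))
      : Vn M11 M21 n))) = 0.
Proof.
move=> hnu.
have e1 := oddzB (n - 1 - 1); have e2 := oddzB (n - 1); have e3 := oddzB n.
rewrite e1 negbK in e2; rewrite e2 in e3.
transitivity (zsum (fun k => zsum (fun i => falling nu (k%:~R) *:
  mode p psi12 psi21 (oddz (n - 1)) (oddz n) (charge_shift p (n - 1)) i
    (mode p psi12 psi21 (oddz (n - 1 - 1)) (oddz (n - 1)) (charge_shift p (n - 1 - 1)) (q - k - i)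
       (mode p psi12 psi21 (oddz (n - 1 - 1 - 1)) (oddz (n - 1 - 1))
          (charge_shift p (n - 1 - 1 - 1)) (k - nu%:Z) x))))).
  by apply: eq_zsum => k; apply: eq_zsum => i; rewrite !(a_compE hp).
rewrite (charge_shiftS p (n - 1)) (charge_shiftS p (n - 1 - 1)).
move: (charge_shift p (n - 1 - 1 - 1)) => e; move: x; rewrite /Vn e3 e2 e1.
move: (oddz (n - 1 - 1 - 1)) => b x.
exact: (mode_three_zero hp pair12 pair21 e q x hnu).
Qed.

Lemma a_modeE k x n : a k x n = ac k (x (n - 1)) :> Vn M11 M21 n.
Proof.
have [B hB] := dsum_bounded x.
have ac0 m : ac k (0 : Vn M11 M21 (m - 1)) = 0 := morphD0 (@acD k m).
rewrite /a_mode -[\sum_(m \in _) _]/(zsum _) zsum_dsum_val; last first.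
  exists (B%:Z + 1) => m hm; rewrite hB; last by lia.
  by apply: dsumP => j; rewrite ac0; case: (eqVneq j m) => [->|jm];
    rewrite ?dsum_inj_same ?dsum_inj_val.
rewrite (zsum_single (c := n)) => [|m mn]; first exact: dsum_inj_same.
by rewrite dsum_inj_val // eq_sym.
Qed.

Lemma a_mode_linear k : linear (a k).
Proof.
move=> al x y; apply: dsumP => n; rewrite a_modeE.
change (ac k (al *: x (n - 1) + y (n - 1)) = al *: (a k x n) + a k y n).
by rewrite !a_modeE a_comp_linear.
Qed.

Let aD k := linear_morphD (a_mode_linear k).
Let aZ k := linear_scalable (a_mode_linear k).
Let a0 k := morphD0 (aD k).

Lemma a_mode_comm k l x : a k (a l x) = a l (a k x).
Proof.
by apply: dsumP => n; rewrite a_modeE [a l x _]a_modeE [RHS]a_modeE [a k x _]a_modeE a_comp_comm.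
Qed.

Lemma a_mode_truncated x : exists B : int, forall k, B < k -> a k x = 0.
Proof.
have [B hB] := dsum_bounded x.
have [B' hB'] : exists B' : int, forall n, n \in int_range B ->
    forall k, B' < k -> ac k (x (n + 1 - 1)) = 0 :> Vn M11 M21 (n + 1).
  elim: (int_range B) => [|m s [B1 h1]]; first by exists 0.
  have [B2 h2] := a_comp_truncated (x (m + 1 - 1)).
  exists (`|B1| + `|B2|) => n; rewrite in_cons => /orP[/eqP ->|ns] k hk.
    by apply: h2; lia.
  by apply: h1 => //; lia.
exists B' => k hk; apply: dsumP => n; rewrite a_modeE.
case: (leP `|n - 1| B%:Z) => hn; last by rewrite hB //; exact: morphD0 (@acD k n).
have := hB' (n - 1); rewrite mem_int_range => /(_ hn k hk).
by rewrite (_ : n - 1 + 1 = n) // subrK.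
Qed.

Lemma triple_bounded nu n x : exists B : int, forall i j k, i + j + k = n ->
  B < `|i| \/ B < `|j| \/ B < `|k| -> a i (a j (a (k - nu%:Z) x)) = 0.
Proof.
have [B hB] := a_mode_truncated x.
exists (`|B| + `|B| + `|B| + `|n| + `|nu%:Z|) => i j k hn h.
case: (ltP B (k - nu%:Z)) => hk; first by rewrite (hB _ hk) !a0.
case: (ltP B j) => hj; first by rewrite (a_mode_comm j) (hB _ hj) !a0.
case: (ltP B i) => hi.
  by rewrite a_mode_comm (a_mode_comm i (k - nu%:Z)) (hB _ hi) !a0.
by case: h => [h|[h|h]]; lia.
Qed.

(** On v_0 the modes psi_i with i > 0 vanish by degree, and phi_beta(z) |0> has no
    negative powers of z. *)
Lemma a_mode_vacuum (v11 : M11) n : (forall i, 0 < i -> psi12 i v11 = 0) ->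
  0 <= n -> a n (vac M21 v11) = 0.
Proof.
move=> hv n0; apply: dsumP => m; rewrite a_modeE.
case: (eqVneq m 1) => [->|m1]; last first.
  rewrite (_ : vac M21 v11 (m - 1) = 0); last by apply: dsum_inj_val; rewrite subr_eq0.
  exact: (morphD0 (@acD n m)).
rewrite (a_compE hp); change (mode p psi12 psi21 false true 0 n (vac M21 v11 0) = 0).
rewrite /vac dsum_inj_same.
apply: (etrans (product_mode_pure (fock_phi_linear _) _ _ _ _ _)); apply: zsum0 => i.
case: (ltP 0 i) => i0; first by rewrite /= hv //; exact: tpure0l.
have -> : vertex (pgen C) (@pderiv C) (beta R p) (i - n - 1 - 0) 1 = 0.
  by apply: vertex_vacuum; lia.
exact: tpure0r.
Qed.

(** In each component of the direct sum this is the vanishing for three modes; the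
    sign of the derivative is moved into the vector. *)
Lemma a_square_derivative_eq0 nu : (nu <= p - 3)%N ->
  field_mul3_eq0 a a (iter nu (@field_deriv _ _) a).
Proof.
move=> hnu n x; set S := [set t | _]; set F := fun t => _.
have FE t : F t = ((-1) ^+ nu * falling nu (t.2%:~R)) *: a t.1.1 (a t.1.2 (a (t.2 - nu%:Z) x)).
  by rewrite /F iter_field_deriv !aZ.
have [B hB] := triple_bounded nu n x.
have F0 t : S t -> B < `|t.1.1| \/ B < `|t.1.2| \/ B < `|t.2| -> F t = 0.
  by move=> St ht; rewrite FE hB ?scaler0.
split.
  have [r hr] : exists r : seq int, forall m, `|m| <= B -> m \in r.
    by exists (int_range (absz B)) => m; rewrite mem_int_range; lia.
  apply: (@sub_finite_set _ _ [set` [seq (ij, k) | ij <- [seq (i, j) | i <- r, j <- r], k <- r]]).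
    move=> [[i j] k] /= [St /eqP Ft].
    have hij : (`|i| <= B) /\ (`|j| <= B) /\ (`|k| <= B).
      by split; [|split]; rewrite leNgt; apply/negP => h; apply: Ft;
        apply: (F0 _ St); [left|right; left|right; right].
    apply/allpairsP; exists ((i, j), k); split=> //=; last by apply: hr; tauto.
    by apply/allpairsP; exists (i, j); split=> //=; apply: hr; tauto.
  exact: finite_seq.
pose B' := `|B|.
have G0 k i : B' < `|k| \/ B' < `|i| ->
    ((-1) ^+ nu * falling nu (k%:~R)) *: a i (a (n - k - i) (a (k - nu%:Z) x)) = 0.
  by move=> hki; rewrite hB ?scaler0 //; [lia|case: hki; lia].
pose G i j k := ((-1) ^+ nu * falling nu (k%:~R)) *: a i (a j (a (k - nu%:Z) x)).
rewrite (_ : F = fun t => G t.1.1 t.1.2 t.2); last by apply: funext.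
rewrite /S (@fsum_triple _ n G); last first.
  by exists B' => k i hki; apply: G0; tauto.
apply: dsumP => m; rewrite zsum_dsum_val; last first.
  by exists B' => k hk; apply: zsum0 => i; apply: G0; left.
rewrite -[RHS](@a_comp_three_zero nu n m ((-1) ^+ nu *: x (m - 1 - 1 - 1)) hnu).
apply: eq_zsum => k; rewrite zsum_dsum_val; last first.
  by exists B' => i hi; apply: G0; right.
apply: eq_zsum => i.
have -> : G i (n - k - i) k =
  falling nu k%:~R *: a i (a (n - k - i) (a (k - nu%:Z) ((-1) ^+ nu *: x))).
  by rewrite /G !aZ scalerA mulrC.
set y := (-1) ^+ nu *: x.
change (falling nu k%:~R *: (a i (a (n - k - i) (a (k - nu%:Z) y)) m : Vn M11 M21 m) =
  falling nu k%:~R *: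
    ac i (ac (n - k - i) (ac (k - nu%:Z) (y (m - 1 - 1 - 1)))) :> Vn M11 M21 m).
by rewrite !a_modeE.
Qed.
End Modes.

(** * Polynomials in commuting operators *)

Lemma linear_sum (K : pzRingType) (U V : lmodType K) (f : U -> V) (J : Type) (r : seq J)
  (P : pred J) (F : J -> U) : linear f ->
  f (\sum_(i <- r | P i) F i) = \sum_(i <- r | P i) f (F i).
Proof.
move=> lf; have fD := linear_morphD lf; exact: (big_morph f fD (morphD0 fD)).
Qed.

Section CommutingFold.
Variables (T : eqType) (U : Type) (f : T -> U -> U).
Hypothesis f_comm : forall i j w, f i (f j w) = f j (f i w).

Lemma foldr_comm_perm w s t : perm_eq s t -> foldr f w s = foldr f w t.
Proof.
elim: s t => [|i s IH] t; first by rewrite perm_sym => /perm_nilP ->.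
move=> hst; have it : i \in t by rewrite -(perm_mem hst) mem_head.
move: hst; case/splitPr: it => t1 t2.
rewrite perm_sym -cat1s perm_catCA cat1s perm_cons perm_sym => /IH /= ->.
by elim: t1 => //= j t1 <-.
Qed.

End CommutingFold.

Section PolynomialAction.
Variables (K : fieldType) (V : lmodType K) (X : nat -> V -> V).
Hypothesis X_comm : forall i j w, X i (X j w) = X j (X i w).

(** The action of one monomial in the definition of poly_act. *)
Definition monomial_act (m : {cmonom nat}) (w : V) : V :=
  foldr (fun i w => iter (m i) (X i.+1) w) w (finsupp m).

Let powers_comm (m : {cmonom nat}) i j w :
  iter (m i) (X i.+1) (iter (m j) (X j.+1) w) =
  iter (m j) (X j.+1) (iter (m i) (X i.+1) w).
Proof.
elim: (m i) => [//|a /= ->].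
by elim: (m j) => [//|b /= <-]; exact: X_comm.
Qed.

Lemma monomial_actE (m : {cmonom nat}) w (s : seq nat) :
  uniq s -> (forall i, m i != 0%N -> i \in s) ->
  monomial_act m w = foldr (fun i w => iter (m i) (X i.+1) w) w s.
Proof.
move=> us hs; rewrite /monomial_act.
have -> : foldr (fun i w => iter (m i) (X i.+1) w) w s =
    foldr (fun i w => iter (m i) (X i.+1) w) w [seq i <- s | m i != 0%N].
  by elim: s {us hs} => //= i s ->; case: eqVneq => //= ->.
apply: foldr_comm_perm; first exact: powers_comm.
apply: uniq_perm; [exact: fset_uniq|exact: filter_uniq|move=> i].
by rewrite mem_filter mem_finsupp; case: (boolP (m i != 0%N)) => [/hs ->|].
Qed.

Lemma monomial_actS i (m : {cmonom nat}) w :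
  monomial_act (mmul (ucm i) m) w = X i.+1 (monomial_act m w).
Proof.
have nz j : mmul (ucm i) m j != 0%N -> j \in i :: rem i (undup (i :: finsupp m)).
  case: (eqVneq j i) => [->|ji]; first by rewrite mem_head.
  rewrite cmM cmU [i == j]eq_sym (negbTE ji) add0n => mj.
  by rewrite in_cons (negbTE ji) mem_rem_uniq ?undup_uniq // inE ji mem_undup
    in_cons mem_finsupp mj orbT.
set s := rem _ _ in nz.
have us : uniq (i :: s) by rewrite /= mem_rem_uniqF ?rem_uniq ?undup_uniq.
rewrite (monomial_actE _ us nz) (@monomial_actE m w (i :: s) us); last first.
  by move=> j mj; apply: nz; rewrite cmM; lia.
rewrite /= cmM cmUU /=; congr (X _ (iter _ _ _)).
elim: s us {nz} => //= j s IH; rewrite inE negb_or -andbA => /and4P[ij si _ us].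
rewrite IH; last by rewrite si.
by rewrite cmM cmU (negbTE ij).
Qed.

(** A common range of summation for several polynomials, from which linearity
    follows. *)
Lemma poly_act_sum (A : {fset {cmonom nat}}) (P : ipoly K) v :
  (msupp P `<=` A)%fset -> poly_act X P v = \sum_(m <- A) P@_m *: monomial_act m v.
Proof.
move=> hA; apply: big_fset_incl => // m _ hm.
by rewrite (mcoeff_outdom hm) scale0r.
Qed.

Lemma poly_act_linear v : linear (fun P : ipoly K => poly_act X P v).
Proof.
move=> c P Q; pose A := (msupp P `|` msupp Q `|` msupp (c *: P + Q))%fset.
rewrite (@poly_act_sum A (c *: P + Q)); last exact: fsubsetUr.
rewrite (@poly_act_sum A P); last by rewrite /A -fsetUA fsubsetUl.
rewrite (@poly_act_sum A Q); last by rewrite /A fsetUAC fsubsetUr.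
rewrite scaler_sumr -big_split; apply: eq_bigr => m _ /=.
by rewrite (mcoeffD m (c *: P) Q) (mcoeffZ c P m) scalerDl scalerA.
Qed.

Lemma poly_act_monomial m v : poly_act X (<< m >> : ipoly K) v = monomial_act m v.
Proof.
rewrite /poly_act; have -> : msupp (<< m >> : ipoly K) = [fset m]%fset.
  exact (@msuppU1 _ K m).
rewrite big_seq_fset1; have -> : (<< m >> : ipoly K)@_m = 1 by exact (@mcoeffUU _ K m 1).
by rewrite scale1r.
Qed.

Lemma poly_act_gen3 i j k v : (0 < i)%N -> (0 < j)%N -> (0 < k)%N ->
  poly_act X (pgen K i * pgen K j * pgen K k) v = X i (X j (X k v)).
Proof.
case: i j k => [//|i] [//|j] [//|k] _ _ _.
have -> : pgen K i.+1 * pgen K j.+1 * pgen K k.+1 =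
    << mmul (ucm i) (mmul (ucm j) (mmul (ucm k) mone)) >>.
  rewrite -(mulrA (pgen K i.+1)) mulm1.
  by rewrite -monomialM -monomialM.
rewrite poly_act_monomial !monomial_actS; congr (X _ (X _ (X _ _))).
by rewrite (@monomial_actE _ _ [::]) // => l; rewrite cm1.
Qed.

End PolynomialAction.

(** * The cubic relations *)

Lemma cubic_relation_cubic (K : fieldType) nu d : @cubic K (cubic_relation K nu d).
Proof.
pose Q (P : ipoly K) := @cubic K P.
have Q0 : Q 0 by exists [::]; rewrite big_nil.
have QD P P' : Q P -> Q P' -> Q (P + P').
  by case=> s -> [s' ->]; exists (s ++ s'); rewrite big_cat.
have Qc c i j k : Q (c *: (pgen K i * pgen K j * pgen K k)).
  by exists [:: (c, (i, j, k))]; rewrite big_seq1.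
rewrite -/(Q _) /cubic_relation.
apply: (big_ind Q Q0 QD) => i _; apply: (big_ind Q Q0 QD) => j _.
by apply: (big_ind Q Q0 QD) => k _; exact: Qc.
Qed.

Section CubicRelation.
Variables (K : numFieldType) (V : lmodType K) (a : int -> V -> V) (v : V).
Hypothesis a_linear : forall k, linear (a k).
Hypothesis a_comm : forall k l x, a k (a l x) = a l (a k x).
Hypothesis a_vac : forall n, 0 <= n -> a n v = 0.

(** The mode of d^nu a(z) with index nu - k is a multiple of a_(- k); the factor
    obtained by differentiation is the one of the cubic relation. *)
Lemma falling_reflect nu k : (-1) ^+ nu * falling nu ((nu%:Z - k%:Z)%:~R : K) =
  \prod_(1 <= l < nu.+1) (k%:R - l%:R).
Proof.
rewrite /falling big_add1 /= [in LHS]big_nat_rev /= add0n.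
rewrite -[in (-1) ^+ nu](subn0 nu) -prodr_const_nat -big_split /=.
apply: eq_big_nat => l hl; rewrite natrB; last by lia.
by rewrite intrB -!pmulrn -[l.+1%:R]natr1; ring.
Qed.

Lemma poly_act_cubic_relation nu d : poly_act (fun n => a (- n%:Z)) (cubic_relation K nu d) v =
  \sum_(1 <= i < d.+1) \sum_(1 <= j < d.+1) \sum_(1 <= k < d.+1 | (i + j + k == d)%N)
     (\prod_(1 <= l < nu.+1) (k%:R - l%:R : K)) *: a (- i%:Z) (a (- j%:Z) (a (- k%:Z) v)).
Proof.
have lf := @poly_act_linear K V (fun n => a (- n%:Z)) v.
rewrite /cubic_relation (linear_sum _ _ _ lf) big_nat_cond [RHS]big_nat_cond.
apply: eq_bigr => i; rewrite andbT => /andP[i0 _].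
rewrite (linear_sum _ _ _ lf) big_nat_cond [RHS]big_nat_cond.
apply: eq_bigr => j; rewrite andbT => /andP[j0 _].
rewrite (linear_sum _ _ _ lf) big_nat_cond [RHS]big_nat_cond.
apply: eq_bigr => k /andP[/andP[k0 _] _].
rewrite (linear_scalable lf); congr (_ *: _).
by apply: (poly_act_gen3 (X := fun n => a (- n%:Z))) => // *; exact: a_comm.
Qed.

Let aD k := linear_morphD (a_linear k).
Let aZ k := linear_scalable (a_linear k).
Let a0 k := morphD0 (aD k).

Let vac_triple i j k : 0 <= i \/ 0 <= j \/ 0 <= k -> a i (a j (a k v)) = 0.
Proof.
case: (leP 0 k) => hk; first by rewrite a_vac // !a0.
case: (leP 0 j) => hj; first by rewrite (a_comm j) a_vac // !a0.
by case=> [hi|]; [rewrite a_comm (a_comm i) a_vac // !a0|lia].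
Qed.

(** The coefficient of z^(d - nu - 3) in a(z)^2 d^nu a(z) v_0. Since a_n v_0 = 0 for
    n >= 0, the sum runs over negative indices - i, - j, - k, and i + j + k = d. *)
Lemma cubic_relation_mem nu d : field_mul3_eq0 a a (iter nu (@field_deriv _ _) a) ->
  relation_ideal a v (cubic_relation K nu d).
Proof.
pose G i j k := ((-1) ^+ nu * falling nu (k%:~R : K)) *: a i (a j (a (k - nu%:Z) v)).
pose n := nu%:Z - d%:Z.
have G0 i j k : 0 <= i \/ 0 <= j \/ 0 <= k - nu%:Z -> G i j k = 0.
  by move=> h; rewrite /G vac_triple ?scaler0.
have GE (i j k : nat) : G (- i%:Z) (- j%:Z) (nu%:Z - k%:Z) =
    (\prod_(1 <= l < nu.+1) (k%:R - l%:R)) *: a (- i%:Z) (a (- j%:Z) (a (- k%:Z) v)).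
  rewrite /G falling_reflect (_ : nu%:Z - k%:Z - nu%:Z = - k%:Z) //; last by ring.
case/(_ n v) => _ h; rewrite /relation_ideal /= poly_act_cubic_relation.
have {h} : \sum_(t \in [set t : int * int * int | t.1.1 + t.1.2 + t.2 = n]) G t.1.1 t.1.2 t.2 = 0.
  by rewrite -[RHS]h; apply: eq_fsbigr => t _; rewrite iter_field_deriv !aZ.
rewrite (@fsum_triple _ n G) => [h|]; last first.
  by exists (`|d%:Z| + `|nu%:Z|) => k i hki; apply: G0; rewrite /n; lia.
apply: etrans h.
rewrite -(zsum_reflect nu%:Z) (@zsum_nat _ d); last first.
  by move=> k hk; apply: zsum0 => i; apply: G0; rewrite /n; lia.
under [LHS]eq_bigr do rewrite (exchange_big_dep predT) //=.
rewrite exchange_big /=; apply: eq_big_nat => k hk.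
rewrite -(zsum_reflect 0) (@zsum_nat _ d); last first.
  by move=> i hi; apply: G0; rewrite /n; lia.
apply: eq_big_nat => i hi; rewrite sub0r.
case: (ltnP (k + i) d) => hd; last first.
  rewrite G0; last by rewrite /n; lia.
  by rewrite big_nat_cond big1 // => j; lia.
rewrite (_ : n - (nu%:Z - k%:Z) - - i%:Z = - (d - k - i)%N%:Z) ?GE; last by rewrite /n; lia.
have e j : (i + j + k == d)%N = (j == d - k - i)%N by apply/eqP/eqP; lia.
rewrite (eq_bigl _ _ e) big_nat1_eq (_ : (1 <= d - k - i < d.+1)%N = true) //; lia.
Qed.

End CubicRelation.

Lemma primary_annihilates_hw (K : numFieldType) (c h h' hf delta : K)
    (M M' : lmodType K) (L : int -> {linear M -> M}) (L' : int -> {linear M' -> M'})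
    (v : M) (v' : M') (psi : int -> {linear M -> M'}) n :
  irreducible_hw_module c h L v -> irreducible_hw_module c h' L' v' ->
  primary_field hf delta L L' psi -> h + hf = h' + delta -> 0 < n -> psi n v = 0.
Proof.
move=> hM hM' hpsi hd n0; have hv := primary_homogeneous hpsi hd n (homogeneous_hw hM).
by apply: (homogeneous_neg hM' hv); rewrite sub0r oppr_lt0.
Qed.

Theorem proposition2p4 (R : realType) (p : nat)
    (M11 M21 : lmodType R[i]%C)
    (L11 : int -> {linear M11 -> M11}) (L21 : int -> {linear M21 -> M21})
    (v11 : M11) (v21 : M21)
    (psi12 : int -> {linear M11 -> M21}) (psi21 : int -> {linear M21 -> M11})
    (hp : (4 <= p)%N) (hp3 : ~~ (3 %| p)%N)
    (hM11 : irreducible_hw_module (central_charge R p) 0 L11 v11)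
    (hM21 : irreducible_hw_module (central_charge R p) (weight21 R p) L21 v21)
    (hpsi12 : primary_field (weight21 R p) 0 L11 L21 psi12)
    (hpsi21 : primary_field (weight21 R p) (shift21 R p) L21 L11 psi21)
    (hpsi12_0 : psi12 0 v11 = v21) (hpsi21_0 : psi21 0 v21 = v11) :
  let a := a_mode p psi12 psi21 in
  forall nu : nat, (nu <= p - 3)%N ->
    field_mul3_eq0 a a (iter nu (@field_deriv _ _) a) /\
    forall d : nat,
      (relation_ideal a (vac M21 v11) `&` @cubic _) (cubic_relation _ nu d).
Proof.
move=> a nu hnu.
have pair12 := vacuum_local_pair hM11 hM21 hpsi12 hpsi21.
have pair21 := level2_local_pair hp hp3 hM11 hM21 hpsi12 hpsi21.
have hz := a_square_derivative_eq0 hp pair12 pair21 hnu.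
split=> [|d]; first exact: hz.
split; last exact: cubic_relation_cubic.
apply: cubic_relation_mem => //.
- exact: (a_mode_linear hp pair12 pair21).
- exact: (a_mode_comm hp pair12 pair21).
- move=> n; apply: (a_mode_vacuum hp pair12 pair21) => i.
  by apply: (primary_annihilates_hw hM11 hM21 hpsi12); rewrite addr0 add0r.
Qed.
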